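(* Let $\mathcal C,\mathcal D$ be unitary fusion categories, ${}_{\mathcal C}\mathcal M_{\mathcal D}$ an indecomposable finitely semisimple unitary bimodule category with $d^L_m=d^R_m$ for all $m\in\mathrm{Irr}(\mathcal M)$, and $W=\mathbf{Tube}({}_{\mathcal C}\mathcal M_{\mathcal D})$. The assignment $\mathfrak f\mapsto V^{\mathfrak f}=\bigoplus_{x,y\in\mathrm{Irr}(\mathcal M)}\mathrm{Hom}(x,\mathfrak f(y))$, with the $W$-action given in the context, is a monoidal functor $\mathrm{Fun}_{\mathcal C|\mathcal D}(\mathcal M,\mathcal M)\to\mathrm{Rep}(W)$, with monoidal structure isomorphism $\eta_{\mathfrak f,\mathfrak g}:V^{\mathfrak f\otimes\mathfrak g}\to V^{\mathfrak f}\otimes V^{\mathfrak g}$ the inverse of the map $$V^{\mathfrak f}\otimes V^{\mathfrak g}\to V^{\mathfrak f\otimes\mathfrak g},\qquad \alpha\otimes\beta\mapsto\mathfrak g(\alpha)\circ\beta\qquad(\alpha\in\mathrm{Hom}(y,\mathfrak f(w)),\ \beta\in\mathrm{Hom}(x,\mathfrak g(y))),$$ which satisfies the pentagon (coherence) relation. (Here the tensor product $V^{\mathfrak f}\otimes V^{\mathfrak g}$ is that of $\mathrm{Rep}(W)$, not the one over $\mathbb C$, and thus $\eta_{\mathfrak f,\mathfrak g}$ is an isomorphism.) The tensor unit $\mathrm{id}_{\mathcal M}$ is mapped to the tensor unit $V^{\mathrm{id}_{\mathcal M}}$ of $\mathrm{Rep}(W)$: the elements $e_s=\sum_{s'\in\mathrm{Irr}(\mathcal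 M)}\mathrm{id}_{s'}\otimes\mathrm{id}_s$ ($s\in\mathrm{Irr}(\mathcal M)$) form a basis of the unit object $\varepsilon_L(W)$, they are in one-to-one correspondence with the elements $\tilde e_s:=\mathrm{id}_s\in\mathrm{Hom}(s,\mathrm{id}_{\mathcal M}(s))\subset V^{\mathrm{id}_{\mathcal M}}$, and the correspondence $e_s\mapsto\tilde e_s$ is a map of $W$-modules; the unit morphism $V^{\mathrm{id}_{\mathcal M}}\otimes V^{\mathfrak f}\to V^{\mathrm{id}_{\mathcal M}\otimes\mathfrak f}=V^{\mathfrak f}$ sends $\tilde e_y\otimes\beta\mapsto\beta$ for $\beta\in\mathrm{Hom}(x,\mathfrak f(y))$. In a similar way, $V_\bullet:\mathfrak f\mapsto V_{\mathfrak f}=\bigoplus_{x,y\in\mathrm{Irr}(\mathcal M)}\mathrm{Hom}(\mathfrak f(x),y)$ is also a monoidal functor.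
   Context: $\mathrm{Fun}_{\mathcal C|\mathcal D}(\mathcal M,\mathcal M)$: (right exact) bimodule endofunctors, with structure isomorphisms $\mathfrak f(a\otimes m\otimes b)\cong a\otimes\mathfrak f(m)\otimes b$ (suppressed below), tensor product $\mathfrak f\otimes\mathfrak g:=\mathfrak g\circ\mathfrak f$, unit $\mathrm{id}_{\mathcal M}$. Associators are suppressed. $\mathrm{Irr}$: representatives of simple objects; $d_a$: quantum dimension; $\bar a$: dual; $R_a:\mathbb 1\to\bar a\otimes a$, $\bar R_a:\mathbb 1\to a\otimes\bar a$: standard balanced solutions of the conjugate equations. $d^L_m>0$ satisfy $d_ad^L_m=\sum_n\dim\mathrm{Hom}(a\otimes m,n)d^L_n$ for $a\in \mathrm{Irr}(\mathcal C)$; $d^R_m>0$ satisfy $d^R_md_b=\sum_n\dim\mathrm{Hom}(m\otimes b,n)d^R_n$ for $b\in \mathrm{Irr}(\mathcal D)$ (only ratios matter); $d_m$ denotes the common value. Dual bases $\tau,\tau^*$ of $\mathrm{Hom}(k,Y)$, $\mathrm{Hom}(Y,k)$ ($k$ simple): $\tau_i^*\tau_j=\delta_{ij}\mathrm{id}_k$. Domain wall tube algebra (a weak Hopf algebra): $W=\bigoplus_{a,b}\bigoplus_{x,z,u,w\in\mathrm{Irr}(\mathcal M)}\mathrm{Hom}(x,a\otimes z\otimes b)\otimes\mathrm{Hom}(a\otimes u\otimes b,w)$ ($a\in\mathrm{Irr}(\mathcal C),b\in\mathrm{Irr}(\mathcal D)$), with - $1=\sum_{x,u}\mathrm{id}_x\otimes\mathrm{id}_u$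 ($a=b=\mathbb 1$); - $(f\otimes g)(f'\otimes g')=\delta_{u,w'}\delta_{z,x'}\sum_{k,s,\tau,\sigma}[(\tau^*\otimes\mathrm{id}_{z'}\otimes\sigma^* )(\mathrm{id}_a\otimes f'\otimes\mathrm{id}_b)f]\otimes[g(\mathrm{id}_a\otimes g'\otimes\mathrm{id}_b)(\tau\otimes\mathrm{id}_{u'}\otimes\sigma)]$, $\tau,\sigma$ over bases of $\mathrm{Hom}(k,a\otimes a')$, $\mathrm{Hom}(s,b'\otimes b)$; - $\varepsilon(f\otimes g)=0$ unless $z=u,x=w$, and then $gf=\varepsilon(f\otimes g)\mathrm{id}_x$; - $\Delta(f\otimes g)=\sum_{i,k,e}(e\otimes g)\otimes(f\otimes e^* )$, $e,e^*$ dual bases of $\mathrm{Hom}(k,a\otimes i\otimes b)$, $\mathrm{Hom}(a\otimes i\otimes b,k)$; - $S(f\otimes g)=\frac{d_u}{d_w}\hat g\otimes\hat f$, $\hat g=(\mathrm{id}_{\bar a}\otimes g\otimes\mathrm{id}_{\bar b})(R_a\otimes\mathrm{id}_u\otimes\bar R_b)$, $\hat f=(R_a^\dagger\otimes\mathrm{id}_z\otimes\bar R_b^\dagger)(\mathrm{id}_{\bar a}\otimes f\otimes\mathrm{id}_{\bar b})$. Action on $V^{\mathfrak f}$: for $f\otimes g$ in the summand $(a,b;x,z,u,w)$ and $\alpha\in\mathrm{Hom}(s,\mathfrak f(t))$, $(f\otimes g)\triangleright\alpha=\delta_{z,s}\delta_{u,t}\;\mathfrak f(g)\circ(\mathrm{id}_a\otimes\alpha\otimes\mathrm{id}_b)\circ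 f\in\mathrm{Hom}(x,\mathfrak f(w))$. Action on $V_{\mathfrak f}$: for $\alpha\in\mathrm{Hom}(\mathfrak f(s),t)$, $(f\otimes g)\triangleright\alpha=\delta_{z,s}\delta_{u,t}\;g\circ(\mathrm{id}_a\otimes\alpha\otimes\mathrm{id}_b)\circ\mathfrak f(f)\in\mathrm{Hom}(\mathfrak f(x),w)$. $\mathrm{Rep}(W)$: finite-dimensional left $W$-modules with $V\otimes U:=\Delta(1)\triangleright(V\otimes_{\mathbb C}U)$, $h\triangleright(v\otimes u)=\sum h^{(1)}v\otimes h^{(2)}u$, unit object $\varepsilon_L(W)$ with action $x\triangleright a=\varepsilon_L(xa)$, $\varepsilon_L(x)=\sum\varepsilon(1^{(1)}x)1^{(2)}$. In $V^{\mathfrak f}\otimes V^{\mathfrak g}$ the projection $\Delta(1)$ keeps exactly the terms $\alpha\otimes\beta$ with $\alpha\in\mathrm{Hom}(y,\mathfrak f(w))$, $\beta\in\mathrm{Hom}(x,\mathfrak g(y))$ sharing the same $y$. In the formula for $e_s$, $\mathrm{id}_{s'}\otimes\mathrm{id}_s$ lies in the summand $a=b=\mathbb 1$, $x=z=s'$, $u=w=s$.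
   Formalization: The last claim is read contravariantly: V_• is a monoidal functor on the opposite of Fun(M,M) with reversed tensor product, V_f⊗V_g ≅ V_{f∘g} = V_{g⊗f} via α⊗β ↦ α∘f(β), since the covariant, order-preserving reading fails (e.g. M = C = Vec_G, G nonabelian, D = Vec). *)

(* Defs.v *)
From HB Require Import structures.
Set Warnings "-notation-overridden,-ambiguous-paths".
From mathcomp Require Import all_boot all_order all_algebra.
From mathcomp Require Import boolp reals complex.

Set Implicit Arguments.
Unset Strict Implicit.
Unset Printing Implicit Defensive.

Import Order.TTheory GRing.Theory Num.Theory.
Local Open Scope ring_scope.

Declare Scope tube_scope.
Delimit Scope tube_scope with tube.

Section DirectSum.
Variables (K : fieldType) (I : finType) (T : I -> vectType K).

Definition dsum : Type := {dffun forall i, T i}.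

HB.instance Definition _ := Choice.on dsum.

Definition dsum_of (f : forall i, T i) : dsum := [ffun i => f i].
Definition dcomp (i : I) (v : dsum) : T i :=
  (v : {dffun forall i, T i}) i.

Lemma dsum_ofE f i : dcomp i (dsum_of f) = f i.
Proof. exact: ffunE. Qed.

Lemma dsumP (u v : dsum) : (forall i, dcomp i u = dcomp i v) -> u = v.
Proof. by move=> uv; apply/ffunP. Qed.

Fact dsum_addA : associative (fun u v => dsum_of (fun i => dcomp i u + dcomp i v)).
Proof. by move=> u v w; apply: dsumP => i; rewrite !dsum_ofE addrA. Qed.
Fact dsum_addC : commutative (fun u v => dsum_of (fun i => dcomp i u + dcomp i v)).
Proof. by move=> u v; apply: dsumP => i; rewrite !dsum_ofE addrC. Qed.
Fact dsum_add0 : left_id (dsum_of (fun=> 0))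
  (fun u v => dsum_of (fun i => dcomp i u + dcomp i v)).
Proof. by move=> u; apply: dsumP => i; rewrite !dsum_ofE add0r. Qed.
Fact dsum_addN : left_inverse (dsum_of (fun=> 0))
  (fun u => dsum_of (fun i => - dcomp i u))
  (fun u v => dsum_of (fun i => dcomp i u + dcomp i v)).
Proof. by move=> u; apply: dsumP => i; rewrite !dsum_ofE addNr. Qed.

HB.instance Definition _ :=
  GRing.isZmodule.Build dsum dsum_addA dsum_addC dsum_add0 dsum_addN.

Definition dsum_scale (c : K) (u : dsum) := dsum_of (fun i => c *: dcomp i u).

Fact dsum_scaleA c d u : dsum_scale c (dsum_scale d u) = dsum_scale (c * d) u.
Proof. by apply: dsumP => i; rewrite !dsum_ofE scalerA. Qed.
Fact dsum_scale1 : left_id 1 dsum_scale.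
Proof. by move=> u; apply: dsumP => i; rewrite !dsum_ofE scale1r. Qed.
Fact dsum_scaleDr : right_distributive dsum_scale +%R.
Proof. by move=> c u v; apply: dsumP => i; rewrite !dsum_ofE scalerDr. Qed.
Fact dsum_scaleDl u : {morph dsum_scale^~ u : c d / c + d}.
Proof. by move=> c d; apply: dsumP => i; rewrite !dsum_ofE scalerDl. Qed.

HB.instance Definition _ := GRing.Zmodule_isLmodule.Build K dsum
  dsum_scaleA dsum_scale1 dsum_scaleDr dsum_scaleDl.

Lemma dcompD i u v : dcomp i (u + v) = dcomp i u + dcomp i v.
Proof. exact: dsum_ofE. Qed.
Lemma dcompZ i c v : dcomp i (c *: v) = c *: dcomp i v.
Proof. exact: dsum_ofE. Qed.

Fact dsum_vect_iso :
  Vector.axiom #|{: {i : I & 'I_(\dim {: T i})}}| dsum.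
Proof.
pose J := {i : I & 'I_(\dim {: T i})}.
pose crd (p : J) (u : dsum) :=
  coord (vbasis {: T (tag p)}) (tagged p) (dcomp (tag p) u).
pose f (u : dsum) : 'rV[K]_#|{: J}| := \row_k crd (enum_val k) u.
pose g (r : 'rV[K]_#|{: J}|) : dsum := dsum_of (fun i =>
  \sum_(j < \dim {: T i})
    r 0 (enum_rank (Tagged (fun i => 'I_(\dim {: T i})) j)) *: (vbasis {: T i})`_j).
exists f.
  by move=> c u v; apply/rowP=> k; rewrite !mxE /crd dcompD dcompZ linearP.
exists g => [u|r].
  apply: dsumP => i; rewrite dsum_ofE [RHS](coord_vbasis (memvf _)).
  by apply: eq_bigr => j _; rewrite mxE enum_rankK.
apply/rowP=> k; rewrite mxE /crd dsum_ofE coord_sum_free ?(basis_free (vbasisP _)) //.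
by rewrite /Tagged -sigT_eta enum_valK.
Qed.

HB.instance Definition _ := Lmodule_hasFinDim.Build K dsum dsum_vect_iso.

Definition dinj (i : I) (v : T i) : dsum := dsum_of (dfwith (fun j => 0 : T j) v).

End DirectSum.

Arguments dinj {K I T} i v.
Arguments dcomp {K I T} i v.

(* The tensor product is represented in coordinates on the reference bases
   [vbasis]; only [tens] and its universal extension [tlift] are used. *)
Section Tensor.
Variable K : fieldType.

Definition tprod (V U : vectType K) : vectType K :=
  'M[K]_(\dim {: V}, \dim {: U}).

Definition tens (V U : vectType K) (v : V) (u : U) : tprod V U :=
  \matrix_(i, j) (coord (vbasis {: V}) i v * coord (vbasis {: U}) j u).

(* For bilinear [B], the linear map with [v (x) u |-> B v u]. *)
Definition tlift (V U : vectType K) (T : lmodType K) (B : V -> U -> T)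
    (t : tprod V U) : T :=
  \sum_(i < \dim {: V}) \sum_(j < \dim {: U})
    (t : 'M_(_, _)) i j *: B (vbasis {: V})`_i (vbasis {: U})`_j.

Definition tmap (V V' U U' : vectType K) (f : V -> V') (g : U -> U') :
    tprod V U -> tprod V' U' := tlift (fun v u => tens (f v) (g u)).

Definition tassoc (V U X : vectType K) :
    tprod (tprod V U) X -> tprod V (tprod U X) :=
  tlift (fun t x => tlift (fun v u => tens v (tens u x)) t).

Lemma tlift0 (V U : vectType K) (T : lmodType K) (B : V -> U -> T) : tlift B 0 = 0.
Proof. by rewrite /tlift big1 // => i _; rewrite big1 // => j _; rewrite mxE scale0r. Qed.

Lemma tlift_is_linear V U T B : linear (@tlift V U T B).
Proof.
move=> c s t; rewrite /tlift scaler_sumr -big_split; apply: eq_bigr => i _.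
rewrite scaler_sumr -big_split; apply: eq_bigr => j _ /=.
by rewrite !mxE scalerDl scalerA.
Qed.

Lemma tlift_tens (V U : vectType K) (T : lmodType K) (B : V -> U -> T) v u :
  (forall x, linear (B x)) -> (forall y, linear (B^~ y)) ->
  tlift B (tens v u) = B v u.
Proof.
move=> Br Bl.
pose Br' x := GRing.isLinear.Build K U T *:%R (B x) (Br x).
pose Bl' y := GRing.isLinear.Build K V T *:%R (B^~ y) (Bl y).
pose fr x : {linear U -> T} := HB.pack (B x) (Br' x).
pose fl y : {linear V -> T} := HB.pack (B^~ y) (Bl' y).
rewrite -[RHS]/(fl u v) {2}(coord_vbasis (memvf v)) linear_sum.
apply: eq_bigr => i _; rewrite linearZ /= -[B _ u]/(fr _ u).
rewrite {2}(coord_vbasis (memvf u)) linear_sum scaler_sumr.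
by apply: eq_bigr => j _; rewrite linearZ mxE scalerA.
Qed.

End Tensor.

Record starCat (K : numClosedFieldType) := StarCat {
  ob :> Type;
  mor : ob -> ob -> vectType K;
  idm : forall x, mor x x;
  cmp : forall x y z, mor y z -> mor x y -> mor x z;
  dag : forall x y, mor x y -> mor y x;
  cmpA : forall x y z w (h : mor z w) (g : mor y z) (f : mor x y),
    cmp h (cmp g f) = cmp (cmp h g) f;
  cmp1m : forall x y (f : mor x y), cmp (idm y) f = f;
  cmpm1 : forall x y (f : mor x y), cmp f (idm x) = f;
  cmp_linr : forall x y z (g : mor y z), linear (fun f : mor x y => cmp g f);
  cmp_linl : forall x y z (f : mor x y), linear (fun g : mor y z => cmp g f);
  dagK : forall x y (f : mor x y), dag (dag f) = f;
  dag_cmp : forall x y z (g : mor y z) (f : mor x y),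
    dag (cmp g f) = cmp (dag f) (dag g);
  dag_antilin : forall x y (c : K) (f g : mor x y),
    dag (c *: f + g) = c^* *: dag f + dag g;
  (* The C*-condition: with finite-dimensional hom spaces, the existence of a
     C*-norm amounts to these two algebraic conditions. *)
  dag_definite : forall x y (f : mor x y), cmp (dag f) f = 0 -> f = 0;
  dag_positive : forall x y (f : mor x y),
    exists g : mor x x, cmp (dag f) f = cmp (dag g) g }.

Arguments idm {K E} x : rename.
Arguments mor {K} E x y : rename.
Notation "g '∘' f" := (cmp g f) (at level 40, left associativity) : tube_scope.
Notation "f '^†'" := (dag f) (at level 2, format "f ^†") : tube_scope.
Local Open Scope tube_scope.

Section StarCatTheory.
Variables (K : numClosedFieldType) (E : starCat K).

Definition unitary (x y : E) (f : mor E x y) : Prop :=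
  f^† ∘ f = idm x /\ f ∘ f^† = idm y.

Definition is_zero_ob (z : E) : Prop := idm z = 0.

Definition is_dsum (x y z : E) : Prop :=
  exists (i : mor E x z) (j : mor E y z) (p : mor E z x) (q : mor E z y),
    [/\ p ∘ i = idm x, q ∘ j = idm y, p ∘ j = 0, q ∘ i = 0 &
        i ∘ p + j ∘ q = idm z].

(* [X] is a complete family of representatives of the simple objects, and all
   objects are finite direct sums of simple ones. Over an algebraically closed
   field, the objects of a semisimple linear category which are simple are those
   with one-dimensional endomorphism space. *)
Record finitely_semisimple (I : finType) (X : I -> E) : Prop := {
  ss_zero : exists z, is_zero_ob z;
  ss_dsum : forall x y, exists z, is_dsum x y z;
  ss_simple : forall i j, \dim {: mor E (X i) (X j)} = (i == j);
  ss_decomp : forall y, exists (n : nat) (k : 'I_n -> I)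
      (p : forall r, mor E y (X (k r))) (q : forall r, mor E (X (k r)) y),
    [/\ forall r, p r ∘ q r = idm (X (k r)),
        forall r s, r != s -> p r ∘ q s = 0 &
        \sum_(r < n) q r ∘ p r = idm y] }.

(* The scalar [c] with [f = c *: idm x], for simple [x]. *)
Definition scal (x : E) (f : mor E x x) : K :=
  coord [tuple of [:: idm x]] ord0 f.

Record dualBases (I : finType) (X : I -> E) := DualBases {
  bas : forall (k : I) (y : E), 'I_(\dim {: mor E (X k) y}) -> mor E (X k) y;
  dbas : forall (k : I) (y : E), 'I_(\dim {: mor E (X k) y}) -> mor E y (X k);
  bas_basis : forall k y,
    basis_of {: mor E (X k) y} [seq @bas k y i | i <- enum 'I_(\dim {: mor E (X k) y})];
  dbas_basis : forall k y,
    basis_of {: mor E y (X k)} [seq @dbas k y i | i <- enum 'I_(\dim {: mor E (X k) y})];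
  dbas_bas : forall k y i j,
    @dbas k y i ∘ @bas k y j = (i == j)%:R *: idm (X k) }.

Record iso (x y : E) := Iso {
  fwd : mor E x y;
  bwd : mor E y x;
  bwd_fwd : bwd ∘ fwd = idm x;
  fwd_bwd : fwd ∘ bwd = idm y }.

Definition is_coker (x y z : E) (f : mor E x y) (g : mor E y z) : Prop :=
  g ∘ f = 0 /\
  forall w (h : mor E y w), h ∘ f = 0 -> exists! k : mor E z w, h = k ∘ g.

End StarCatTheory.

Record starBifun (K : numClosedFieldType) (A B E : starCat K) := StarBifun {
  bob :> A -> B -> E;
  bhom : forall a a' b b', mor A a a' -> mor B b b' -> mor E (bob a b) (bob a' b');
  bhom1 : forall a b, bhom (idm a) (idm b) = idm (bob a b);
  bhom_cmp : forall a a' a'' b b' b'' (f' : mor A a' a'') (f : mor A a a')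
      (g' : mor B b' b'') (g : mor B b b'),
    bhom (f' ∘ f) (g' ∘ g) = bhom f' g' ∘ bhom f g;
  bhom_linr : forall a a' b b' (f : mor A a a'), linear (@bhom a a' b b' f);
  bhom_linl : forall a a' b b' (g : mor B b b'),
    linear (fun f : mor A a a' => bhom f g);
  bhom_dag : forall a a' b b' (f : mor A a a') (g : mor B b b'),
    (bhom f g)^† = bhom f^† g^† }.

Arguments bhom {K A B E} _ {a a' b b'}.

(* Tensor products are not assumed to be strict; the associators and unitors are
   unitary, so that their inverses are their adjoints. *)
Record unitaryMonCat (K : numClosedFieldType) := UnitaryMonCat {
  um_cat :> starCat K;
  ten : starBifun um_cat um_cat um_cat;
  one : um_cat;
  asc : forall x y z, mor um_cat (ten (ten x y) z) (ten x (ten y z));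
  lun : forall x, mor um_cat (ten one x) x;
  run : forall x, mor um_cat (ten x one) x;
  asc_unitary : forall x y z, unitary (asc x y z);
  lun_unitary : forall x, unitary (lun x);
  run_unitary : forall x, unitary (run x);
  asc_nat : forall x x' y y' z z' (f : mor um_cat x x') (g : mor um_cat y y')
      (h : mor um_cat z z'),
    asc x' y' z' ∘ bhom ten (bhom ten f g) h
    = bhom ten f (bhom ten g h) ∘ asc x y z;
  lun_nat : forall x x' (f : mor um_cat x x'),
    lun x' ∘ bhom ten (idm one) f = f ∘ lun x;
  run_nat : forall x x' (f : mor um_cat x x'),
    run x' ∘ bhom ten f (idm one) = f ∘ run x;
  asc_pentagon : forall x y z w,
    asc x y (ten z w) ∘ asc (ten x y) z w
    = bhom ten (idm x) (asc y z w) ∘ asc x (ten y z) w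
      ∘ bhom ten (asc x y z) (idm w);
  asc_triangle : forall x y,
    bhom ten (idm x) (lun y) ∘ asc x one y = bhom ten (run x) (idm y) }.

Arguments ten {K} C : rename.
Arguments one {K} C : rename.

Notation "x ⊗ y" := (ten _ x y) (at level 39, left associativity) : tube_scope.
Notation "f ⊗h g" := (bhom (ten _) f g) (at level 39, left associativity) : tube_scope.

Definition conj_eqs (K : numClosedFieldType) (C : unitaryMonCat K) (x y : C)
    (R : mor C (one C) (y ⊗ x)) (Rb : mor C (one C) (x ⊗ y)) : Prop :=
  lun x ∘ (Rb^† ⊗h idm x) ∘ (asc x y x)^† ∘ (idm x ⊗h R) ∘ (run x)^† = idm x /\
  lun y ∘ (R^† ⊗h idm y) ∘ (asc y x y)^† ∘ (idm y ⊗h Rb) ∘ (run y)^† = idm y.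

(* The simple objects are represented by the unit object and the objects
   [nontriv j]. *)
Record unitaryFusion (K : numClosedFieldType) := UnitaryFusion {
  uf_mon :> unitaryMonCat K;
  uf_index : finType;
  nontriv : uf_index -> uf_mon;
  uf_ss : finitely_semisimple (oapp nontriv (one uf_mon));
  uf_rigid : forall x : uf_mon, exists (y : uf_mon)
    (R : mor uf_mon (one uf_mon) (y ⊗ x)) (Rb : mor uf_mon (one uf_mon) (x ⊗ y)),
    conj_eqs R Rb }.

Definition irrF (K : numClosedFieldType) (C : unitaryFusion K) : finType :=
  option (uf_index C).
Definition simpF (K : numClosedFieldType) (C : unitaryFusion K) (a : irrF C) : C :=
  oapp (@nontriv K C) (one C) a.

(* For simple objects, a solution of the conjugate equations is standard when it
   is balanced, and the common value of [R^† ∘ R] and [Rb^† ∘ Rb] is then the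
   quantum dimension. *)
Record standardSolutions (K : numClosedFieldType) (C : unitaryFusion K) :=
    StandardSolutions {
  cj : irrF C -> irrF C;
  solR : forall a, mor C (one C) (simpF (cj a) ⊗ simpF a);
  solRb : forall a, mor C (one C) (simpF a ⊗ simpF (cj a));
  sol_conj : forall a, conj_eqs (solR a) (solRb a);
  qdim : irrF C -> K;
  solR_qdim : forall a, (solR a)^† ∘ solR a = qdim a *: idm (one C);
  solRb_qdim : forall a, (solRb a)^† ∘ solRb a = qdim a *: idm (one C) }.

Record unitaryBimod (K : numClosedFieldType) (C D : unitaryFusion K) := UnitaryBimod {
  ub_cat :> starCat K;
  lact : starBifun C ub_cat ub_cat;
  ract : starBifun ub_cat D ub_cat;
  lasc : forall a a' m, mor ub_cat (lact (a ⊗ a') m) (lact a (lact a' m));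
  lunit : forall m, mor ub_cat (lact (one C) m) m;
  rasc : forall m b b', mor ub_cat (ract (ract m b) b') (ract m (b ⊗ b'));
  runit : forall m, mor ub_cat (ract m (one D)) m;
  masc : forall a m b, mor ub_cat (ract (lact a m) b) (lact a (ract m b));
  lasc_unitary : forall a a' m, unitary (lasc a a' m);
  lunit_unitary : forall m, unitary (lunit m);
  rasc_unitary : forall m b b', unitary (rasc m b b');
  runit_unitary : forall m, unitary (runit m);
  masc_unitary : forall a m b, unitary (masc a m b);
  lasc_nat : forall a1 a2 a1' a2' m1 m2 (f : mor C a1 a2) (f' : mor C a1' a2')
      (h : mor ub_cat m1 m2),
    lasc a2 a2' m2 ∘ bhom lact (f ⊗h f') h
    = bhom lact f (bhom lact f' h) ∘ lasc a1 a1' m1;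
  lunit_nat : forall m m' (h : mor ub_cat m m'),
    lunit m' ∘ bhom lact (idm (one C)) h = h ∘ lunit m;
  rasc_nat : forall m1 m2 b1 b2 b1' b2' (h : mor ub_cat m1 m2) (g : mor D b1 b2)
      (g' : mor D b1' b2'),
    rasc m2 b2 b2' ∘ bhom ract (bhom ract h g) g'
    = bhom ract h (g ⊗h g') ∘ rasc m1 b1 b1';
  runit_nat : forall m m' (h : mor ub_cat m m'),
    runit m' ∘ bhom ract h (idm (one D)) = h ∘ runit m;
  masc_nat : forall a1 a2 m1 m2 b1 b2 (f : mor C a1 a2) (h : mor ub_cat m1 m2)
      (g : mor D b1 b2),
    masc a2 m2 b2 ∘ bhom ract (bhom lact f h) g
    = bhom lact f (bhom ract h g) ∘ masc a1 m1 b1;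
  lasc_pentagon : forall a a' a'' m,
    lasc a a' (lact a'' m) ∘ lasc (a ⊗ a') a'' m
    = bhom lact (idm a) (lasc a' a'' m) ∘ lasc a (a' ⊗ a'') m
      ∘ bhom lact (asc a a' a'') (idm m);
  lasc_triangle : forall a m,
    bhom lact (idm a) (lunit m) ∘ lasc a (one C) m = bhom lact (run a) (idm m);
  rasc_pentagon : forall m b b' b'',
    rasc m b (b' ⊗ b'') ∘ rasc (ract m b) b' b''
    = bhom ract (idm m) (asc b b' b'') ∘ rasc m (b ⊗ b') b''
      ∘ bhom ract (rasc m b b') (idm b'');
  rasc_triangle : forall m b,
    bhom ract (idm m) (lun b) ∘ rasc m (one D) b = bhom ract (runit m) (idm b);
  masc_lpentagon : forall a a' m b,
    bhom lact (idm a) (masc a' m b) ∘ masc a (lact a' m) b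
      ∘ bhom ract (lasc a a' m) (idm b)
    = lasc a a' (ract m b) ∘ masc (a ⊗ a') m b;
  masc_rpentagon : forall a m b b',
    bhom lact (idm a) (rasc m b b') ∘ masc a (ract m b) b'
      ∘ bhom ract (masc a m b) (idm b')
    = masc a m (b ⊗ b') ∘ rasc (lact a m) b b';
  (* These two triangles follow from the other axioms. *)
  masc_ltriangle : forall m b,
    lunit (ract m b) ∘ masc (one C) m b = bhom ract (lunit m) (idm b);
  masc_rtriangle : forall a m,
    bhom lact (idm a) (runit m) ∘ masc a m (one D) = runit (lact a m);
  irrM : finType;
  simpM : irrM -> ub_cat;
  ub_ss : finitely_semisimple simpM }.

Arguments simpM {K C D M} _ : rename.
Arguments irrM {K C D} M : rename.
Notation "f ⊳h g" := (bhom (lact _) f g) (at level 39, left associativity) : tube_scope.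
Notation "f ⊲h g" := (bhom (ract _) f g) (at level 39, left associativity) : tube_scope.
Notation "a ⊳ m" := (lact _ a m) (at level 39, left associativity) : tube_scope.
Notation "m ⊲ b" := (ract _ m b) (at level 39, left associativity) : tube_scope.

Section Bimodule.
Variables (K : numClosedFieldType) (C D : unitaryFusion K) (M : unitaryBimod C D).

(* [M] is the direct sum of the nonzero full bimodule subcategories [P] and [Q]. *)
Record is_decomposition (P Q : M -> Prop) : Prop := {
  dec_lact : forall (a : C) m, (P m -> P (a ⊳ m)) /\ (Q m -> Q (a ⊳ m));
  dec_ract : forall m (b : D), (P m -> P (m ⊲ b)) /\ (Q m -> Q (m ⊲ b));
  dec_orth : forall m n, P m -> Q n ->
    (forall f : mor M m n, f = 0) /\ (forall f : mor M n m, f = 0);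
  dec_sum : forall x, exists m n, [/\ P m, Q n & is_dsum m n x];
  dec_neq0 : (exists2 m, P m & ~ is_zero_ob m) /\
             (exists2 n, Q n & ~ is_zero_ob n) }.

Definition indecomposable : Prop :=
  (exists m : M, ~ is_zero_ob m) /\
  forall P Q : M -> Prop, ~ is_decomposition P Q.

(* a (x) m (x) b is read as (a (x) m) (x) b. *)
Definition act (a : C) (m : M) (b : D) : M := (a ⊳ m) ⊲ b.
Definition acth a a' m m' b b' (f : mor C a a') (h : mor M m m') (g : mor D b b') :
  mor M (act a m b) (act a' m' b') := (f ⊳h h) ⊲h g.
Definition act_asc (a a' : C) (m : M) (b' b : D) :
    mor M (act a (act a' m b') b) (act (a ⊗ a') m (b' ⊗ b)) :=
  rasc ((a ⊗ a') ⊳ m) b' b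
  ∘ (((lasc a a' m)^† ⊲h idm b') ⊲h idm b)
  ∘ ((masc a (a' ⊳ m) b')^† ⊲h idm b).
Definition act_unit (m : M) : mor M (act (one C) m (one D)) m :=
  lunit m ∘ runit (one C ⊳ m).

Record bimodFun := BimodFun {
  bf_ob :> M -> M;
  bf_hom : forall x y, mor M x y -> mor M (bf_ob x) (bf_ob y);
  bf_lin : forall x y, linear (@bf_hom x y);
  bf1 : forall x, bf_hom (idm x) = idm (bf_ob x);
  bf_cmp : forall x y z (g : mor M y z) (f : mor M x y),
    bf_hom (g ∘ f) = bf_hom g ∘ bf_hom f;
  (* Right exactness; it is automatic, as [M] is semisimple. *)
  bf_rexact : forall x y z (f : mor M x y) (g : mor M y z),
    is_coker f g -> is_coker (bf_hom f) (bf_hom g);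
  bf_l : forall (a : C) m, iso (bf_ob (a ⊳ m)) (a ⊳ bf_ob m);
  bf_r : forall m (b : D), iso (bf_ob (m ⊲ b)) (bf_ob m ⊲ b);
  bf_l_nat : forall a a' m m' (f : mor C a a') (h : mor M m m'),
    fwd (bf_l a' m') ∘ bf_hom (f ⊳h h) = (f ⊳h bf_hom h) ∘ fwd (bf_l a m);
  bf_r_nat : forall m m' b b' (h : mor M m m') (g : mor D b b'),
    fwd (bf_r m' b') ∘ bf_hom (h ⊲h g) = (bf_hom h ⊲h g) ∘ fwd (bf_r m b);
  bf_l_asc : forall (a a' : C) m,
    lasc a a' (bf_ob m) ∘ fwd (bf_l (a ⊗ a') m)
    = (idm a ⊳h fwd (bf_l a' m)) ∘ fwd (bf_l a (a' ⊳ m)) ∘ bf_hom (lasc a a' m);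
  bf_l_unit : forall m,
    lunit (bf_ob m) ∘ fwd (bf_l (one C) m) = bf_hom (lunit m);
  bf_r_asc : forall m (b b' : D),
    rasc (bf_ob m) b b' ∘ (fwd (bf_r m b) ⊲h idm b') ∘ fwd (bf_r (m ⊲ b) b')
    = fwd (bf_r m (b ⊗ b')) ∘ bf_hom (rasc m b b');
  bf_r_unit : forall m,
    runit (bf_ob m) ∘ fwd (bf_r m (one D)) = bf_hom (runit m);
  bf_masc : forall (a : C) m (b : D),
    masc a (bf_ob m) b ∘ (fwd (bf_l a m) ⊲h idm b) ∘ fwd (bf_r (a ⊳ m) b)
    = (idm a ⊳h fwd (bf_r m b)) ∘ fwd (bf_l a (m ⊲ b)) ∘ bf_hom (masc a m b) }.

Definition bf_act (F : bimodFun) a m b : mor M (F (act a m b)) (act a (F m) b) :=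
  (fwd (bf_l F a m) ⊲h idm b) ∘ fwd (bf_r F (a ⊳ m) b).
Definition bf_actV (F : bimodFun) a m b : mor M (act a (F m) b) (F (act a m b)) :=
  bwd (bf_r F (a ⊳ m) b) ∘ (bwd (bf_l F a m) ⊲h idm b).

Record bimodNat (F G : bimodFun) := BimodNat {
  nt :> forall m, mor M (F m) (G m);
  nt_nat : forall m m' (h : mor M m m'), nt m' ∘ bf_hom F h = bf_hom G h ∘ nt m;
  nt_l : forall a m,
    fwd (bf_l G a m) ∘ nt (a ⊳ m) = (idm a ⊳h nt m) ∘ fwd (bf_l F a m);
  nt_r : forall m b,
    fwd (bf_r G m b) ∘ nt (m ⊲ b) = (nt m ⊲h idm b) ∘ fwd (bf_r F m b) }.

Lemma bimodNat_eq F G (s t : bimodNat F G) : (forall m, s m = t m) -> s = t.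
Proof.
case: s t => [s s1 s2 s3] [t t1 t2 t3] /= st.
have {}st : s = t by apply: functional_extensionality_dep.
by subst t; congr BimodNat; apply: Prop_irrelevance.
Qed.

Section IsoOps.
Variables (x y z : M).

Lemma iso_comp_subproof (j : iso y z) (i : iso x y) :
  bwd i ∘ bwd j ∘ (fwd j ∘ fwd i) = idm x /\ fwd j ∘ fwd i ∘ (bwd i ∘ bwd j) = idm z.
Proof.
by rewrite !cmpA -(cmpA (bwd i)) -(cmpA (fwd j) (fwd i)) bwd_fwd fwd_bwd !cmpm1
  bwd_fwd fwd_bwd.
Qed.
Definition iso_comp (j : iso y z) (i : iso x y) : iso x z :=
  Iso (iso_comp_subproof j i).1 (iso_comp_subproof j i).2.

Definition iso_id : iso x x := Iso (cmp1m (idm x)) (cmp1m (idm x)).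

Lemma iso_map_subproof (F : bimodFun) (i : iso x y) :
  bf_hom F (bwd i) ∘ bf_hom F (fwd i) = idm (F x) /\
  bf_hom F (fwd i) ∘ bf_hom F (bwd i) = idm (F y).
Proof. by rewrite -!bf_cmp bwd_fwd fwd_bwd !bf1. Qed.
Definition iso_map (F : bimodFun) (i : iso x y) : iso (F x) (F y) :=
  Iso (iso_map_subproof F i).1 (iso_map_subproof F i).2.
End IsoOps.

Lemma lh1 (a : C) (x y z : M) (g : mor M y z) (f : mor M x y) :
  idm a ⊳h (g ∘ f) = (idm a ⊳h g) ∘ (idm a ⊳h f).
Proof. by rewrite -bhom_cmp cmp1m. Qed.
Lemma rh1 (b : D) (x y z : M) (g : mor M y z) (f : mor M x y) :
  (g ∘ f) ⊲h idm b = (g ⊲h idm b) ∘ (f ⊲h idm b).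
Proof. by rewrite -bhom_cmp cmp1m. Qed.

Definition bf_id : bimodFun.
Proof.
refine (@BimodFun (fun m => m) (fun x y f => f) _ _ _ _
  (fun a m => iso_id (a ⊳ m)) (fun m b => iso_id (m ⊲ b)) _ _ _ _ _ _ _);
  by move=> * //=; rewrite ?cmp1m ?cmpm1 ?bhom1 ?cmp1m ?cmpm1.
Defined.

Definition bf_comp (G F : bimodFun) : bimodFun.
Proof.
refine (@BimodFun (fun m => G (F m)) (fun x y f => bf_hom G (bf_hom F f)) _ _ _ _
  (fun a m => iso_comp (bf_l G a (F m)) (iso_map G (bf_l F a m)))
  (fun m b => iso_comp (bf_r G (F m) b) (iso_map G (bf_r F m b))) _ _ _ _ _ _ _).
- by move=> x y c f g; rewrite bf_lin bf_lin.
- by move=> x; rewrite !bf1.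
- by move=> x y z g f; rewrite !bf_cmp.
- by move=> x y z f g fg; do 2! apply: bf_rexact.
- move=> a a' m m' f h /=.
  by rewrite -cmpA -bf_cmp bf_l_nat bf_cmp cmpA bf_l_nat cmpA.
- move=> m m' b b' h g /=.
  by rewrite -cmpA -bf_cmp bf_r_nat bf_cmp cmpA bf_r_nat cmpA.
- move=> a a' m /=.
  rewrite cmpA bf_l_asc -cmpA -bf_cmp bf_l_asc !bf_cmp lh1.
  by rewrite !cmpA -(cmpA _ _ (bf_hom G (_ ⊳h _))) bf_l_nat !cmpA.
- by move=> m /=; rewrite cmpA bf_l_unit -bf_cmp bf_l_unit.
- move=> m b b' /=.
  rewrite rh1 !cmpA -(cmpA _ _ (fwd (bf_r G _ _))) -bf_r_nat !cmpA bf_r_asc.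
  by rewrite -!cmpA -!bf_cmp cmpA bf_r_asc.
- by move=> m /=; rewrite cmpA bf_r_unit -bf_cmp bf_r_unit.
- move=> a m b /=.
  rewrite rh1 lh1 !cmpA -(cmpA _ _ (fwd (bf_r G _ _))) -bf_r_nat !cmpA bf_masc.
  rewrite -!cmpA -!bf_cmp (cmpA (masc _ _ _)) bf_masc !bf_cmp.
  by congr cmp; rewrite !cmpA bf_l_nat.
Defined.

Definition nt_id F : bimodNat F F.
Proof.
by refine (@BimodNat F F (fun m => idm (F m)) _ _ _) => *;
  rewrite ?bhom1 ?cmp1m ?cmpm1.
Defined.

Definition nt_cmp F G H (t : bimodNat G H) (s : bimodNat F G) : bimodNat F H.
Proof.
refine (@BimodNat F H (fun m => t m ∘ s m) _ _ _).
- by move=> m m' h; rewrite -cmpA nt_nat cmpA nt_nat cmpA.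
- by move=> a m; rewrite cmpA nt_l -cmpA nt_l cmpA lh1.
- by move=> m b; rewrite cmpA nt_r -cmpA nt_r cmpA rh1.
Defined.

Definition nt_ten F F' G G' (s : bimodNat F F') (t : bimodNat G G') :
  bimodNat (bf_comp G F) (bf_comp G' F').
Proof.
refine (@BimodNat (bf_comp G F) (bf_comp G' F')
  (fun m => t (F' m) ∘ bf_hom G (s m)) _ _ _) => /=.
- by move=> m m' h; rewrite -cmpA -bf_cmp (nt_nat s) bf_cmp !cmpA (nt_nat t).
- move=> a m; rewrite !cmpA -(cmpA _ (bf_hom G' _) (t _)) -(nt_nat t) cmpA.
  rewrite (nt_l t) -(cmpA _ (bf_hom G _) (bf_hom G _)) -bf_cmp (nt_l s) bf_cmp cmpA.
  by rewrite -(cmpA _ (fwd _) (bf_hom G (_ ⊳h _))) bf_l_nat lh1 !cmpA.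
- move=> m b; rewrite !cmpA -(cmpA _ (bf_hom G' _) (t _)) -(nt_nat t) cmpA.
  rewrite (nt_r t) -(cmpA _ (bf_hom G _) (bf_hom G _)) -bf_cmp (nt_r s) bf_cmp cmpA.
  by rewrite -(cmpA _ (fwd _) (bf_hom G (_ ⊲h _))) bf_r_nat rh1 !cmpA.
Defined.

Definition nt_asc F G H :
  bimodNat (bf_comp H (bf_comp G F)) (bf_comp (bf_comp H G) F).
Proof.
by refine (@BimodNat (bf_comp H (bf_comp G F)) (bf_comp (bf_comp H G) F)
    (fun m => idm (H (G (F m)))) _ _ _) => /= *;
  rewrite ?bhom1 ?cmp1m ?cmpm1 ?bf_cmp ?cmpA.
Defined.

Definition nt_ascV F G H :
  bimodNat (bf_comp (bf_comp H G) F) (bf_comp H (bf_comp G F)).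
Proof.
by refine (@BimodNat (bf_comp (bf_comp H G) F) (bf_comp H (bf_comp G F))
    (fun m => idm (H (G (F m)))) _ _ _) => /= *;
  rewrite ?bhom1 ?cmp1m ?cmpm1 ?bf_cmp ?cmpA.
Defined.

Definition nt_lun F : bimodNat (bf_comp F bf_id) F.
Proof.
by refine (@BimodNat (bf_comp F bf_id) F (fun m => idm (F m)) _ _ _) => /= *;
  rewrite ?bhom1 ?bf1 ?cmp1m ?cmpm1.
Defined.

Definition nt_lunV F : bimodNat F (bf_comp F bf_id).
Proof.
by refine (@BimodNat F (bf_comp F bf_id) (fun m => idm (F m)) _ _ _) => /= *;
  rewrite ?bhom1 ?bf1 ?cmp1m ?cmpm1.
Defined.

Definition nt_run F : bimodNat (bf_comp bf_id F) F.
Proof.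
by refine (@BimodNat (bf_comp bf_id F) F (fun m => idm (F m)) _ _ _) => /= *;
  rewrite ?bhom1 ?cmp1m ?cmpm1.
Defined.

Definition nt_runV F : bimodNat F (bf_comp bf_id F).
Proof.
by refine (@BimodNat F (bf_comp bf_id F) (fun m => idm (F m)) _ _ _) => /= *;
  rewrite ?bhom1 ?cmp1m ?cmpm1.
Defined.

End Bimodule.

Arguments bf_id {K C D M}.

Record monCat := MonCat {
  mob :> Type;
  mhom : mob -> mob -> Type;
  mid : forall x, mhom x x;
  mcmp : forall x y z, mhom y z -> mhom x y -> mhom x z;
  mcmpA : forall x y z w (h : mhom z w) (g : mhom y z) (f : mhom x y),
    mcmp h (mcmp g f) = mcmp (mcmp h g) f;
  mcmp1m : forall x y (f : mhom x y), mcmp (mid y) f = f;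
  mcmpm1 : forall x y (f : mhom x y), mcmp f (mid x) = f;
  mten : mob -> mob -> mob;
  mtenh : forall x x' y y', mhom x x' -> mhom y y' -> mhom (mten x y) (mten x' y');
  mtenh1 : forall x y, mtenh (mid x) (mid y) = mid (mten x y);
  mtenh_cmp : forall x x' x'' y y' y'' (f' : mhom x' x'') (f : mhom x x')
      (g' : mhom y' y'') (g : mhom y y'),
    mtenh (mcmp f' f) (mcmp g' g) = mcmp (mtenh f' g') (mtenh f g);
  mone : mob;
  massoc : forall x y z, mhom (mten (mten x y) z) (mten x (mten y z));
  massocV : forall x y z, mhom (mten x (mten y z)) (mten (mten x y) z);
  mlun : forall x, mhom (mten mone x) x;
  mlunV : forall x, mhom x (mten mone x);
  mrun : forall x, mhom (mten x mone) x;
  mrunV : forall x, mhom x (mten x mone);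
  massoc_iso : forall x y z, mcmp (massoc x y z) (massocV x y z) = mid _ /\
    mcmp (massocV x y z) (massoc x y z) = mid _;
  mlun_iso : forall x, mcmp (mlun x) (mlunV x) = mid _ /\
    mcmp (mlunV x) (mlun x) = mid _;
  mrun_iso : forall x, mcmp (mrun x) (mrunV x) = mid _ /\
    mcmp (mrunV x) (mrun x) = mid _;
  massoc_nat : forall x x' y y' z z' (f : mhom x x') (g : mhom y y') (h : mhom z z'),
    mcmp (massoc x' y' z') (mtenh (mtenh f g) h)
    = mcmp (mtenh f (mtenh g h)) (massoc x y z);
  mlun_nat : forall x x' (f : mhom x x'),
    mcmp (mlun x') (mtenh (mid mone) f) = mcmp f (mlun x);
  mrun_nat : forall x x' (f : mhom x x'),
    mcmp (mrun x') (mtenh f (mid mone)) = mcmp f (mrun x);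
  mpentagon : forall x y z w,
    mcmp (massoc x y (mten z w)) (massoc (mten x y) z w)
    = mcmp (mtenh (mid x) (massoc y z w))
        (mcmp (massoc x (mten y z) w) (mtenh (massoc x y z) (mid w)));
  mtriangle : forall x y,
    mcmp (mtenh (mid x) (mlun y)) (massoc x mone y) = mtenh (mrun x) (mid y) }.

Arguments mone A : rename.

Section OppositeReverse.
Variable A : monCat.

Fact oprev_lun_nat (x x' : A) (f : mhom x' x) :
  mcmp (mtenh f (mid (mone A))) (mrunV x') = mcmp (mrunV x) f.
Proof.
by rewrite -[LHS]mcmp1m -(mrun_iso x).2 -!mcmpA (mcmpA (mrun x)) mrun_nat -mcmpA
  (mrun_iso x').1 mcmpm1.
Qed.

Fact oprev_run_nat (x x' : A) (f : mhom x' x) :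
  mcmp (mtenh (mid (mone A)) f) (mlunV x') = mcmp (mlunV x) f.
Proof.
by rewrite -[LHS]mcmp1m -(mlun_iso x).2 -!mcmpA (mcmpA (mlun x)) mlun_nat -mcmpA
  (mlun_iso x').1 mcmpm1.
Qed.

Fact oprev_triangle (x y : A) :
  mcmp (massoc y (mone A) x) (mtenh (mrunV y) (mid x)) = mtenh (mid y) (mlunV x).
Proof.
have e : mcmp (mtenh (mid y) (mlunV x)) (mtenh (mid y) (mlun x)) = mid _.
  by rewrite -mtenh_cmp mcmp1m (mlun_iso x).2 mtenh1.
rewrite -[LHS]mcmp1m -e -!mcmpA (mcmpA (mtenh (mid y) (mlun x))) mtriangle.
by rewrite -mtenh_cmp mcmp1m (mrun_iso y).1 mtenh1 mcmpm1.
Qed.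

Definition opRev : monCat.
Proof.
refine (@MonCat A (fun x y => mhom y x) (@mid A) (fun x y z g f => mcmp f g) _ _ _
  (fun x y => mten y x) (fun x x' y y' f g => mtenh g f) _ _ (mone A)
  (fun x y z => massoc z y x) (fun x y z => massocV z y x)
  (@mrunV A) (@mrun A) (@mlunV A) (@mlun A) _ _ _ _ _ _ _ _).
- by move=> *; rewrite mcmpA.
- by move=> *; rewrite mcmpm1.
- by move=> *; rewrite mcmp1m.
- by move=> *; rewrite mtenh1.
- by move=> *; rewrite mtenh_cmp.
- by move=> x y z; have [? ?] := massoc_iso z y x.
- by move=> x; have [? ?] := mrun_iso x.
- by move=> x; have [? ?] := mlun_iso x.
- by move=> *; rewrite massoc_nat.
- by move=> x x' f; rewrite oprev_lun_nat.
- by move=> x x' f; rewrite oprev_run_nat.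
- by move=> x y z w; rewrite mpentagon mcmpA.
- by move=> x y; rewrite oprev_triangle.
Defined.

End OppositeReverse.

(* The tensor product is f (x) g := g o f. *)
Definition FunCat (K : numClosedFieldType) (C D : unitaryFusion K)
  (M : unitaryBimod C D) : monCat.
Proof.
refine (@MonCat (bimodFun M) (@bimodNat K C D M) (@nt_id K C D M) (@nt_cmp K C D M) _ _ _
  (fun F G => bf_comp G F) (@nt_ten K C D M) _ _ bf_id
  (@nt_asc K C D M) (@nt_ascV K C D M) (@nt_lun K C D M) (@nt_lunV K C D M)
  (@nt_run K C D M) (@nt_runV K C D M) _ _ _ _ _ _ _ _).
- by move=> F G H L h g f; apply: bimodNat_eq => m /=; rewrite cmpA.
- by move=> F G f; apply: bimodNat_eq => m /=; rewrite cmp1m.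
- by move=> F G f; apply: bimodNat_eq => m /=; rewrite cmpm1.
- by move=> F G; apply: bimodNat_eq => m /=; rewrite bf1 cmp1m.
- move=> F F1 F2 G G1 G2 f' f g' g; apply: bimodNat_eq => m /=.
  rewrite bf_cmp !cmpA; congr (_ ∘ _).
  by rewrite -!cmpA; congr (_ ∘ _); rewrite nt_nat.
- by move=> F G H; split; apply: bimodNat_eq => m /=; rewrite cmp1m.
- by move=> F; split; apply: bimodNat_eq => m /=; rewrite cmp1m.
- by move=> F; split; apply: bimodNat_eq => m /=; rewrite cmp1m.
- move=> F F' G G' H H' f g h; apply: bimodNat_eq => m /=.
  by rewrite cmp1m cmpm1 bf_cmp cmpA.
- by move=> F F' f; apply: bimodNat_eq => m /=; rewrite bf1 cmp1m cmpm1.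
- by move=> F F' f; apply: bimodNat_eq => m /=; rewrite cmp1m cmpm1 cmp1m.
- by move=> F G H L; apply: bimodNat_eq => m /=; rewrite ?bf1 ?cmp1m ?bf1 ?cmp1m.
- by move=> F G; apply: bimodNat_eq => m /=; rewrite ?bf1 ?cmp1m ?bf1 ?cmp1m.
Defined.

(* The structure maps only: no axiom is imposed. *)
Record weakHopfData (K : fieldType) := WeakHopfData {
  wh_sort :> vectType K;
  wmul : wh_sort -> wh_sort -> wh_sort;
  wone : wh_sort;
  wcomul : wh_sort -> tprod wh_sort wh_sort;
  wcounit : wh_sort -> K;
  wantipode : wh_sort -> wh_sort }.

Arguments wone {K} W : rename.

Section Rep.
Variables (K : fieldType) (W : weakHopfData K).

(* The representations are the [wmod] satisfying [is_rep]: the tensor product and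
   the unit object below do satisfy it when [W] is a weak bialgebra. *)
Record wmod := WMod {
  wm_sort :> vectType K;
  wact : W -> wm_sort -> wm_sort }.

Record is_rep (V : wmod) : Prop := {
  wact_linr : forall h : W, linear (@wact V h);
  wact_linl : forall v : V, linear (fun h : W => wact h v);
  wact1 : forall v : V, wact (wone W) v = v;
  wactM : forall (h h' : W) (v : V), wact (wmul h h') v = wact h (wact h' v) }.

Definition is_rep_hom (V U : wmod) (f : V -> U) : Prop :=
  linear f /\ forall (h : W) (v : V), f (wact h v) = wact h (f v).

Definition wact2 (V U : wmod) (D : tprod W W) (t : tprod V U) : tprod V U :=
  tlift (fun h1 h2 : W => tmap (@wact V h1) (@wact U h2) t) D.

Definition rten_space (V U : wmod) : {vspace tprod V U} :=
  limg (linfun (@wact2 V U (wcomul (wone W)))).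

Definition rten (V U : wmod) : wmod :=
  @WMod (subvs_of (rten_space V U))
    (fun h t => vsproj (rten_space V U) (wact2 (wcomul h) (vsval t))).

(* The class Delta(1).(v (x) u) of v (x) u in the tensor product of Rep(W). *)
Definition rtens (V U : wmod) (v : V) (u : U) : rten V U :=
  vsproj (rten_space V U) (wact2 (wcomul (wone W)) (tens v u)).

(* In [rtmap], [rassoc] and [rrunV], [vsproj] is a mere corestriction: its argument
   lies in the subspace when the modules are representations of a weak bialgebra and
   the maps are morphisms. *)
Definition rtmap (V V' U U' : wmod) (f : V -> V') (g : U -> U') (t : rten V U) :
    rten V' U' :=
  vsproj (rten_space V' U') (tmap f g (vsval t)).

Definition rassoc (V U X : wmod) (t : rten (rten V U) X) : rten V (rten U X) :=
  vsproj (rten_space V (rten U X))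
    (tmap id (fun s : tprod U X => vsproj (rten_space U X) s : rten U X)
      (tassoc (tmap (fun s : rten V U => vsval s) id (vsval t)))).

Definition epsL (h : W) : W :=
  tlift (fun h1 h2 : W => wcounit (wmul h1 h) *: h2) (wcomul (wone W)).

Definition epsL_space : {vspace W} := limg (linfun epsL).

Definition rone : wmod :=
  @WMod (subvs_of epsL_space)
    (fun h a => vsproj epsL_space (epsL (wmul h (vsval a)))).

(* The left unitor, a (x) v |-> a.v, and the inverse of the right unitor,
   v |-> 1^(1).v (x) 1^(2). *)
Definition rlun (V : wmod) (t : rten rone V) : V :=
  tlift (fun (a : rone) (v : V) => wact (vsval a : W) v) (vsval t).
Definition rrunV (V : wmod) (v : V) : rten V rone :=
  vsproj (rten_space V rone)
    (tlift (fun h1 h2 : W => tens (wact h1 v) (vsproj epsL_space h2 : rone))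
      (wcomul (wone W))).

(* [V0], [V1] is a (strong) monoidal functor from [A] to Rep(W), with structure
   isomorphisms [eta], of inverses [mu], and [psi]. *)
Record is_monoidal_functor (A : monCat) (V0 : A -> wmod)
    (V1 : forall f g : A, mhom f g -> V0 f -> V0 g)
    (mu : forall f g : A, rten (V0 f) (V0 g) -> V0 (mten f g))
    (eta : forall f g : A, V0 (mten f g) -> rten (V0 f) (V0 g))
    (psi : rone -> V0 (mone A)) : Prop := {
  mf_rep : forall f, is_rep (V0 f);
  mf_rep_ten : forall f g, is_rep (rten (V0 f) (V0 g));
  mf_rep_one : is_rep rone;
  mf_hom : forall (f g : A) (t : mhom f g), is_rep_hom (V1 _ _ t);
  mf_id : forall (f : A) v, V1 _ _ (mid f) v = v;
  mf_cmp : forall (f g h : A) (t : mhom g h) (s : mhom f g) v,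
    V1 _ _ (mcmp t s) v = V1 _ _ t (V1 _ _ s v);
  mf_eta_hom : forall f g, is_rep_hom (eta f g);
  mf_mu_hom : forall f g, is_rep_hom (mu f g);
  mf_etaK : forall f g, cancel (eta f g) (mu f g);
  mf_muK : forall f g, cancel (mu f g) (eta f g);
  mf_eta_nat : forall (f f' g g' : A) (s : mhom f f') (t : mhom g g') v,
    eta f' g' (V1 _ _ (mtenh s t) v) = rtmap (V1 _ _ s) (V1 _ _ t) (eta f g v);
  mf_psi_hom : is_rep_hom psi;
  mf_psi_bij : bijective psi;
  mf_assoc : forall (f g h : A) v,
    rassoc (rtmap (eta f g) id (eta (mten f g) h v))
    = rtmap id (eta g h) (eta f (mten g h) (V1 _ _ (massoc f g h) v));
  mf_lun : forall (f : A) (t : rten rone (V0 f)),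
    V1 _ _ (mlun f) (mu (mone A) f (rtmap psi id t)) = rlun t;
  mf_run : forall (f : A) (v : V0 f),
    V1 _ _ (mrun f) (mu f (mone A) (rtmap id psi (rrunV v))) = v }.

End Rep.

Section Tube.
Variables (K : numClosedFieldType) (C D : unitaryFusion K) (M : unitaryBimod C D).
Variables (sC : standardSolutions C) (sD : standardSolutions D).
Variables (bC : dualBases (@simpF K C)) (bD : dualBases (@simpF K D))
  (bM : dualBases (@simpM K C D M)).
Variable d : irrM M -> K.

Definition tidx : finType :=
  (irrF C * irrF D * irrM M * irrM M * irrM M * irrM M)%type.

Local Notation actI a m b := (act (simpF a) (simpM m) (simpF b)).

Definition tsummand (a : irrF C) (b : irrF D) (x z u w : irrM M) : vectType K :=
  tprod (mor M (simpM x) (actI a z b)) (mor M (actI a u b) (simpM w)).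

Definition tfam (p : tidx) : vectType K :=
  let: (a, b, x, z, u, w) := p in tsummand a b x z u w.

Definition tube : vectType K := dsum tfam.

Definition tgen a b x z u w (f : mor M (simpM x) (actI a z b))
    (g : mor M (actI a u b) (simpM w)) : tube :=
  @dinj K tidx tfam (a, b, x, z, u, w) (tens f g).

Definition tcomp a b x z u w (h : tube) : tsummand a b x z u w :=
  @dcomp K tidx tfam (a, b, x, z, u, w) h.

(* The linear map on [tube] with [tgen f g |-> B f g], for bilinear [B]. *)
Definition tube_lift (T : lmodType K)
    (B : forall a b x z u w, mor M (simpM x) (actI a z b) ->
           mor M (actI a u b) (simpM w) -> T) (h : tube) : T :=
  \sum_a \sum_b \sum_x \sum_z \sum_u \sum_w
    tlift (@B a b x z u w) (tcomp a b x z u w h).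

Lemma tcomp_gen_neq (a b a' b' x z u w x' z' u' w' : _) f g :
  (a', b', x', z', u', w') != (a, b, x, z, u, w) ->
  tcomp a' b' x' z' u' w' (@tgen a b x z u w f g) = 0.
Proof. by move=> ne; rewrite /tcomp /tgen /dinj dsum_ofE dfwith_out // eq_sym. Qed.

Lemma tcomp_gen a b x z u w f g :
  tcomp a b x z u w (@tgen a b x z u w f g) = tens f g.
Proof. by rewrite /tcomp /tgen /dinj dsum_ofE dfwith_in. Qed.

Lemma tube_lift_gen (T : lmodType K)
    (B : forall a b x z u w, mor M (simpM x) (actI a z b) ->
           mor M (actI a u b) (simpM w) -> T) a b x z u w f g :
  (forall y, linear (@B a b x z u w y)) -> (forall y, linear (@B a b x z u w ^~ y)) ->
  tube_lift B (@tgen a b x z u w f g) = B a b x z u w f g.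
Proof.
move=> Br Bl; rewrite /tube_lift.
have ne a' b' x' z' u' w' : (a', b', x', z', u', w') != (a, b, x, z, u, w) ->
   tlift (@B a' b' x' z' u' w') (tcomp a' b' x' z' u' w' (@tgen a b x z u w f g)) = 0.
  by move=> n; rewrite tcomp_gen_neq // tlift0.
rewrite (bigD1 a) //= [X in _ + X]big1 ?addr0; last first.
  move=> i n; do 5! (rewrite big1 // => ? _); apply: ne.
  by apply: contra n => /eqP [-> _ _ _ _ _].
rewrite (bigD1 b) //= [X in _ + X]big1 ?addr0; last first.
  move=> i n; do 4! (rewrite big1 // => ? _); apply: ne.
  by apply: contra n => /eqP [-> _ _ _ _].
rewrite (bigD1 x) //= [X in _ + X]big1 ?addr0; last first.
  move=> i n; do 3! (rewrite big1 // => ? _); apply: ne.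
  by apply: contra n => /eqP [-> _ _ _].
rewrite (bigD1 z) //= [X in _ + X]big1 ?addr0; last first.
  move=> i n; do 2! (rewrite big1 // => ? _); apply: ne.
  by apply: contra n => /eqP [-> _ _].
rewrite (bigD1 u) //= [X in _ + X]big1 ?addr0; last first.
  move=> i n; do 1! (rewrite big1 // => ? _); apply: ne.
  by apply: contra n => /eqP [-> _].
rewrite (bigD1 w) //= [X in _ + X]big1 ?addr0; last first.
  move=> i n; apply: ne.
  by apply: contra n => /eqP [->].
by rewrite tcomp_gen tlift_tens.
Qed.

(* [None] is the index of the unit object. *)
Definition tube_one : tube :=
  \sum_x \sum_u
    @tgen None None x x u u (act_unit (simpM x))^† (act_unit (simpM u)).

(* The factors delta_{z,x'} and delta_{u,w'} are accounted for by the components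
   (a', b'; z, z', u', u) of the second argument. *)
Definition tube_mul (h h' : tube) : tube :=
  tube_lift (fun a b x z u w f g =>
    \sum_a' \sum_b' \sum_z' \sum_u'
      tlift (fun (f' : mor M (simpM z) (actI a' z' b'))
                 (g' : mor M (actI a' u' b') (simpM u)) =>
        \sum_k \sum_s \sum_i \sum_j
          let tau := @bas _ _ _ _ bC k (simpF a ⊗ simpF a') i in
          let tau' := @dbas _ _ _ _ bC k (simpF a ⊗ simpF a') i in
          let sig := @bas _ _ _ _ bD s (simpF b' ⊗ simpF b) j in
          let sig' := @dbas _ _ _ _ bD s (simpF b' ⊗ simpF b) j in
          @tgen k s x z' u' w
            (acth tau' (idm (simpM z')) sig'
             ∘ act_asc (simpF a) (simpF a') (simpM z') (simpF b') (simpF b)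
             ∘ acth (idm (simpF a)) f' (idm (simpF b)) ∘ f)
            (g ∘ acth (idm (simpF a)) g' (idm (simpF b))
             ∘ (act_asc (simpF a) (simpF a') (simpM u') (simpF b') (simpF b))^†
             ∘ acth tau (idm (simpM u')) sig))
        (tcomp a' b' z z' u' u h')) h.

Definition tube_counit (h : tube) : K :=
  \sum_a \sum_b \sum_x \sum_z
    tlift (fun (f : mor M (simpM x) (actI a z b)) (g : mor M (actI a z b) (simpM x)) =>
             scal (g ∘ f) : K^o)
          (tcomp a b x z z x h).

Definition tube_comul (h : tube) : tprod tube tube :=
  tube_lift (fun a b x z u w f g =>
    \sum_i \sum_k \sum_r
      let e := @bas _ _ _ _ bM k (actI a i b) r in
      let e' := @dbas _ _ _ _ bM k (actI a i b) r in
      tens (tgen e g) (tgen f e')) h.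

Definition hat_g a u b w (g : mor M (actI a u b) (simpM w)) :
    mor M (simpM u) (actI (cj sC a) w (cj sD b)) :=
  acth (idm (simpF (cj sC a))) g (idm (simpF (cj sD b)))
  ∘ (act_asc (simpF (cj sC a)) (simpF a) (simpM u) (simpF b) (simpF (cj sD b)))^†
  ∘ acth (solR sC a) (idm (simpM u)) (solRb sD b) ∘ (act_unit (simpM u))^†.

Definition hat_f a z b x (f : mor M (simpM x) (actI a z b)) :
    mor M (actI (cj sC a) x (cj sD b)) (simpM z) :=
  act_unit (simpM z) ∘ acth (solR sC a)^† (idm (simpM z)) (solRb sD b)^†
  ∘ act_asc (simpF (cj sC a)) (simpF a) (simpM z) (simpF b) (simpF (cj sD b))
  ∘ acth (idm (simpF (cj sC a))) f (idm (simpF (cj sD b))).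

Definition tube_antipode (h : tube) : tube :=
  tube_lift (fun a b x z u w f g => (d u / d w) *: tgen (hat_g g) (hat_f f)) h.

Definition Tube : weakHopfData K :=
  @WeakHopfData K tube tube_mul tube_one tube_comul tube_counit tube_antipode.

Definition tube_e (s : irrM M) : Tube :=
  \sum_s' @tgen None None s' s' s s (act_unit (simpM s'))^† (act_unit (simpM s)).

Definition Vup_sort (F : bimodFun M) : vectType K :=
  dsum (fun p : irrM M * irrM M => mor M (simpM p.1) (F (simpM p.2))).

Definition Vup_in (F : bimodFun M) (x y : irrM M)
    (alpha : mor M (simpM x) (F (simpM y))) : Vup_sort F :=
  dinj (T := fun p : irrM M * irrM M => mor M (simpM p.1) (F (simpM p.2)))
    (x, y) alpha.

Definition Vup_act (F : bimodFun M) (h : Tube) (v : Vup_sort F) : Vup_sort F :=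
  tube_lift (fun a b x z u w f g =>
    Vup_in (bf_hom F g ∘ bf_actV F (simpF a) (simpM u) (simpF b)
            ∘ acth (idm (simpF a)) (dcomp (z, u) v) (idm (simpF b)) ∘ f)) h.

Definition Vup (F : FunCat M) : wmod Tube := @WMod K Tube (Vup_sort F) (@Vup_act F).

Definition Vup_map (F G : FunCat M) (t : mhom F G) (v : Vup F) : Vup G :=
  dsum_of (fun p => (t : bimodNat F G) (simpM p.2) ∘ dcomp p v).

Definition Vdown_sort (F : bimodFun M) : vectType K :=
  dsum (fun p : irrM M * irrM M => mor M (F (simpM p.1)) (simpM p.2)).

Definition Vdown_in (F : bimodFun M) (x y : irrM M)
    (alpha : mor M (F (simpM x)) (simpM y)) : Vdown_sort F :=
  dinj (T := fun p : irrM M * irrM M => mor M (F (simpM p.1)) (simpM p.2))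
    (x, y) alpha.

Definition Vdown_act (F : bimodFun M) (h : Tube) (v : Vdown_sort F) : Vdown_sort F :=
  tube_lift (fun a b x z u w f g =>
    Vdown_in (g ∘ acth (idm (simpF a)) (dcomp (z, u) v) (idm (simpF b))
              ∘ bf_act F (simpF a) (simpM z) (simpF b) ∘ bf_hom F f)) h.

(* V_f is contravariant in f, hence defined on the opposite category. *)
Definition Vdown (F : opRev (FunCat M)) : wmod Tube :=
  @WMod K Tube (Vdown_sort F) (@Vdown_act F).

Definition Vdown_map (F G : opRev (FunCat M)) (t : mhom F G) (v : Vdown F) :
    Vdown G :=
  dsum_of (fun p => dcomp p v ∘ (t : bimodNat G F) (simpM p.1)).

End Tube.

Arguments Vup_in {K C D M} F x y alpha.
Arguments Vdown_in {K C D M} F x y alpha.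

(* Main.v *)
(* For bimodule functors f and g put mu(alpha (x) beta) = g(alpha) o beta and let
   eta(gamma) = sum_e e (x) (g(e') o gamma), over dual bases e, e' of Hom(k, f(w)) and
   Hom(f(w), k), k simple. Then mu o eta = id since the e o e' add up to the identity of
   f(w), and Delta(h) acts on V^f (x) V^g as eta o h o mu, because the canonical element
   sum_e e (x) e' may be slid along any morphism. For h = 1 this says that Delta(1) is
   the projection eta o mu; hence the tensor product of Rep(W) is V^(f (x) g) transported
   along mu, and every axiom of a monoidal functor becomes a statement on mu and eta
   over the ground field. The unit object is treated likewise: with 1 = sum_s id_s in
   V^id and j(id_s) = e_s, one has epsilon_L(h) = j(h.1). *)

From HB Require Import structures.
Require Import Defs.
From mathcomp Require Import all_boot all_order all_algebra.
From mathcomp Require Import reals complex.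

Set Implicit Arguments.
Unset Strict Implicit.
Unset Printing Implicit Defensive.

Import Order.TTheory GRing.Theory Num.Theory.
Local Open Scope ring_scope.
Local Open Scope tube_scope.

(** * Linear and multilinear algebra *)

Lemma exchange_big4 (T : nmodType) (I J : finType) (m : I -> nat) (n : J -> nat)
    (f : forall i, 'I_(m i) -> forall j, 'I_(n j) -> T) :
  \sum_i \sum_(r < m i) \sum_j \sum_(s < n j) f i r j s
  = \sum_j \sum_(s < n j) \sum_i \sum_(r < m i) f i r j s.
Proof.
under eq_bigr => i _.
  rewrite exchange_big; under eq_bigr => j _ do rewrite exchange_big; over.
rewrite exchange_big; apply: eq_bigr => j _; exact: exchange_big.
Qed.

Section LinearProp.
Variables (K : fieldType).
Implicit Types (V U T : lmodType K).

Section OneMap.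
Variables (V U : lmodType K) (f : V -> U).
Hypothesis lf : linear f.
Let fl : {linear V -> U} := HB.pack f (GRing.isLinear.Build K V U *:%R f lf).

Lemma lin0 : f 0 = 0. Proof. exact: (linear0 fl). Qed.
Lemma linZ c v : f (c *: v) = c *: f v. Proof. exact: (linearZ_LR fl). Qed.
Lemma lin_sum I r (P : pred I) F :
  f (\sum_(i <- r | P i) F i) = \sum_(i <- r | P i) f (F i).
Proof. exact: (linear_sum fl). Qed.
End OneMap.

Lemma lin_id V : linear (fun v : V => v).
Proof. by []. Qed.
Lemma lin_comp V U T (g : U -> T) (f : V -> U) :
  linear g -> linear f -> linear (fun v => g (f v)).
Proof. by move=> lg lf c u v; rewrite lf lg. Qed.
Lemma lin_scale V U c (f : V -> U) : linear f -> linear (fun v => c *: f v).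
Proof. by move=> lf a u v; rewrite lf scalerDr !scalerA mulrC. Qed.
Lemma lin_scalel V U (f : V -> K^o) (w : U) :
  linear f -> linear (fun v => (f v : K) *: w).
Proof. by move=> lf a u v; rewrite lf scalerDl scalerA. Qed.
Lemma lin_bigsum V U I r (P : pred I) (F : I -> V -> U) :
  (forall i, linear (F i)) -> linear (fun v => \sum_(i <- r | P i) F i v).
Proof.
move=> lF a u v; rewrite scaler_sumr -big_split /=.
by apply: eq_bigr => i _; rewrite lF.
Qed.

Lemma eq_lin_sum2 V U T (I J : finType) (A : V -> T) (B : U -> T)
    (f : I -> J -> V) (g : I -> J -> U) : linear A -> linear B ->
  (forall i j, A (f i j) = B (g i j)) ->
  A (\sum_i \sum_j f i j) = B (\sum_i \sum_j g i j).
Proof.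
move=> lA lB e; rewrite (lin_sum lA) (lin_sum lB); apply: eq_bigr => i _.
by rewrite (lin_sum lA) (lin_sum lB); apply: eq_bigr => j _.
Qed.

Lemma linfunE (V U : vectType K) (f : V -> U) v : linear f -> linfun f v = f v.
Proof.
move=> lf; pose fl : {linear V -> U} := HB.pack f (GRing.isLinear.Build K V U *:%R f lf).
exact: (lfunE fl).
Qed.

Lemma memv_limgP (V U : vectType K) (f : V -> U) (u : U) : linear f ->
  u \in limg (linfun f) <-> exists v, u = f v.
Proof.
move=> lf; split.
  by case/memv_imgP=> v _ ->; exists v; rewrite linfunE.
by case=> v ->; rewrite -(linfunE v lf) memv_img ?memvf.
Qed.
End LinearProp.

Section TensorTheory.
Variable K : fieldType.
Implicit Types (V U X : vectType K).

Lemma tens_linr V U (v : V) : linear (fun u : U => tens v u).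
Proof. by move=> c x y; apply/matrixP=> i j; rewrite !mxE linearP mulrDr mulrCA. Qed.
Lemma tens_linl V U (u : U) : linear (fun v : V => tens v u).
Proof. by move=> c x y; apply/matrixP=> i j; rewrite !mxE linearP mulrDl mulrA. Qed.

Lemma tens_sum V U (t : tprod V U) : t = \sum_(i < \dim {: V}) \sum_(j < \dim {: U})
  (t : 'M_(_, _)) i j *: tens (vbasis {: V})`_i (vbasis {: U})`_j.
Proof.
rewrite {1}[t](@matrix_sum_delta K); apply: eq_bigr => i _; apply: eq_bigr => j _.
congr (_ *: _); apply/matrixP=> a b; rewrite !mxE !coord_free ?(basis_free (vbasisP _)) //.
by rewrite -natrM mulnb (eq_sym i) (eq_sym j).
Qed.

Lemma tens_ext V U (T : lmodType K) (A B : tprod V U -> T) :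
  linear A -> linear B -> (forall v u, A (tens v u) = B (tens v u)) -> A =1 B.
Proof.
move=> lA lB e t; rewrite (tens_sum t) !(lin_sum lA, lin_sum lB).
apply: eq_bigr => i _; rewrite (lin_sum lA) (lin_sum lB).
by apply: eq_bigr => j _; rewrite (linZ lA) (linZ lB) e.
Qed.

Lemma tlift_lin V U (T : lmodType K) (B : V -> U -> T) : linear (tlift B).
Proof. exact: tlift_is_linear. Qed.

Lemma tlift_comp V U (T T' : lmodType K) (B : V -> U -> T) (f : T -> T') t :
  linear f -> f (tlift B t) = tlift (fun v u => f (B v u)) t.
Proof.
move=> lf; rewrite (lin_sum lf); apply: eq_bigr => i _.
by rewrite (lin_sum lf); apply: eq_bigr => j _; rewrite (linZ lf).
Qed.

Lemma eq_tlift V U (T : lmodType K) (B B' : V -> U -> T) t :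
  (forall v u, B v u = B' v u) -> tlift B t = tlift B' t.
Proof. by move=> e; apply: eq_bigr => i _; apply: eq_bigr => j _; rewrite e. Qed.

Lemma tmap_lin V V' U U' (f : V -> V') (g : U -> U') : linear (tmap f g).
Proof. exact: tlift_lin. Qed.

Lemma tmap_tens V V' U U' (f : V -> V') (g : U -> U') v u :
  linear f -> linear g -> tmap f g (tens v u) = tens (f v) (g u).
Proof.
move=> lf lg; rewrite /tmap tlift_tens // => [x|y].
  exact: (lin_comp (tens_linr _) lg).
exact: (lin_comp (tens_linl _) lf).
Qed.

Lemma tmap_comp V V' V'' U U' U'' (f' : V' -> V'') (f : V -> V')
    (g' : U' -> U'') (g : U -> U') t :
  linear f -> linear f' -> linear g -> linear g' ->
  tmap f' g' (tmap f g t) = tmap (fun v => f' (f v)) (fun u => g' (g u)) t.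
Proof.
move=> lf lf' lg lg'; move: t; apply: tens_ext => [||v u].
- by apply: (@lin_comp _ _ _ _ (tmap f' g')); apply: tmap_lin.
- exact: tmap_lin.
by rewrite !tmap_tens //; apply: lin_comp.
Qed.

Lemma tmap_eq V V' U U' (f f' : V -> V') (g g' : U -> U') :
  f =1 f' -> g =1 g' -> tmap f g =1 tmap f' g'.
Proof. by move=> ef eg t; apply: eq_tlift => v u; rewrite ef eg. Qed.

Lemma tassoc_lin V U X : linear (@tassoc K V U X).
Proof. exact: tlift_lin. Qed.

Lemma tassoc_tens V U X (v : V) (u : U) (x : X) :
  tassoc (tens (tens v u) x) = tens v (tens u x).
Proof.
rewrite /tassoc tlift_tens.
- rewrite tlift_tens // => y; last exact: tens_linl.
  exact: (@lin_comp _ _ _ _ (fun t => tens y t) (fun u => tens u x)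
    (tens_linr _) (tens_linl _)).
- move=> t c y z; rewrite scaler_sumr -big_split /=; apply: eq_bigr => i _.
  rewrite scaler_sumr -big_split /=; apply: eq_bigr => j _.
  by rewrite tens_linr tens_linr scalerDr !scalerA mulrC.
- move=> y; exact: tlift_lin.
Qed.

End TensorTheory.

(** * A criterion for monoidality *)

Section MonoidalCriterion.
Variables (K : fieldType) (W : weakHopfData K).
Implicit Types V U : wmod W.

Lemma wact2_lin V U D : linear (@wact2 K W V U D).
Proof.
move=> c s t; rewrite /wact2 /tlift scaler_sumr -big_split /=; apply: eq_bigr => i _.
rewrite scaler_sumr -big_split /=; apply: eq_bigr => j _.
by rewrite tmap_lin scalerDr !scalerA mulrC.
Qed.

Lemma wact2_linD V U t : linear (fun D => @wact2 K W V U D t).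
Proof. exact: tlift_lin. Qed.

Lemma wact2_tens V U (D : tprod W W) v u : is_rep V -> is_rep U ->
  wact2 D (tens v u) = tlift (fun h1 h2 => tens (wact h1 v : V) (wact h2 u : U)) D.
Proof.
by move=> rV rU; apply: eq_tlift => h1 h2; rewrite tmap_tens //; apply: wact_linr.
Qed.

Lemma tmap_wact2 V V' U U' (f : V -> V') (g : U -> U') D t :
  is_rep V -> is_rep V' -> is_rep U -> is_rep U' -> is_rep_hom f -> is_rep_hom g ->
  tmap f g (wact2 D t) = wact2 D (tmap f g t).
Proof.
move=> rV rV' rU rU' [lf hf] [lg hg].
rewrite (tlift_comp _ _ (tmap_lin f g)); apply: eq_tlift => h1 h2.
rewrite !tmap_comp //; try exact: wact_linr.
by apply: tmap_eq => x; rewrite ?hf ?hg.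
Qed.

Section Fusion.
Variables (V U X : wmod W) (mu0 : tprod V U -> X) (eta0 : X -> tprod V U).
Hypotheses (rX : is_rep X) (lmu : linear mu0) (leta : linear eta0)
  (mu0K : cancel eta0 mu0)
  (wact2E : forall h t, wact2 (wcomul h) t = eta0 (wact h (mu0 t))).

Lemma wact2_one t : wact2 (wcomul (wone W)) t = eta0 (mu0 t).
Proof. by rewrite wact2E (wact1 rX). Qed.

Lemma mem_rten_space (t : tprod V U) : t \in rten_space V U <-> exists x, t = eta0 x.
Proof.
rewrite memv_limgP; last exact: wact2_lin.
split; first by case=> v ->; exists (mu0 v); rewrite wact2_one.
by case=> x ->; exists (eta0 x); rewrite wact2_one mu0K.
Qed.

Lemma eta_in x : eta0 x \in rten_space V U.
Proof. by apply/mem_rten_space; exists x. Qed.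

Lemma val_eta x : vsval (vsproj (rten_space V U) (eta0 x)) = eta0 x.
Proof. by rewrite vsprojK ?eta_in. Qed.

Lemma eta_mu (t : rten V U) : eta0 (mu0 (vsval t)) = vsval t.
Proof. by have /mem_rten_space [x ->] := subvsP t; rewrite mu0K. Qed.

Lemma rten_act h (t : rten V U) :
  vsval (wact h t : rten V U) = eta0 (wact h (mu0 (vsval t))).
Proof. by rewrite /= wact2E val_eta. Qed.

Lemma rtens_val v u : vsval (rtens v u : rten V U) = eta0 (mu0 (tens v u)).
Proof. by rewrite /rtens wact2_one val_eta. Qed.

Lemma rten_valP c (s t : rten V U) : vsval (c *: s + t : rten V U) = c *: vsval s + vsval t.
Proof. exact: linearP. Qed.

Lemma rten_inj (s t : rten V U) : vsval s = vsval t -> s = t.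
Proof. exact: val_inj. Qed.

Lemma rten_rep : is_rep (rten V U).
Proof.
split.
- move=> h c s t; apply: rten_inj; rewrite rten_valP !rten_act rten_valP lmu.
  by rewrite (wact_linr rX) leta.
- move=> t c h k; apply: rten_inj; rewrite rten_valP !rten_act.
  by rewrite (wact_linl rX) leta.
- by move=> t; apply: rten_inj; rewrite rten_act (wact1 rX) eta_mu.
- by move=> h k t; apply: rten_inj; rewrite !rten_act mu0K (wactM rX).
Qed.

Lemma mu_rep_hom : is_rep_hom (fun t : rten V U => mu0 (vsval t)).
Proof.
split; first by move=> c s t; rewrite rten_valP lmu.
by move=> h t; rewrite rten_act mu0K.
Qed.

Lemma eta_rep_hom :
  is_rep_hom (fun x => vsproj (rten_space V U) (eta0 x) : rten V U).
Proof.
split; first by move=> c s t; apply: rten_inj; rewrite rten_valP !val_eta leta.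
by move=> h t; apply: rten_inj; rewrite rten_act !val_eta mu0K.
Qed.
End Fusion.

Lemma rtmap_val V V' U U' (f : V -> V') (g : U -> U') (t : rten V U) :
  is_rep V -> is_rep V' -> is_rep U -> is_rep U' -> is_rep_hom f -> is_rep_hom g ->
  vsval (rtmap f g t) = tmap f g (vsval t).
Proof.
move=> rV rV' rU rU' hf hg; rewrite vsprojK //.
have /memv_limgP [|s ->] := subvsP t; first exact: wact2_lin.
by rewrite tmap_wact2 //; apply/memv_limgP; [exact: wact2_lin|eexists].
Qed.

Section Unit.
Variables (X : wmod W) (ob : X) (j : X -> W).
Hypotheses (rX : is_rep X) (lj : linear j)
  (epsLE : forall h, epsL h = j (wact h ob)) (jK : forall v, wact (j v) ob = v).

Lemma epsL_lin : linear (@epsL K W).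
Proof. by move=> c h k; rewrite !epsLE (wact_linl rX) lj. Qed.

Lemma mem_epsL_space h : h \in epsL_space W <-> exists v, h = j v.
Proof.
rewrite memv_limgP; last exact: epsL_lin.
split; first by case=> k ->; exists (wact k ob); rewrite epsLE.
by case=> v ->; exists (j v); rewrite epsLE jK.
Qed.

Lemma val_j v : vsval (vsproj (epsL_space W) (j v)) = j v.
Proof. by rewrite vsprojK //; apply/mem_epsL_space; exists v. Qed.

Lemma j_act (a : rone W) : j (wact (vsval a : W) ob) = vsval a.
Proof. by have /mem_epsL_space [v ->] := subvsP a; rewrite jK. Qed.

Lemma rone_act h (a : rone W) :
  vsval (wact h a : rone W) = j (wact h (wact (vsval a : W) ob)).
Proof. by rewrite /= epsLE val_j (wactM rX). Qed.

Lemma rone_valP c (a b : rone W) : vsval (c *: a + b : rone W) = c *: vsval a + vsval b.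
Proof. exact: linearP. Qed.

Lemma rone_inj (a b : rone W) : vsval a = vsval b -> a = b.
Proof. exact: val_inj. Qed.

Lemma rone_rep : is_rep (rone W).
Proof.
split.
- move=> h c a b; apply: rone_inj; rewrite rone_valP !rone_act rone_valP.
  by rewrite (wact_linl rX) (wact_linr rX) lj.
- move=> a c h k; apply: rone_inj; rewrite rone_valP !rone_act.
  by rewrite (wact_linl rX) lj.
- by move=> a; apply: rone_inj; rewrite rone_act (wact1 rX) j_act.
- by move=> h k a; apply: rone_inj; rewrite !rone_act jK (wactM rX).
Qed.

Definition psi (a : rone W) : X := wact (vsval a : W) ob.

Lemma psi_rep_hom : is_rep_hom psi.
Proof.
split; first by move=> c a b; rewrite /psi rone_valP (wact_linl rX).
by move=> h a; rewrite /psi rone_act jK.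
Qed.

Lemma psi_j v : psi (vsproj (epsL_space W) (j v)) = v.
Proof. by rewrite /psi val_j jK. Qed.

Lemma psi_bij : bijective psi.
Proof.
exists (fun v => vsproj (epsL_space W) (j v)) => [a|v]; last exact: psi_j.
by apply: rone_inj; rewrite /= val_j j_act.
Qed.

Variables (I : finType) (p : I -> W) (q : I -> X).
Hypothesis comul1 : wcomul (wone W) = \sum_i tens (p i) (j (q i)).

Lemma rrunVE (V : wmod W) (v : V) : is_rep V ->
  rrunV v = vsproj (rten_space V (rone W))
    (wact2 (wcomul (wone W)) (tens v (vsproj (epsL_space W) (j ob) : rone W))).
Proof.
move=> rV; congr (vsproj _ _); rewrite (wact2_tens _ _ _ rV rone_rep) comul1.
rewrite !(lin_sum (tlift_lin _)); apply: eq_bigr => i _.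
rewrite !tlift_tens.
- congr tens; apply: rone_inj.
  by rewrite rone_act !val_j jK (jK (q i)).
- by move=> h; apply: lin_comp; [apply: tens_linr|apply: (wact_linl rone_rep)].
- by move=> h; apply: (@lin_comp _ _ _ _ (fun t => tens t _));
    [apply: tens_linl|apply: (wact_linl rV)].
- by move=> h; apply: lin_comp; [apply: tens_linr|move=> c x y; rewrite linearP].
- by move=> h; apply: (@lin_comp _ _ _ _ (fun t => tens t _));
    [apply: tens_linl|apply: (wact_linl rV)].
Qed.
End Unit.

Section Criterion.
Variables (A : monCat) (V0 : A -> wmod W)
  (V1 : forall f g : A, mhom f g -> V0 f -> V0 g)
  (mu0 : forall f g : A, tprod (V0 f) (V0 g) -> V0 (mten f g))
  (eta0 : forall f g : A, V0 (mten f g) -> tprod (V0 f) (V0 g))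
  (ob : V0 (mone A)) (j : V0 (mone A) -> W)
  (I : finType) (p : I -> W) (q : I -> V0 (mone A)).
Arguments V1 {f g}.
Hypotheses (rV : forall f, is_rep (V0 f))
  (V1_hom : forall (f g : A) (t : mhom f g), is_rep_hom (V1 t))
  (V1_id : forall (f : A) v, V1 (mid f) v = v)
  (V1_cmp : forall (f g h : A) (t : mhom g h) (s : mhom f g) v,
    V1 (mcmp t s) v = V1 t (V1 s v))
  (lmu : forall f g, linear (@mu0 f g)) (leta : forall f g, linear (@eta0 f g))
  (mu0K : forall f g, cancel (@eta0 f g) (@mu0 f g))
  (wact2E : forall f g h t, wact2 (wcomul h) t = @eta0 f g (wact h (mu0 t)))
  (mu_nat : forall (f f' g g' : A) (s : mhom f f') (t : mhom g g') v u,
    mu0 (tens (V1 s v) (V1 t u)) = V1 (mtenh s t) (mu0 (tens v u)))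
  (eta_assoc : forall (f g h : A) v,
    tassoc (tmap (@eta0 f g) id (@eta0 (mten f g) h v))
    = tmap id (@eta0 g h) (eta0 (V1 (massoc f g h) v)))
  (lj : linear j) (epsLE : forall h, epsL h = j (wact h ob))
  (jK : forall v, wact (j v) ob = v)
  (comul1 : wcomul (wone W) = \sum_i tens (p i) (j (q i)))
  (mu_lun : forall f v u, V1 (mlun f) (mu0 (tens v u)) = wact (j v) u)
  (mu_run : forall f v, V1 (mrun f) (mu0 (tens v ob)) = v).

Definition mu_of f g (t : rten (V0 f) (V0 g)) : V0 (mten f g) := mu0 (vsval t).
Definition eta_of f g (v : V0 (mten f g)) : rten (V0 f) (V0 g) :=
  vsproj (rten_space (V0 f) (V0 g)) (eta0 v).

Let rten_r f g : is_rep (rten (V0 f) (V0 g)).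
Proof. exact: (rten_rep (rV _) (@lmu f g) (@leta f g) (@mu0K f g) (@wact2E f g)). Qed.
Let val_eta_of f g v : vsval (@eta_of f g v) = eta0 v.
Proof. exact: (val_eta (rV _) (@mu0K f g) (@wact2E f g)). Qed.
Let eta_hom f g : is_rep_hom (@eta_of f g).
Proof. exact: (eta_rep_hom (rV _) (@leta f g) (@mu0K f g) (@wact2E f g)). Qed.

Let mu_ofK f g : cancel (@mu_of f g) (@eta_of f g).
Proof.
move=> t; apply: val_inj; rewrite /= val_eta_of.
exact: (eta_mu (rV _) (@mu0K f g) (@wact2E f g)).
Qed.

Let id_hom (V : wmod W) : is_rep_hom (fun v : V => v).
Proof. by split. Qed.

Lemma monoidal_criterion : is_monoidal_functor (@V1) mu_of eta_of (psi ob).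
Proof.
have rone_r := rone_rep (rV _) lj epsLE jK.
have psi_hom := psi_rep_hom (rV _) lj epsLE jK.
split=> //.
- move=> f g; exact: (mu_rep_hom (rV _) (@lmu f g) (@mu0K f g) (@wact2E f g)).
- by move=> f g v; rewrite /mu_of val_eta_of mu0K.
- move=> f f' g g' s t v; apply: (can_inj (@mu_ofK f' g')).
  rewrite /mu_of val_eta_of mu0K.
  rewrite (rtmap_val _ (rV f) (rV f') (rV g) (rV g')) //.
  rewrite val_eta_of -{1}(mu0K v); move: (eta0 v); apply: tens_ext => [||x y].
  + exact: lin_comp (proj1 (V1_hom _)) (@lmu _ _).
  + exact: (lin_comp (@lmu _ _) (tmap_lin _ _)).
  + by rewrite tmap_tens ?mu_nat //; apply: (proj1 (V1_hom _)).
- exact: (psi_bij (rV _) lj epsLE jK).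
- move=> f g h v; rewrite /rassoc (rtmap_val _ (rV _) (rten_r _ _) (rV _) (rV _)) //.
  rewrite val_eta_of; set t := rtmap id _ _.
  have et : vsval t = tmap id (@eta_of g h) (eta0 (V1 (massoc f g h) v)).
    by rewrite (rtmap_val _ (rV _) (rV _) (rV _) (rten_r _ _)) // val_eta_of.
  rewrite -(vsvalK t) et; congr (vsproj _ _).
  rewrite tmap_comp //; last exact: (proj1 (eta_hom _ _)).
  rewrite (@tmap_eq _ _ _ _ _ _ (@eta0 f g) _ id (val_eta_of (g := g))) // eta_assoc.
  by rewrite tmap_comp //; move=> c x y; rewrite linearP.
- move=> f t; rewrite /mu_of.
  rewrite (rtmap_val _ rone_r (rV _) (rV f) (rV f)) //.
  rewrite /rlun; move: (vsval t); apply: tens_ext => [||a v].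
  + apply: (lin_comp (proj1 (V1_hom _))); exact: (lin_comp (@lmu _ _) (tmap_lin _ _)).
  + exact: tlift_lin.
  + rewrite tmap_tens ?mu_lun //; last exact: (proj1 psi_hom).
    rewrite (j_act (rV _) lj epsLE jK) tlift_tens //.
      by move=> b; apply: (wact_linr (rV _)).
    by move=> u; apply: (lin_comp (wact_linl (rV _) u)) => c x y; rewrite linearP.
- move=> f v; rewrite (rrunVE (rV _) lj epsLE jK comul1) //.
  rewrite /mu_of (rtmap_val _ (rV f) (rV f) rone_r (rV _)) //.
  rewrite vsprojK; last by apply/memv_limgP; [exact: wact2_lin|eexists].
  rewrite tmap_wact2 // (wact2_one (rV _) (@wact2E _ _)) mu0K tmap_tens //.
    by rewrite (psi_j (rV _) lj epsLE jK) mu_run.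
  exact: (proj1 psi_hom).
Qed.
End Criterion.

End MonoidalCriterion.

(** * Dual bases in semisimple categories *)

Section CmpTheory.
Variables (K : numClosedFieldType) (E : starCat K).
Implicit Types x y z : E.

Lemma cmp0m x y z (f : mor E x y) : (0 : mor E y z) ∘ f = 0.
Proof. exact: (lin0 (cmp_linl f)). Qed.
Lemma cmpm0 x y z (g : mor E y z) : g ∘ (0 : mor E x y) = 0.
Proof. exact: (lin0 (cmp_linr g)). Qed.
Lemma cmpZm x y z c (g : mor E y z) (f : mor E x y) : (c *: g) ∘ f = c *: (g ∘ f).
Proof. exact: (linZ (cmp_linl f)). Qed.
Lemma cmpmZ x y z c (g : mor E y z) (f : mor E x y) : g ∘ (c *: f) = c *: (g ∘ f).
Proof. exact: (linZ (cmp_linr g)). Qed.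
Lemma cmp_suml x y z J (r : seq J) (P : pred J) (g : J -> mor E y z) (f : mor E x y) :
  (\sum_(i <- r | P i) g i) ∘ f = \sum_(i <- r | P i) (g i ∘ f).
Proof. exact: (lin_sum (cmp_linl f)). Qed.
Lemma cmp_sumr x y z J (r : seq J) (P : pred J) (g : mor E y z) (f : J -> mor E x y) :
  g ∘ (\sum_(i <- r | P i) f i) = \sum_(i <- r | P i) (g ∘ f i).
Proof. exact: (lin_sum (cmp_linr g)). Qed.
End CmpTheory.

Section DualBases.
Variables (K : numClosedFieldType) (E : starCat K) (I : finType) (X : I -> E).
Hypothesis ss : finitely_semisimple X.

Lemma simple_idm_neq0 k : idm (X k) != 0.
Proof.
apply/eqP => id0; have := ss_simple ss k k; rewrite eqxx => dim1.
suff : (\dim {: mor E (X k) (X k)} == 0)%N by rewrite dim1.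
rewrite dimv_eq0 -subv0; apply/subvP => f _.
by rewrite memv0 -[f]cmp1m id0 cmp0m.
Qed.

Lemma simple_idm_basis k : basis_of {: mor E (X k) (X k)} [tuple of [:: idm (X k)]].
Proof. by rewrite basisEfree seq1_free simple_idm_neq0 subvf (ss_simple ss) eqxx. Qed.

Lemma simpleE k (f : mor E (X k) (X k)) : f = scal f *: idm (X k).
Proof.
by rewrite {1}(coord_basis (simple_idm_basis k) (memvf f)) big_ord_recl big_ord0 addr0.
Qed.

Lemma scal_lin k : linear (fun f : mor E (X k) (X k) => scal f : K^o).
Proof. by move=> c f g; rewrite /scal linearP. Qed.

Lemma scal_idm k : scal (idm (X k)) = 1.
Proof.
have /eqP := simpleE (idm (X k)).
rewrite -{1}[idm _]scale1r -subr_eq0 -scalerBl scaler_eq0 (negbTE (simple_idm_neq0 k)).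
by rewrite orbF subr_eq0 => /eqP.
Qed.

Lemma simple_hom0 k l (f : mor E (X k) (X l)) : k != l -> f = 0.
Proof.
move=> /negbTE kl; have := ss_simple ss k l; rewrite kl => /eqP; rewrite dimv_eq0.
by move=> /eqP e; apply/eqP; rewrite -memv0 -e memvf.
Qed.

Variable b : dualBases X.
Local Notation bas := (@bas K E I X b).
Local Notation dbas := (@dbas K E I X b).

Lemma scal_delta (i j : bool) k c : i = j -> scal (c *: (i%:R *: idm (X k))) = j%:R * c.
Proof.
move=> <-; rewrite !(linZ (@scal_lin k)) scal_idm.
by rewrite -[LHS]/(c * (i%:R * 1)) mulr1 mulrC.
Qed.

Lemma bas_expand k y (f : mor E (X k) y) :
  f = \sum_i scal (dbas i ∘ f) *: bas i.
Proof.
pose t := mktuple (fun i => bas i : mor E (X k) y).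
have bt : basis_of {: mor E (X k) y} t := bas_basis b k y.
have [c fE] : exists c, f = \sum_i c i *: bas i.
  exists (fun i => coord t i f); rewrite {1}(coord_basis bt (memvf f)).
  by apply: eq_bigr => i _; rewrite -tnth_nth tnth_mktuple.
rewrite {1}fE; apply: eq_bigr => i _; congr (_ *: _).
rewrite fE cmp_sumr (lin_sum (@scal_lin k)) (bigD1 i) // big1 /= => [|j ji].
  by rewrite addr0 cmpmZ dbas_bas (scal_delta _ _ (eqxx i)) mul1r.
by rewrite cmpmZ dbas_bas (scal_delta _ _ (negbTE _)) ?mul0r // eq_sym.
Qed.

Lemma dbas_expand k y (f : mor E y (X k)) :
  f = \sum_i scal (f ∘ bas i) *: dbas i.
Proof.
pose t := mktuple (fun i => dbas i : mor E y (X k)).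
have bt : basis_of {: mor E y (X k)} t := dbas_basis b k y.
have [c fE] : exists c, f = \sum_i c i *: dbas i.
  exists (fun i => coord t i f); rewrite {1}(coord_basis bt (memvf f)).
  by apply: eq_bigr => i _; rewrite -tnth_nth tnth_mktuple.
rewrite {1}fE; apply: eq_bigr => i _; congr (_ *: _).
rewrite fE cmp_suml (lin_sum (@scal_lin k)) (bigD1 i) // big1 /= => [|j ji].
  by rewrite addr0 cmpZm dbas_bas (scal_delta _ _ (eqxx i)) mul1r.
by rewrite cmpZm dbas_bas (scal_delta _ _ (negbTE ji)) ?mul0r.
Qed.

Lemma bas_sum y :
  \sum_k \sum_(i < \dim {: mor E (X k) y}) (bas i ∘ dbas i) = idm y :> mor E y y.
Proof.
have [n [l [p [q [_ _ pq1]]]]] := ss_decomp ss y.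
rewrite -[LHS]cmpm1 -pq1 cmp_sumr; apply: eq_bigr => r _; rewrite cmpA; congr (_ ∘ _).
rewrite cmp_suml (bigD1 (l r)) //= [X in _ + X]big1 ?addr0 => [|k kr].
  rewrite cmp_suml [RHS]bas_expand; apply: eq_bigr => i _.
  by rewrite -cmpA [X in _ ∘ X]simpleE cmpmZ cmpm1.
rewrite cmp_suml big1 // => i _.
by rewrite -cmpA (simple_hom0 (dbas i ∘ q r)) ?cmpm0 // eq_sym.
Qed.

Section Bilinear.
Variables (T : lmodType K) (y z : E) (B : forall k, mor E (X k) z -> mor E y (X k) -> T).
Hypotheses (Br : forall k f, linear (@B k f)) (Bl : forall k g, linear (@B k ^~ g)).

(* The canonical element of Hom(k, -) (x) Hom(-, k) is natural: [h] slides across it. *)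
Lemma bas_shift (h : mor E y z) :
  \sum_k \sum_(i < \dim {: mor E (X k) y}) @B k (h ∘ bas i) (dbas i)
  = \sum_k \sum_(i < \dim {: mor E (X k) z}) @B k (bas i) (dbas i ∘ h).
Proof.
apply: eq_bigr => k _.
under eq_bigr => i _ do rewrite [h ∘ bas i]bas_expand (lin_sum (@Bl k _)).
rewrite exchange_big; apply: eq_bigr => j _ /=.
rewrite [dbas j ∘ h]dbas_expand (lin_sum (@Br k _)); apply: eq_bigr => i _.
by rewrite (linZ (@Bl k _)) (linZ (@Br k _)) cmpA.
Qed.
End Bilinear.

Lemma bas_simple (T : lmodType K) l (B : forall k, mor E (X k) (X l) -> mor E (X l) (X k) -> T) :
  (forall k f, linear (@B k f)) -> (forall k g, linear (@B k ^~ g)) ->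
  \sum_k \sum_(i < \dim {: mor E (X k) (X l)}) @B k (bas i) (dbas i) = B l (idm (X l)) (idm (X l)).
Proof.
move=> Br Bl; rewrite (bigD1 l) //= [X in _ + X]big1 ?addr0 => [|k kl].
  rewrite [X in _ = B l _ X]dbas_expand (lin_sum (@Br l _)); apply: eq_bigr => i _.
  by rewrite cmp1m (linZ (@Br l _)) {1}[bas i]simpleE (linZ (@Bl l _)).
by rewrite big1 // => i _; rewrite (simple_hom0 (bas i)) // (lin0 (@Bl k _)).
Qed.
End DualBases.

(** * Coherence in bimodule categories *)

Section Unitary.
Variables (K : numClosedFieldType) (E : starCat K).
Implicit Types x y z w : E.

Lemma unitary_dag x y (f : mor E x y) : unitary f -> unitary f^†.
Proof. by case=> e1 e2; split; rewrite dagK. Qed.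

Lemma unitary_cmp x y z (g : mor E y z) (f : mor E x y) :
  unitary g -> unitary f -> unitary (g ∘ f).
Proof.
move=> [g1 g2] [f1 f2]; split; rewrite dag_cmp cmpA.
  by rewrite -(cmpA f^†) g1 cmpm1.
by rewrite -(cmpA g) f2 cmpm1.
Qed.

Lemma unitary_dag_swap x y z w (u : mor E x y) (v : mor E z w) (f : mor E x z)
    (g : mor E y w) :
  unitary u -> unitary v -> v ∘ f = g ∘ u -> v^† ∘ g = f ∘ u^†.
Proof.
move=> [_ u2] [v1 _] e.
by rewrite -[LHS]cmpm1 -u2 cmpA -(cmpA v^†) -e cmpA v1 cmp1m.
Qed.
End Unitary.

Section Coherence.
Variables (K : numClosedFieldType) (C D : unitaryFusion K) (M : unitaryBimod C D).
Implicit Types (F G : bimodFun M).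

Lemma acth_cmp a a' a'' m m' m'' b b' b'' (f' : mor C a' a'') (f : mor C a a')
    (h' : mor M m' m'') (h : mor M m m') (g' : mor D b' b'') (g : mor D b b') :
  acth (f' ∘ f) (h' ∘ h) (g' ∘ g) = acth f' h' g' ∘ acth f h g.
Proof. by rewrite /acth !bhom_cmp. Qed.

Lemma acth1 (a : C) (m : M) (b : D) : acth (idm a) (idm m) (idm b) = idm (act a m b).
Proof. by rewrite /acth !bhom1. Qed.

Lemma acth1_cmp a b x y z (h' : mor M y z) (h : mor M x y) :
  acth (idm a) (h' ∘ h) (idm b) = acth (idm a) h' (idm b) ∘ acth (idm a) h (idm b)
  :> mor M (act a x b) _.
Proof. by rewrite -acth_cmp !cmp1m. Qed.

Lemma acth_lin a a' m m' b b' (f : mor C a a') (g : mor D b b') :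
  linear (fun h : mor M m m' => acth f h g).
Proof. exact: (lin_comp (bhom_linl _ _) (bhom_linr _ _)). Qed.

Lemma acth_linl a a' m m' b b' (h : mor M m m') (g : mor D b b') :
  linear (fun f : mor C a a' => acth f h g).
Proof. exact: (lin_comp (bhom_linl _ g) (bhom_linl _ h)). Qed.

Lemma acth_linr a a' m m' b b' (f : mor C a a') (h : mor M m m') :
  linear (fun g : mor D b b' => acth f h g).
Proof. exact: bhom_linr. Qed.

Lemma unitary_idm (E : starCat K) (x : E) : unitary (idm x).
Proof.
have e : (idm x)^† = idm x by rewrite -[LHS]cmpm1 -{2}[idm x]dagK -dag_cmp cmpm1 dagK.
by split; rewrite e cmp1m.
Qed.

Lemma ractl x y z b b' (u : mor M y z) (v : mor M x y) (g : mor D b b') :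
  (u ⊲h idm b') ∘ (v ⊲h g) = (u ∘ v) ⊲h g.
Proof. by rewrite -bhom_cmp cmp1m. Qed.
Lemma ractr x y z b b' (v : mor M y z) (u : mor M x y) (g : mor D b b') :
  (v ⊲h g) ∘ (u ⊲h idm b) = (v ∘ u) ⊲h g.
Proof. by rewrite -bhom_cmp cmpm1. Qed.

Lemma ract_unitary m m' (b : D) (h : mor M m m') : unitary h -> unitary (h ⊲h idm b).
Proof.
move=> [h1 h2]; have [i1 i2] := unitary_idm b.
by split; rewrite bhom_dag -bhom_cmp ?h1 ?h2 ?i1 ?i2 bhom1.
Qed.

Lemma act_asc_unitary a a' m b' b : unitary (@act_asc K C D M a a' m b' b).
Proof.
apply: unitary_cmp; last exact/ract_unitary/unitary_dag/masc_unitary.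
apply: unitary_cmp; first exact: rasc_unitary.
exact/ract_unitary/ract_unitary/unitary_dag/lasc_unitary.
Qed.

Lemma act_asc_nat a1 a2 a1' a2' m1 m2 b1' b2' b1 b2 (f : mor C a1 a2)
    (f' : mor C a1' a2') (h : mor M m1 m2) (g' : mor D b1' b2') (g : mor D b1 b2) :
  act_asc a2 a2' m2 b2' b2 ∘ acth f (acth f' h g') g
  = acth (f ⊗h f') h (g' ⊗h g) ∘ act_asc a1 a1' m1 b1' b1.
Proof.
have e1 := unitary_dag_swap (masc_unitary _ _ _) (masc_unitary _ _ _)
  (masc_nat f (f' ⊳h h) g').
have e2 := unitary_dag_swap (lasc_unitary _ _ _) (lasc_unitary _ _ _)
  (lasc_nat f f' h).
rewrite /acth /act_asc -!cmpA (ractl (masc a2 _ _)^†) e1 -ractr (cmpA (_ ⊲h idm b2)).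
rewrite (ractl (_ ⊲h idm b2')) ractl e2 -!ractr.
by rewrite !cmpA rasc_nat.
Qed.

Lemma act_unit_unitary m : unitary (@act_unit K C D M m).
Proof. by apply: unitary_cmp; [exact: lunit_unitary|exact: runit_unitary]. Qed.

Lemma act_unit_nat m m' (h : mor M m m') :
  act_unit m' ∘ acth (idm _) h (idm _) = h ∘ act_unit m.
Proof. by rewrite /act_unit /acth -cmpA runit_nat cmpA lunit_nat cmpA. Qed.

Lemma act_unitV_nat m m' (h : mor M m m') :
  acth (idm _) h (idm _) ∘ (act_unit m)^† = (act_unit m')^† ∘ h.
Proof.
by rewrite (unitary_dag_swap (act_unit_unitary _) (act_unit_unitary _) (act_unit_nat h)).
Qed.

Lemma bf_actK F a m b : bf_actV F a m b ∘ bf_act F a m b = idm _.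
Proof.
rewrite /bf_act /bf_actV -cmpA (cmpA (_ ⊲h _)) -bhom_cmp bwd_fwd cmp1m bhom1 cmp1m.
by rewrite bwd_fwd.
Qed.

Lemma bf_actVK F a m b : bf_act F a m b ∘ bf_actV F a m b = idm _.
Proof.
rewrite /bf_act /bf_actV -cmpA (cmpA (fwd _)) fwd_bwd cmp1m -bhom_cmp fwd_bwd.
by rewrite cmp1m bhom1.
Qed.

Lemma bf_act_nat F a a' m m' b b' (f : mor C a a') (h : mor M m m') (g : mor D b b') :
  bf_act F a' m' b' ∘ bf_hom F (acth f h g) = acth f (bf_hom F h) g ∘ bf_act F a m b.
Proof.
rewrite /bf_act /acth -!cmpA bf_r_nat !cmpA -!bhom_cmp bf_l_nat.
by rewrite cmp1m cmpm1.
Qed.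

Lemma bf_actV_nat F a a' m m' b b' (f : mor C a a') (h : mor M m m') (g : mor D b b') :
  bf_hom F (acth f h g) ∘ bf_actV F a m b = bf_actV F a' m' b' ∘ acth f (bf_hom F h) g.
Proof.
rewrite -[LHS]cmp1m -(bf_actK F a' m' b') -cmpA (cmpA (bf_act F a' m' b')) bf_act_nat.
by rewrite -cmpA bf_actVK cmpm1.
Qed.

Lemma bf_act_asc F a a' m b' b :
  act_asc a a' (F m) b' b ∘ acth (idm a) (bf_act F a' m b') (idm b)
    ∘ bf_act F a (act a' m b') b
  = bf_act F (a ⊗ a') m (b' ⊗ b) ∘ bf_hom F (act_asc a a' m b' b).
Proof.
have dagm x y (u : mor M x y) : unitary u -> bf_hom F u ∘ bf_hom F u^† = idm _.
  by case=> _ e; rewrite -bf_cmp e bf1.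
have lE : (lasc a a' (F m))^† ∘ (idm a ⊳h fwd (bf_l F a' m)) ∘ fwd (bf_l F a (a' ⊳ m))
    = fwd (bf_l F (a ⊗ a') m) ∘ bf_hom F (lasc a a' m)^†.
  rewrite -[LHS]cmpm1 -(dagm _ _ _ (lasc_unitary a a' m)) !cmpA; congr (_ ∘ _).
  by rewrite -!cmpA (cmpA (_ ⊳h _)) -bf_l_asc cmpA (lasc_unitary _ _ _).1 cmp1m.
have mE : (masc a (F (a' ⊳ m)) b')^† ∘ (idm a ⊳h fwd (bf_r F (a' ⊳ m) b'))
      ∘ fwd (bf_l F a (act a' m b'))
    = (fwd (bf_l F a (a' ⊳ m)) ⊲h idm b') ∘ fwd (bf_r F (a ⊳ (a' ⊳ m)) b')
      ∘ bf_hom F (masc a (a' ⊳ m) b')^†.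
  rewrite -[LHS]cmpm1 -(dagm _ _ _ (masc_unitary a (a' ⊳ m) b')) !cmpA; congr (_ ∘ _).
  by rewrite -!cmpA (cmpA (_ ⊳h _)) -bf_masc !cmpA (masc_unitary _ _ _).1 cmp1m.
have nE := unitary_dag_swap (masc_unitary _ _ _) (masc_unitary _ _ _)
  (masc_nat (idm a) (fwd (bf_l F a' m)) (idm b')).
have e : act_asc a a' (F m) b' b ∘ acth (idm a) (bf_act F a' m b') (idm b)
    ∘ (fwd (bf_l F a (act a' m b')) ⊲h idm b)
  = (fwd (bf_l F (a ⊗ a') m) ⊲h idm (b' ⊗ b)) ∘ rasc (F ((a ⊗ a') ⊳ m)) b' b
    ∘ ((fwd (bf_r F ((a ⊗ a') ⊳ m) b')
        ∘ bf_hom F ((lasc a a' m)^† ⊲h idm b' ∘ (masc a (a' ⊳ m) b')^†)) ⊲h idm b).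
  rewrite -bhom1 -rasc_nat /act_asc /acth /bf_act lh1 -!cmpA -!rh1; congr (_ ∘ _).
  congr (_ ⊲h _).
  rewrite !cmpA -(cmpA _ _ (idm a ⊳h (_ ⊲h _))) nE -!cmpA (cmpA _ (_ ⊳h _)) mE.
  rewrite !cmpA -!rh1 lE bf_cmp rh1 !cmpA; congr (_ ∘ _).
  by rewrite -!cmpA bf_r_nat.
rewrite {1}/bf_act cmpA e rh1 -!cmpA -bf_r_nat /bf_act (cmpA (_ ⊲h _)).
rewrite (cmpA (_ ⊲h _ ∘ _)) (cmpA (_ ∘ (_ ⊲h _))) -(cmpA _ _ (_ ⊲h _)).
rewrite -!cmpA; congr (_ ∘ _).
rewrite /act_asc -(cmpA (rasc _ _ _)) -rh1 (bf_cmp _ (rasc _ _ _)) !cmpA; congr (_ ∘ _).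
exact: bf_r_asc.
Qed.

Lemma bf_actV_asc F a a' m b' b :
  bf_hom F (act_asc a a' m b' b)^† ∘ bf_actV F (a ⊗ a') m (b' ⊗ b)
    ∘ act_asc a a' (F m) b' b
  = bf_actV F a (act a' m b') b ∘ acth (idm a) (bf_actV F a' m b') (idm b).
Proof.
have PP : acth (idm a) (bf_act F a' m b') (idm b) ∘ acth (idm a) (bf_actV F a' m b') (idm b)
    = idm _ by rewrite -acth1_cmp bf_actVK acth1.
rewrite -[LHS]cmpm1 -PP cmpA; congr (_ ∘ _).
rewrite -[LHS]cmpm1 -(bf_actVK F a (act a' m b') b) cmpA -[RHS]cmp1m; congr (_ ∘ _).
rewrite -(cmpA _ (act_asc _ _ _ _ _)) -(cmpA _ (_ ∘ _)) bf_act_asc.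
rewrite cmpA -(cmpA _ (bf_actV _ _ _ _)) bf_actK cmpm1.
by rewrite -bf_cmp (act_asc_unitary _ _ _ _ _).1 bf1.
Qed.

Lemma bf_actV_unit F m :
  bf_hom F (act_unit m) ∘ bf_actV F (Defs.one C) m (Defs.one D) = act_unit (F m).
Proof.
rewrite -[RHS]cmpm1 -(bf_actVK F (Defs.one C) m (Defs.one D)) cmpA; congr (_ ∘ _).
rewrite /act_unit /bf_act cmpA -(cmpA _ _ (_ ⊲h _)) runit_nat.
by rewrite cmpA bf_l_unit bf_cmp -cmpA bf_r_unit.
Qed.

Lemma bf_act_unit F m :
  act_unit (F m) ∘ bf_act F (Defs.one C) m (Defs.one D) = bf_hom F (act_unit m).
Proof. by rewrite -bf_actV_unit -cmpA bf_actK cmpm1. Qed.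

Lemma bf_act_comp F G a m b :
  bf_act (bf_comp G F) a m b = bf_act G a (F m) b ∘ bf_hom G (bf_act F a m b).
Proof.
rewrite /bf_act /= rh1 -!cmpA; congr (_ ∘ _).
by rewrite bf_cmp !cmpA bf_r_nat.
Qed.

Lemma bf_actV_comp F G a m b :
  bf_actV (bf_comp G F) a m b = bf_hom G (bf_actV F a m b) ∘ bf_actV G a (F m) b.
Proof.
rewrite -[RHS]cmp1m -(bf_actK (bf_comp G F) a m b) -cmpA -[LHS]cmpm1; congr (_ ∘ _).
rewrite bf_act_comp cmpA -(cmpA (bf_act G _ _ _)) -bf_cmp bf_actVK bf1 cmpm1.
by rewrite (bf_actVK G).
Qed.

Lemma nt_act F G (t : bimodNat F G) a m b :
  bf_act G a m b ∘ t (act a m b) = acth (idm a) (t m) (idm b) ∘ bf_act F a m b.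
Proof.
rewrite /bf_act -cmpA nt_r cmpA -rh1 nt_l rh1 -cmpA.
by [].
Qed.

Lemma nt_actV F G (t : bimodNat F G) a m b :
  t (act a m b) ∘ bf_actV F a m b = bf_actV G a m b ∘ acth (idm a) (t m) (idm b).
Proof.
rewrite -[LHS]cmp1m -(bf_actK G a m b) -cmpA (cmpA (bf_act G a m b)) nt_act.
by rewrite -cmpA bf_actVK cmpm1.
Qed.

Lemma bf_act_id a m b : bf_act (@bf_id K C D M) a m b = idm _.
Proof. by rewrite /bf_act /= cmpm1 bhom1. Qed.
Lemma bf_actV_id a m b : bf_actV (@bf_id K C D M) a m b = idm _.
Proof. by rewrite /bf_actV /= cmp1m bhom1. Qed.
End Coherence.

(** * The tube algebra and the modules V^f *)

Section DirectSumTheory.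
Variables (K : fieldType) (I : finType) (T : I -> vectType K).

Lemma dcomp_lin i : linear (fun v : dsum T => dcomp i v).
Proof. by move=> c u v; rewrite dcompD dcompZ. Qed.

Lemma dcomp_dinj i (v : T i) : dcomp i (dinj i v) = v.
Proof. by rewrite dsum_ofE dfwith_in. Qed.

Lemma dcomp_dinj_neq i j (v : T i) : i != j -> dcomp j (dinj i v) = 0.
Proof. by move=> ij; rewrite dsum_ofE dfwith_out. Qed.

Lemma dinj_lin i : linear (fun v : T i => dinj i v).
Proof.
move=> c u v; apply: dsumP => j; rewrite dcompD dcompZ.
have [<-|ij] := eqVneq i j; first by rewrite !dcomp_dinj.
by rewrite !dcomp_dinj_neq // scaler0 addr0.
Qed.

Lemma dsum_dinj (v : dsum T) : v = \sum_i dinj i (dcomp i v).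
Proof.
apply: dsumP => j; rewrite (lin_sum (dcomp_lin j)) (bigD1 j) //= dcomp_dinj.
by rewrite big1 ?addr0 // => i ij; rewrite dcomp_dinj_neq.
Qed.

Lemma dsum_ext (U : lmodType K) (A B : dsum T -> U) : linear A -> linear B ->
  (forall i v, A (dinj i v) = B (dinj i v)) -> A =1 B.
Proof.
move=> lA lB e v; rewrite (dsum_dinj v) (lin_sum lA) (lin_sum lB).
by apply: eq_bigr => i _.
Qed.
End DirectSumTheory.

Section TubeTheory.
Variables (K : numClosedFieldType) (C D : unitaryFusion K) (M : unitaryBimod C D).
Variables (sC : standardSolutions C) (sD : standardSolutions D).
Variables (bC : dualBases (@simpF K C)) (bD : dualBases (@simpF K D))
  (bM : dualBases (@simpM K C D M)).
Variable d : irrM M -> K.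

Local Notation actI a m b := (act (simpF a) (simpM m) (simpF b)).
Local Notation tube := (tube M).
Local Notation W := (Tube sC sD bC bD bM d).
Local Notation Vup := (Vup sC sD bC bD bM d).

Lemma tlift_linB (V U : vectType K) (X T : lmodType K) (B : X -> V -> U -> T) t :
  (forall v u, linear (fun c => B c v u)) -> linear (fun c => tlift (B c) t).
Proof.
by move=> lB; apply: lin_bigsum => i; apply: lin_bigsum => j; apply: lin_scale.
Qed.

Lemma tcomp_lin a b x z u w : linear (@tcomp K C D M a b x z u w).
Proof. exact: (@dcomp_lin _ _ (@tfam K C D M) (a, b, x, z, u, w)). Qed.

Lemma tube_ext (T : lmodType K) (A B : tube -> T) : linear A -> linear B ->
  (forall a b x z u w f g, A (@tgen K C D M a b x z u w f g) = B (tgen f g)) -> A =1 B.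
Proof.
move=> lA lB e; apply: dsum_ext => // -[[[[[a b] x] z] u] w].
have li := @dinj_lin _ _ (@tfam K C D M) (a, b, x, z, u, w).
by apply: tens_ext => [||f g]; [apply: (lin_comp lA li)|apply: (lin_comp lB li)|apply: e].
Qed.

Lemma tube_lift_lin (T : lmodType K) B : linear (@tube_lift K C D M T B).
Proof.
do 6! (apply: lin_bigsum => ?).
by apply: (@lin_comp _ _ _ _ (tlift _)); [apply: tlift_lin|apply: tcomp_lin].
Qed.

Lemma tube_lift_linB (X T : lmodType K)
    (B : X -> forall a b x z u w, mor M (simpM x) (actI a z b) ->
           mor M (actI a u b) (simpM w) -> T) h :
  (forall a b x z u w f g, linear (fun c => B c a b x z u w f g)) ->
  linear (fun c => tube_lift (B c) h).
Proof. by move=> lB; do 6! (apply: lin_bigsum => ?); apply: tlift_linB => *; apply: lB. Qed.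

Lemma tgen_linr a b x z u w f : linear (fun g => @tgen K C D M a b x z u w f g).
Proof. exact: (lin_comp (@dinj_lin _ _ (@tfam K C D M) (a, b, x, z, u, w)) (tens_linr _)). Qed.
Lemma tgen_linl a b x z u w g : linear (fun f => @tgen K C D M a b x z u w f g).
Proof. exact: (lin_comp (@dinj_lin _ _ (@tfam K C D M) (a, b, x, z, u, w)) (tens_linl _)). Qed.

Lemma sum_tcomp_gen (T : lmodType K) a b x z u w (f : mor M (simpM x) (actI a z b))
    (g : mor M (actI a u b) (simpM w))
    (Phi : forall a b z u, @tsummand K C D M a b x z u w -> T) :
  (forall a b z u, Phi a b z u 0 = 0) ->
  \sum_a' \sum_b' \sum_z' \sum_u'
    Phi a' b' z' u' (tcomp a' b' x z' u' w (@tgen K C D M a b x z u w f g))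
  = Phi a b z u (tens f g).
Proof.
move=> Phi0.
have ne a' b' z' u' : (a', b', z', u') != (a, b, z, u) ->
   Phi a' b' z' u' (tcomp a' b' x z' u' w (@tgen K C D M a b x z u w f g)) = 0.
  by move=> n; rewrite tcomp_gen_neq ?Phi0 //; apply: contra n => /eqP [-> -> -> ->].
rewrite (bigD1 a) //= [X in _ + X]big1 ?addr0; last first.
  move=> i n; do 3! (rewrite big1 // => ? _); apply: ne.
  by apply: contra n => /eqP [-> _ _ _].
rewrite (bigD1 b) //= [X in _ + X]big1 ?addr0; last first.
  move=> i n; do 2! (rewrite big1 // => ? _); apply: ne.
  by apply: contra n => /eqP [-> _ _].
rewrite (bigD1 z) //= [X in _ + X]big1 ?addr0; last first.
  move=> i n; rewrite big1 // => ? _; apply: ne.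
  by apply: contra n => /eqP [-> _].
rewrite (bigD1 u) //= [X in _ + X]big1 ?addr0; last first.
  by move=> i n; apply: ne; apply: contra n => /eqP [->].
by rewrite tcomp_gen.
Qed.

Lemma tube_mul_lin (h : tube) : linear (tube_mul bC bD h).
Proof.
apply: tube_lift_linB => a b x z u w f g; do 4! (apply: lin_bigsum => ?).
by apply: (@lin_comp _ _ _ _ (tlift _)); [apply: tlift_lin|apply: tcomp_lin].
Qed.

Definition tube_prod a b x z u w a' b' z' u' (f : mor M (simpM x) (actI a z b))
    (g : mor M (actI a u b) (simpM w)) (f' : mor M (simpM z) (actI a' z' b'))
    (g' : mor M (actI a' u' b') (simpM u)) k s i j : tube :=
  @tgen K C D M k s x z' u' w
    (acth (@dbas _ _ _ _ bC k (simpF a ⊗ simpF a') i) (idm (simpM z'))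
         (@dbas _ _ _ _ bD s (simpF b' ⊗ simpF b) j)
     ∘ act_asc (simpF a) (simpF a') (simpM z') (simpF b') (simpF b)
     ∘ acth (idm (simpF a)) f' (idm (simpF b)) ∘ f)
    (g ∘ acth (idm (simpF a)) g' (idm (simpF b))
     ∘ (act_asc (simpF a) (simpF a') (simpM u') (simpF b') (simpF b))^†
     ∘ acth (@bas _ _ _ _ bC k (simpF a ⊗ simpF a') i) (idm (simpM u'))
         (@bas _ _ _ _ bD s (simpF b' ⊗ simpF b) j)).

Lemma tube_mul_genl a b x z u w (f : mor M (simpM x) (actI a z b))
    (g : mor M (actI a u b) (simpM w)) h :
  tube_mul bC bD (tgen f g) h
  = \sum_a' \sum_b' \sum_z' \sum_u' tlift (fun f' g' =>
      \sum_k \sum_s \sum_i \sum_j tube_prod f g f' g' (k := k) (s := s) i j)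
      (tcomp a' b' z z' u' u h).
Proof.
rewrite /tube_mul tube_lift_gen //.
- move=> y; do 4! apply: lin_bigsum => ?.
  apply: tlift_linB => f1 g1; do 4! apply: lin_bigsum => ?.
  apply: (lin_comp (tgen_linr _)); do 3! apply: (lin_comp (cmp_linl _)).
  exact: lin_id.
- move=> y; do 4! apply: lin_bigsum => ?.
  apply: tlift_linB => f1 g1; do 4! apply: lin_bigsum => ?.
  by apply: (lin_comp (tgen_linl _)); apply: cmp_linr.
Qed.

Lemma tube_mul_gen a b x z u w a' b' z' u' (f : mor M (simpM x) (actI a z b))
    (g : mor M (actI a u b) (simpM w)) (f' : mor M (simpM z) (actI a' z' b'))
    (g' : mor M (actI a' u' b') (simpM u)) :
  tube_mul bC bD (tgen f g) (tgen f' g')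
  = \sum_k \sum_s \sum_i \sum_j tube_prod f g f' g' (k := k) (s := s) i j.
Proof.
rewrite tube_mul_genl (@sum_tcomp_gen _ _ _ _ _ _ _ _ _ (fun a' b' z' u' => tlift _)).
  rewrite tlift_tens // => ?; do 4! apply: lin_bigsum => ?.
    apply: (lin_comp (tgen_linr _)).
    apply: (lin_comp (cmp_linl _)); apply: (lin_comp (cmp_linl _)).
    by apply: (lin_comp (cmp_linr _)); apply: acth_lin.
  apply: (lin_comp (tgen_linl _)).
  apply: (lin_comp (cmp_linl _)); apply: (lin_comp (cmp_linr _)).
  exact: acth_lin.
by move=> *; apply: tlift0.
Qed.

Lemma tube_mul_gen_neq a b x z u w a' b' x' z' u' w' (f : mor M (simpM x) (actI a z b))
    (g : mor M (actI a u b) (simpM w)) (f' : mor M (simpM x') (actI a' z' b'))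
    (g' : mor M (actI a' u' b') (simpM w')) :
  (x', w') != (z, u) -> tube_mul bC bD (tgen f g) (tgen f' g') = 0.
Proof.
move=> ne; rewrite tube_mul_genl; do 4! (rewrite big1 // => ? _).
rewrite tcomp_gen_neq ?tlift0 //; apply: contra ne => /eqP [_ _ -> _ _ ->].
by rewrite eqxx.
Qed.

Lemma bas_sum2 (T : lmodType K) (Y : C) (Z : D) (B : mor C Y Y -> mor D Z Z -> T) :
  (forall f, linear (B f)) -> (forall g, linear (B^~ g)) ->
  \sum_k \sum_s \sum_i \sum_j
    B (@bas _ _ _ _ bC k Y i ∘ dbas bC i) (@bas _ _ _ _ bD s Z j ∘ dbas bD j)
  = B (idm Y) (idm Z).
Proof.
move=> Br Bl; rewrite -(bas_sum (uf_ss C) bC Y) -(bas_sum (uf_ss D) bD Z).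
rewrite (lin_sum (Bl _)); apply: eq_bigr => k _.
rewrite exchange_big (lin_sum (Bl _)); apply: eq_bigr => i _.
by rewrite /= (lin_sum (Br _)); apply: eq_bigr => s _; rewrite (lin_sum (Br _)).
Qed.

Section VUp.
Variable F : bimodFun M.
Local Notation VF := (Vup (F : FunCat M)).
Local Notation VT := (fun p : irrM M * irrM M => mor M (simpM p.1) (F (simpM p.2))).

Definition Vup_comp (x y : irrM M) (v : Vup_sort F) : mor M (simpM x) (F (simpM y)) :=
  dcomp (x, y) v.

Lemma Vup_comp_lin x y : linear (fun v : VF => Vup_comp x y v).
Proof. exact: (@dcomp_lin _ _ VT (x, y)). Qed.
Lemma Vup_in_lin x y : linear (fun alpha => Vup_in F x y alpha : VF).
Proof. exact: (@dinj_lin _ _ VT (x, y)). Qed.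

Lemma Vup_inK x y al : Vup_comp x y (Vup_in F x y al) = al.
Proof. exact: (@dcomp_dinj _ _ VT (x, y) al). Qed.
Lemma Vup_in_neq x y x' y' al : (x', y') != (x, y) -> Vup_comp x y (Vup_in F x' y' al) = 0.
Proof. exact: (@dcomp_dinj_neq _ _ VT (x', y') (x, y) al). Qed.

Lemma Vup_comp_inj (v v' : VF) : (forall x y, Vup_comp x y v = Vup_comp x y v') -> v = v'.
Proof. by move=> e; apply: dsumP => -[x y]; apply: e. Qed.

Lemma Vup_ext (T : lmodType K) (A B : VF -> T) : linear A -> linear B ->
  (forall x y al, A (Vup_in F x y al) = B (Vup_in F x y al)) -> A =1 B.
Proof. by move=> lA lB e; apply: dsum_ext => // -[x y] v; apply: e. Qed.

Lemma Vup_sum (v : VF) : v = \sum_x \sum_y Vup_in F x y (Vup_comp x y v).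
Proof.
rewrite {1}[v]dsum_dinj (pair_bigA _ (fun x y => Vup_in F x y (Vup_comp x y v))).
by apply: eq_bigr => -[x y] _.
Qed.

Lemma Vup_act_gen a b x z u w f g (v : VF) :
  wact (@tgen K C D M a b x z u w f g : W) v
  = Vup_in F x w (bf_hom F g ∘ bf_actV F (simpF a) (simpM u) (simpF b)
      ∘ acth (idm (simpF a)) (Vup_comp z u v) (idm (simpF b)) ∘ f) :> VF.
Proof.
rewrite /= /Vup_act tube_lift_gen // => y.
  apply: (lin_comp (@Vup_in_lin _ _)); do 3! apply: (lin_comp (cmp_linl _)).
  exact: bf_lin.
by apply: (lin_comp (@Vup_in_lin _ _)); apply: cmp_linr.
Qed.

Lemma Vup_act_linl (v : VF) : linear (fun h : W => wact h v).
Proof. exact: tube_lift_lin. Qed.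

Lemma Vup_act_linr (h : W) : linear (fun v : VF => wact h v).
Proof.
apply: tube_lift_linB => *; apply: (lin_comp (@Vup_in_lin _ _)).
apply: (lin_comp (cmp_linl _)); apply: (lin_comp (cmp_linr _)).
by apply: (lin_comp (acth_lin _ _)); apply: Vup_comp_lin.
Qed.

Lemma Vup_act_unit x u (v : VF) :
  wact (@tgen K C D M None None x x u u (act_unit (simpM x))^† (act_unit (simpM u)) : W) v
  = Vup_in F x u (Vup_comp x u v) :> VF.
Proof.
rewrite Vup_act_gen bf_actV_unit -cmpA act_unitV_nat cmpA.
by rewrite (act_unit_unitary _).2 cmp1m.
Qed.

Lemma Vup_rep : is_rep VF.
Proof.
split; [exact: Vup_act_linr|exact: Vup_act_linl| |].
- move=> v; rewrite [RHS]Vup_sum (lin_sum (Vup_act_linl v)); apply: eq_bigr => x _.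
  by rewrite (lin_sum (Vup_act_linl v)); apply: eq_bigr => u _; apply: Vup_act_unit.
move=> h h' v; move: h'; apply: tube_ext => [||a' b' x' z' u' w' f' g'].
- exact: (lin_comp (Vup_act_linl v) (@tube_mul_lin h)).
- exact: (lin_comp (@Vup_act_linr h) (Vup_act_linl v)).
move: h; apply: tube_ext => [||a b x z u w f g].
- exact: (lin_comp (Vup_act_linl v) (tube_lift_lin _)).
- exact: Vup_act_linl.
have [|ne] := eqVneq (x', w') (z, u); last first.
  rewrite -[wmul _ _]/(tube_mul bC bD _ _) tube_mul_gen_neq //.
  rewrite (lin0 (Vup_act_linl v)) [in RHS]Vup_act_gen.
  by rewrite Vup_act_gen Vup_in_neq // (lin0 (acth_lin _ _)) cmpm0 cmp0m (lin0 (@Vup_in_lin _ _)).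
case=> ex ew; subst x' w'.
pose al := Vup_comp z' u' v.
pose B (s : mor C (simpF a ⊗ simpF a') _) (t : mor D (simpF b' ⊗ simpF b) _) : VF :=
  Vup_in F x w (bf_hom F (g ∘ acth (idm (simpF a)) g' (idm (simpF b))
     ∘ (act_asc (simpF a) (simpF a') (simpM u') (simpF b') (simpF b))^†)
   ∘ (bf_actV F _ _ _ ∘ acth s al t)
   ∘ (act_asc (simpF a) (simpF a') (simpM z') (simpF b') (simpF b)
     ∘ acth (idm (simpF a)) f' (idm (simpF b)) ∘ f)).
transitivity (B (idm _) (idm _)).
  rewrite -[wmul _ _]/(tube_mul bC bD _ _) tube_mul_gen -(@bas_sum2 _ _ _ B); last first.
  + move=> t; apply: (lin_comp (@Vup_in_lin _ _)); apply: (lin_comp (cmp_linl _)).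
    by do 2! apply: (lin_comp (cmp_linr _)); apply: acth_linl.
  + move=> s; apply: (lin_comp (@Vup_in_lin _ _)); apply: (lin_comp (cmp_linl _)).
    by do 2! apply: (lin_comp (cmp_linr _)); apply: acth_linr.
  do 4! (rewrite (lin_sum (Vup_act_linl v)); apply: eq_bigr => ? _).
  rewrite /tube_prod Vup_act_gen /B; congr (Vup_in F x w _).
  rewrite bf_cmp -[al in RHS]cmpm1 acth_cmp -/al.
  have mid (k : irrF C) (s : irrF D) (t : mor C (simpF k) _) (r : mor D (simpF s) _) :
    bf_hom F (acth t (idm (simpM u')) r) ∘ bf_actV F _ _ _
      ∘ acth (idm _) al (idm _)
    = bf_actV F (simpF a ⊗ simpF a') (simpM u') (simpF b' ⊗ simpF b) ∘ acth t al r.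
    by rewrite bf_actV_nat bf1 -cmpA -acth_cmp !cmpm1 cmp1m.
  rewrite (cmpA (bf_actV _ _ _ _)) -mid.
  set V := bf_actV _ _ _ _; set Q := act_asc _ _ (simpM z') _ _; clearbody V Q.
  by rewrite !cmpA.
rewrite !Vup_act_gen Vup_inK /B; congr (Vup_in F x w _).
have e1 : acth (idm (simpF a ⊗ simpF a')) al (idm (simpF b' ⊗ simpF b))
    ∘ act_asc (simpF a) (simpF a') (simpM z') (simpF b') (simpF b)
  = act_asc _ _ _ _ _ ∘ acth (idm (simpF a)) (acth (idm (simpF a')) al (idm (simpF b')))
      (idm (simpF b)) by rewrite act_asc_nat !bhom1.
rewrite -/al.
have e2 := bf_actV_asc F (simpF a) (simpF a') (simpM u') (simpF b') (simpF b).
have e3 := bf_actV_nat F (idm (simpF a)) g' (idm (simpF b)).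
move: e1 e2 e3; set V1 := bf_actV F (simpF a) (simpM u) (simpF b).
set V2 := bf_actV _ _ _ _; set V3 := bf_actV _ _ _ _; set V4 := bf_actV _ _ _ _.
set Q1 := act_asc _ _ _ _ _; set Q2 := act_asc _ _ _ _ _; set Q3 := act_asc _ _ _ _ _.
clearbody V1 V2 V3 V4 Q1 Q2 Q3 => e1 e2 e3.
rewrite !acth1_cmp !bf_cmp -!cmpA (cmpA _ Q1) e1 -cmpA (cmpA V2) (cmpA (bf_hom F Q3^†)).
rewrite (cmpA (bf_hom F Q3^†)) e2 -!cmpA (cmpA _ V3) e3.
by rewrite -!cmpA.
Qed.
End VUp.
End TubeTheory.

Section VUpMonoidal.
Variables (K : numClosedFieldType) (C D : unitaryFusion K) (M : unitaryBimod C D).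
Variables (sC : standardSolutions C) (sD : standardSolutions D)
  (bC : dualBases (@simpF K C)) (bD : dualBases (@simpF K D))
  (bM : dualBases (@simpM K C D M)) (d : irrM M -> K).
Implicit Types F G H : bimodFun M.

Local Notation actI a m b := (act (simpF a) (simpM m) (simpF b)).
Local Notation W := (Tube sC sD bC bD bM d).
Local Notation Vup F := (Vup sC sD bC bD bM d (F : FunCat M)).

Local Notation in_lin F x y := (@Vup_in_lin K C D M sC sD bC bD bM d F x y).

Definition up_mul F G (v : Vup F) (u : Vup G) : Vup (bf_comp G F) :=
  dsum_of (fun p => \sum_y bf_hom G (Vup_comp y p.2 v) ∘ Vup_comp p.1 y u).

Lemma up_mul_comp F G (v : Vup F) (u : Vup G) x w :
  Vup_comp x w (up_mul v u) = \sum_y bf_hom G (Vup_comp y w v) ∘ Vup_comp x y u.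
Proof. by rewrite /Vup_comp dsum_ofE. Qed.

Lemma up_mul_linr F G (v : Vup F) : linear (fun u : Vup G => up_mul v u).
Proof.
move=> c u u'; apply: Vup_comp_inj => x w.
rewrite Vup_comp_lin !up_mul_comp scaler_sumr -big_split; apply: eq_bigr => y _.
by rewrite Vup_comp_lin cmp_linr.
Qed.

Lemma up_mul_linl F G (u : Vup G) : linear (fun v : Vup F => up_mul v u).
Proof.
move=> c v v'; apply: Vup_comp_inj => x w.
rewrite Vup_comp_lin !up_mul_comp scaler_sumr -big_split; apply: eq_bigr => y _.
by rewrite Vup_comp_lin bf_lin cmp_linl.
Qed.

Definition up_mu F G : tprod (Vup F) (Vup G) -> Vup (bf_comp G F) :=
  tlift (@up_mul F G).

Lemma up_mu_lin F G : linear (@up_mu F G).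
Proof. exact: tlift_lin. Qed.

Lemma up_mu_tens F G v u : @up_mu F G (tens v u) = up_mul v u.
Proof. by rewrite /up_mu tlift_tens //; [apply: up_mul_linr|apply: up_mul_linl]. Qed.

Lemma up_mul_in F G x y w al be :
  up_mul (Vup_in F y w al : Vup F) (Vup_in G x y be : Vup G)
  = Vup_in (bf_comp G F) x w (bf_hom G al ∘ be).
Proof.
apply: Vup_comp_inj => x' w'; rewrite up_mul_comp.
have [[<- <-]|ne] := eqVneq (x, w) (x', w').
  rewrite Vup_inK (bigD1 y) //= !Vup_inK big1 ?addr0 // => y' ne.
  by rewrite Vup_in_neq ?(lin0 (@bf_lin _ _ _ _ G _ _)) ?cmp0m //;
     apply: contra ne => /eqP [->].
rewrite (@Vup_in_neq _ _ _ _ (bf_comp G F)) // big1 // => y' _.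
have [e1|ne1] := eqVneq x x'; last first.
  rewrite (@Vup_in_neq _ _ _ _ G) ?cmpm0 //.
  by apply: contra ne1 => /eqP [->].
rewrite (@Vup_in_neq _ _ _ _ F) ?(lin0 (@bf_lin _ _ _ _ G _ _)) ?cmp0m //.
by apply: contra ne; rewrite e1 => /eqP [_ ->].
Qed.

Definition up_eta F G (v : Vup (bf_comp G F)) : tprod (Vup F) (Vup G) :=
  \sum_x \sum_w \sum_k \sum_(r < \dim {: mor M (simpM k) (F (simpM w))})
    tens (Vup_in F k w (bas bM r) : Vup F)
      (Vup_in G x k (bf_hom G (dbas bM r) ∘ Vup_comp x w v) : Vup G).

Lemma up_eta_lin F G : linear (@up_eta F G).
Proof.
do 4! apply: lin_bigsum => ?; apply: (lin_comp (tens_linr _)).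
apply: (lin_comp (in_lin _ _ _)); apply: (lin_comp (cmp_linr _)).
exact: Vup_comp_lin.
Qed.

Lemma up_eta_in F G x w ga :
  up_eta (Vup_in (bf_comp G F) x w ga : Vup (bf_comp G F))
  = \sum_k \sum_(r < \dim {: mor M (simpM k) (F (simpM w))})
      tens (Vup_in F k w (bas bM r) : Vup F)
        (Vup_in G x k (bf_hom G (dbas bM r) ∘ ga) : Vup G).
Proof.
rewrite /up_eta (bigD1 x) //= [X in _ + X]big1 ?addr0 => [|x' ne].
  rewrite (bigD1 w) //= [X in _ + X]big1 ?addr0 => [|w' ne].
    by rewrite (@Vup_inK _ _ _ _ (bf_comp G F)).
  do 2! rewrite big1 // => ? _.
  rewrite (@Vup_in_neq _ _ _ _ (bf_comp G F)); last by apply: contra ne => /eqP [->].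
  by rewrite cmpm0 (lin0 (in_lin _ _ _)) (lin0 (tens_linr _)).
do 3! rewrite big1 // => ? _.
rewrite (@Vup_in_neq _ _ _ _ (bf_comp G F)); last by apply: contra ne => /eqP [->].
by rewrite cmpm0 (lin0 (in_lin _ _ _)) (lin0 (tens_linr _)).
Qed.

Lemma up_muK F G : cancel (@up_eta F G) (@up_mu F G).
Proof.
apply: Vup_ext => [||x w ga].
- exact: (lin_comp (@up_mu_lin _ _) (@up_eta_lin _ _)).
- exact: lin_id.
rewrite up_eta_in (lin_sum (@up_mu_lin _ _)) -[RHS]/(Vup_in (bf_comp G F) x w ga).
have -> : ga = bf_hom G (idm (F (simpM w))) ∘ ga by rewrite bf1 cmp1m.
rewrite -[in RHS](bas_sum (ub_ss M) bM) bf1 cmp1m.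
rewrite (lin_sum (@bf_lin _ _ _ _ G _ _)) cmp_suml (lin_sum (in_lin _ _ _)).
apply: eq_bigr => k _; rewrite (lin_sum (@up_mu_lin _ _)).
rewrite (lin_sum (@bf_lin _ _ _ _ G _ _)) cmp_suml (lin_sum (in_lin _ _ _)).
by apply: eq_bigr => r _; rewrite up_mu_tens up_mul_in cmpA bf_cmp.
Qed.

Lemma tube_comul_gen a b x z u w f g :
  tube_comul bM (@tgen K C D M a b x z u w f g)
  = \sum_i \sum_k \sum_(r < \dim {: mor M (simpM k) (actI a i b)})
      tens (tgen (bas bM r) g) (tgen f (dbas bM r)).
Proof.
rewrite /tube_comul tube_lift_gen // => y; do 3! apply: lin_bigsum => ?.
  exact: (lin_comp (tens_linl _) (tgen_linr _)).
exact: (lin_comp (tens_linr _) (tgen_linl _)).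
Qed.

Lemma up_wact2 F G (h : W) t :
  wact2 (wcomul h) t = up_eta (wact h (up_mu t)) :> tprod (Vup F) (Vup G).
Proof.
have rF := Vup_rep sC sD bC bD bM d F; have rG := Vup_rep sC sD bC bD bM d G.
have rGF := Vup_rep sC sD bC bD bM d (bf_comp G F).
move: t; apply: tens_ext => [||v v'].
- exact: wact2_lin.
- apply: (lin_comp (@up_eta_lin _ _)).
  exact: (lin_comp (wact_linr rGF h) (@up_mu_lin _ _)).
rewrite up_mu_tens; move: h; apply: tube_ext => [||a b x z u w f g].
- apply: (@lin_comp _ _ _ _ (fun D => wact2 D (tens v v')) (@tube_comul _ _ _ _ bM)).
    exact: wact2_linD.
  exact: tube_lift_lin.
- apply: (lin_comp (@up_eta_lin _ _)); exact: (wact_linl rGF).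
rewrite (wact2_tens _ _ _ rF rG) -[wcomul _]/(tube_comul bM _) tube_comul_gen.
rewrite Vup_act_gen up_eta_in.
pose h i := bf_hom F g ∘ bf_actV F _ _ _ ∘ acth (idm (simpF a)) (Vup_comp i u v) (idm (simpF b)).
pose q i := bf_actV G _ _ _ ∘ acth (idm (simpF a)) (Vup_comp z i v') (idm (simpF b)) ∘ f.
have -> : bf_hom (bf_comp G F) g ∘ bf_actV (bf_comp G F) (simpF a) (simpM u) (simpF b)
    ∘ acth (idm (simpF a)) (Vup_comp z u (up_mul v v')) (idm (simpF b)) ∘ f
  = \sum_i (bf_hom G (h i) ∘ q i).
  rewrite up_mul_comp (lin_sum (acth_lin _ _)) cmp_sumr cmp_suml; apply: eq_bigr => i _.
  have := bf_actV_nat G (idm (simpF a)) (Vup_comp i u v) (idm (simpF b)).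
  rewrite bf_actV_comp acth1_cmp /h /q.
  set V1 := bf_actV F _ _ _; set V2 := bf_actV G _ _ _; set V3 := bf_actV G _ _ _.
  by clearbody V1 V2 V3 => e; rewrite !bf_cmp !cmpA -(cmpA _ _ V2) e /= !cmpA.
rewrite (lin_sum (tlift_lin _)).
under [RHS]eq_bigr => k _ do under eq_bigr => r _ do
  rewrite cmp_sumr (lin_sum (in_lin _ _ _)) (lin_sum (tens_linr _)).
under [RHS]eq_bigr => k _ do rewrite exchange_big.
rewrite [RHS]exchange_big; apply: eq_bigr => i _.
pose B k (p : mor M (simpM k) (F (simpM w))) (p' : mor M (actI a i b) (simpM k)) :=
  tens (Vup_in F k w p : Vup F) (Vup_in G x k (bf_hom G p' ∘ q i) : Vup G).
under [RHS]eq_bigr => k _ do under eq_bigr => r _ do rewrite cmpA -bf_cmp.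
rewrite -[RHS](bas_shift (ub_ss M) bM (B := B)); last 2 first.
- move=> k p; apply: (lin_comp (tens_linr _)); apply: (lin_comp (in_lin _ _ _)).
  exact: (lin_comp (cmp_linl _) (@bf_lin _ _ _ _ G _ _)).
- by move=> k p; apply: (lin_comp (tens_linl _)); apply: (in_lin _ _ _).
rewrite (lin_sum (tlift_lin _)); apply: eq_bigr => k _.
rewrite (lin_sum (tlift_lin _)); apply: eq_bigr => r _.
rewrite tlift_tens; last 2 first.
- by move=> p; apply: (lin_comp (tens_linr _)); apply: (wact_linl rG).
- by move=> p; apply: (lin_comp (tens_linl _)); apply: (wact_linl rF).
by rewrite !Vup_act_gen /B /h /q !cmpA.
Qed.

Lemma Vup_map_comp F G (t : bimodNat F G) (v : Vup F) x y :
  Vup_comp x y (Vup_map (t : mhom (F : FunCat M) G) v : Vup G)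
  = t (simpM y) ∘ Vup_comp x y v.
Proof. by rewrite /Vup_comp dsum_ofE. Qed.

Lemma up_mu_nat F F' G G' (s : bimodNat F F') (t : bimodNat G G') (v : Vup F) (u : Vup G) :
  up_mu (tens (Vup_map (s : mhom (F : FunCat M) F') v : Vup F')
    (Vup_map (t : mhom (G : FunCat M) G') u : Vup G'))
  = Vup_map (nt_ten s t : mhom (bf_comp G F : FunCat M) (bf_comp G' F'))
      (up_mu (tens v u)) :> Vup (bf_comp G' F').
Proof.
apply: Vup_comp_inj => x w; rewrite Vup_map_comp !up_mu_tens !up_mul_comp cmp_sumr.
apply: eq_bigr => y _; rewrite !Vup_map_comp bf_cmp /=.
by rewrite -!cmpA (cmpA (bf_hom G' (Vup_comp _ _ _))) -nt_nat -cmpA !cmpA nt_nat.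
Qed.

Lemma up_eta_assoc_comp F G H x w (ga : mor M (simpM x) (H (G (F (simpM w))))) :
  tassoc (tmap (@up_eta F G) id
    (\sum_k \sum_(r < \dim {: mor M (simpM k) (G (F (simpM w)))})
      tens (Vup_in (bf_comp G F) k w (bas bM r) : Vup (bf_comp G F))
        (Vup_in H x k (bf_hom H (dbas bM r) ∘ ga) : Vup H)))
  = tmap id (@up_eta G H)
      (\sum_k \sum_(r < \dim {: mor M (simpM k) (F (simpM w))})
        tens (Vup_in F k w (bas bM r) : Vup F)
          (Vup_in (bf_comp H G) x k (bf_hom H (bf_hom G (dbas bM r)) ∘ ga)
             : Vup (bf_comp H G))).
Proof.
have leta F' G' := @up_eta_lin F' G'.
transitivity (\sum_k \sum_(r < \dim {: mor M (simpM k) (G (F (simpM w)))})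
  \sum_l \sum_(s < \dim {: mor M (simpM l) (F (simpM w))})
    tens (Vup_in F l w (bas bM s) : Vup F) (tens
      (Vup_in G k l (bf_hom G (dbas bM s) ∘ bas bM r) : Vup G)
      (Vup_in H x k (bf_hom H (dbas bM r) ∘ ga) : Vup H))).
  rewrite (lin_sum (tmap_lin _ _)) (lin_sum (@tassoc_lin _ _ _ _)); apply: eq_bigr => k _.
  rewrite (lin_sum (tmap_lin _ _)) (lin_sum (@tassoc_lin _ _ _ _)); apply: eq_bigr => r _.
  rewrite tmap_tens // up_eta_in (lin_sum (tens_linl _)) (lin_sum (@tassoc_lin _ _ _ _)).
  apply: eq_bigr => l _; rewrite (lin_sum (tens_linl _)) (lin_sum (@tassoc_lin _ _ _ _)).
  by apply: eq_bigr => s _; rewrite tassoc_tens.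
rewrite exchange_big4 (lin_sum (tmap_lin _ _)); apply: eq_bigr => l _.
rewrite (lin_sum (tmap_lin _ _)); apply: eq_bigr => s _.
rewrite tmap_tens // up_eta_in.
pose B k (p : mor M (simpM k) (G (simpM l))) (p' : mor M (G (F (simpM w))) (simpM k)) :=
  tens (Vup_in F l w (bas bM s) : Vup F) (tens (Vup_in G k l p : Vup G)
    (Vup_in H x k (bf_hom H p' ∘ ga) : Vup H)).
rewrite [LHS](bas_shift (ub_ss M) bM (B := B)).
- rewrite (lin_sum (tens_linr _)); apply: eq_bigr => k _.
  rewrite (lin_sum (tens_linr _)); apply: eq_bigr => r _.
  by rewrite /B bf_cmp cmpA.
- move=> k p; do 2! apply: (lin_comp (tens_linr _)); apply: (lin_comp (in_lin _ _ _)).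
  exact: (lin_comp (cmp_linl _) (@bf_lin _ _ _ _ H _ _)).
- move=> k p; apply: (lin_comp (tens_linr _)); apply: (lin_comp (tens_linl _)).
  exact: (in_lin _ _ _).
Qed.

Lemma up_eta_assoc (F G H : FunCat M) (v : Vup (mten (mten F G) H)) :
  tassoc (tmap (@up_eta F G) id (@up_eta (mten F G) H v))
  = tmap id (@up_eta G H) (@up_eta F (mten G H) (Vup_map (massoc F G H) v)).
Proof.
pose A (t : tprod (Vup (mten F G)) (Vup H)) := tassoc (tmap (@up_eta F G) id t).
pose B (t : tprod (Vup F) (Vup (mten G H))) := tmap id (@up_eta G H) t.
apply: (@eq_lin_sum2 _ _ _ _ _ _ A B) => [||x w].
- exact: (lin_comp (@tassoc_lin _ _ _ _) (tmap_lin _ _)).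
- exact: tmap_lin.
apply: etrans (@up_eta_assoc_comp F G H x w (Vup_comp x w v)) _.
rewrite /B; congr (tmap _ _ _); apply: eq_bigr => k _; apply: eq_bigr => r _.
congr (tens _ (Vup_in _ _ _ (_ ∘ _))).
by rewrite /Vup_comp dsum_ofE; symmetry; apply: cmp1m.
Qed.

End VUpMonoidal.

Section TubeUnit.
Variables (K : numClosedFieldType) (C D : unitaryFusion K) (M : unitaryBimod C D).
Variables (sC : standardSolutions C) (sD : standardSolutions D)
  (bC : dualBases (@simpF K C)) (bD : dualBases (@simpF K D))
  (bM : dualBases (@simpM K C D M)) (d : irrM M -> K).
Implicit Types F G H : bimodFun M.

Local Notation W := (Tube sC sD bC bD bM d).
Local Notation Vup F := (Vup sC sD bC bD bM d (F : FunCat M)).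
Local Notation in_lin F x y := (@Vup_in_lin K C D M sC sD bC bD bM d F x y).
Local Notation e_ := (tube_e sC sD bC bD bM d).
Local Notation unit_gen x u :=
  (@tgen K C D M None None x x u u (act_unit (simpM x))^† (act_unit (simpM u))).

Definition row_unit (k : irrM M) : W := \sum_u unit_gen k u.

Lemma Vup_comp_unit F (v : Vup F) x y x' y' :
  Vup_comp x y (Vup_in F x' y' (Vup_comp x' y' v))
  = if (x == x') && (y == y') then Vup_comp x y v else 0.
Proof.
have [->|nx] /= := eqVneq x x'; last first.
  by rewrite Vup_in_neq //; apply: contra nx => /eqP [->].
have [->|ny] := eqVneq y y'; first by rewrite Vup_inK.
by rewrite Vup_in_neq //; apply: contra ny => /eqP [->].
Qed.

Lemma Vup_act_row F (v : Vup F) k x y :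
  Vup_comp x y (wact (row_unit k) v : Vup F) = if x == k then Vup_comp x y v else 0.
Proof.
rewrite (lin_sum (Vup_act_linl v)) (lin_sum (@Vup_comp_lin _ _ _ _ sC sD bC bD bM d F x y)).
under eq_bigr => u _ do rewrite Vup_act_unit (Vup_comp_unit v).
case: ifP => /= [e|_]; last by rewrite big1.
by rewrite (bigD1 y) //= eqxx big1 ?addr0 // => u /negbTE; rewrite eq_sym => ->.
Qed.

Lemma Vup_act_e F (v : Vup F) s x y :
  Vup_comp x y (wact (e_ s) v : Vup F) = if y == s then Vup_comp x y v else 0.
Proof.
rewrite (lin_sum (Vup_act_linl v)) (lin_sum (@Vup_comp_lin _ _ _ _ sC sD bC bD bM d F x y)).
under eq_bigr => u _ do rewrite Vup_act_unit (Vup_comp_unit v).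
case: ifP => /= [e|_]; last by rewrite big1 // => i _; rewrite andbF.
by rewrite (bigD1 x) //= eqxx big1 ?addr0 // => u /negbTE; rewrite eq_sym => ->.
Qed.

Lemma tube_comul_one :
  wcomul (wone W) = \sum_k tens (row_unit k) (e_ k).
Proof.
have lD : linear (tube_comul bM) by exact: tube_lift_lin.
transitivity (\sum_x \sum_u \sum_i tens (unit_gen i u) (unit_gen x i)).
  rewrite /= /tube_one (lin_sum lD); apply: eq_bigr => x _.
  rewrite (lin_sum lD); apply: eq_bigr => u _; rewrite tube_comul_gen.
  apply: eq_bigr => i _.
  pose B k (p : mor M (simpM k) (act (Defs.one C) (simpM i) (Defs.one D)))
      (q : mor M (simpM i) (simpM k)) :=
    tens (@tgen K C D M None None k i u u p (act_unit (simpM u)))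
      (@tgen K C D M None None x x i k (act_unit (simpM x))^† (q ∘ act_unit (simpM i))).
  have Br k f : linear (B k f).
    exact: (lin_comp (tens_linr _) (lin_comp (tgen_linr _) (cmp_linl _))).
  have Bl k g : linear (B k ^~ g).
    apply: (lin_comp (tens_linl _)).
    exact: (@tgen_linl K C D M None None k i u u (act_unit (simpM u))).
  transitivity (\sum_k \sum_(r < \dim {: mor M (simpM k) (simpM i)})
     B k ((act_unit (simpM i))^† ∘ bas bM r) (dbas bM r)).
    rewrite (bas_shift (ub_ss M) bM Br Bl); apply: eq_bigr => k _; apply: eq_bigr => r _.
    by rewrite /B -cmpA (act_unit_unitary _).1 cmpm1.
  rewrite (bas_simple (ub_ss M) bM (B := fun k p q => B k ((act_unit (simpM i))^† ∘ p) q)) //.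
    by rewrite /B cmpm1 cmp1m.
  by move=> k g; apply: (lin_comp (Bl k g)); apply: cmp_linr.
rewrite exchange_big /=; under eq_bigr => u _ do rewrite exchange_big.
rewrite exchange_big; apply: eq_bigr => k _ /=.
rewrite exchange_big (lin_sum (tens_linr _)); apply: eq_bigr => x _.
by rewrite (lin_sum (tens_linl _)).
Qed.

Definition up_one : Vup bf_id := \sum_s Vup_in bf_id s s (idm (simpM s)).
Definition up_unit (v : Vup bf_id) : W := \sum_s scal (Vup_comp s s v) *: e_ s.

Lemma up_one_diag x : Vup_comp x x up_one = idm (simpM x).
Proof.
rewrite (lin_sum (@Vup_comp_lin _ _ _ _ sC sD bC bD bM d bf_id x x)) (bigD1 x) //=.
rewrite Vup_inK big1 ?addr0 // => s ne.
by rewrite Vup_in_neq //; apply: contra ne => /eqP [->].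
Qed.

Lemma up_one_off x y : x != y -> Vup_comp x y up_one = 0.
Proof.
move=> xy; rewrite (lin_sum (@Vup_comp_lin _ _ _ _ sC sD bC bD bM d bf_id x y)) big1 // => s _.
by rewrite Vup_in_neq //; apply: contra xy => /eqP [<- <-].
Qed.

Lemma tube_counit_lin : linear (fun h : W => tube_counit h : K^o).
Proof.
do 4! apply: lin_bigsum => ?.
by apply: (@lin_comp _ _ _ _ (tlift _)); [apply: tlift_lin|apply: tcomp_lin].
Qed.

(* Computing the counit through the module V^id dispenses with the unit laws of the tube
   algebra when evaluating [epsL]. *)
Lemma tube_counitE (h : W) :
  tube_counit h = \sum_s scal (Vup_comp s s (wact h up_one : Vup bf_id)) :> K^o.
Proof.
move: h; apply: tube_ext => [||a b x z u w f g].
- exact: tube_counit_lin.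
- apply: lin_bigsum => s; apply: (lin_comp (@scal_lin _ _ _ _ s)).
  apply: (@lin_comp _ _ _ _ (fun v : Vup bf_id => Vup_comp s s v)).
    exact: Vup_comp_lin.
  exact: Vup_act_linl.
rewrite Vup_act_gen.
have [ezu|nzu] := eqVneq z u; last first.
  rewrite up_one_off // (lin0 (acth_lin _ _)) cmpm0 cmp0m (lin0 (in_lin _ _ _)).
  rewrite [RHS]big1 => [|s _]; last first.
    by rewrite (lin0 (@Vup_comp_lin _ _ _ _ sC sD bC bD bM d bf_id s s))
      (lin0 (@scal_lin _ _ _ _ s)).
  rewrite /tube_counit; do 4! rewrite big1 // => ? _.
  by rewrite tcomp_gen_neq ?tlift0 //; apply: contra nzu => /eqP [_ _ _ -> ->].
subst u; rewrite up_one_diag [acth _ _ _]acth1 cmpm1 bf_actV_id cmpm1.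
have [exw|nxw] := eqVneq x w; last first.
  rewrite [RHS]big1 => [|s _]; last first.
    rewrite Vup_in_neq ?(lin0 (@scal_lin _ _ _ _ s)) //.
    by apply: contra nxw => /eqP [-> ->].
  rewrite /tube_counit; do 4! rewrite big1 // => ? _.
  by rewrite tcomp_gen_neq ?tlift0 //; apply: contra nxw => /eqP [_ _ -> _ _ ->].
subst w; rewrite [RHS](bigD1 x) //= Vup_inK [X in _ = _ + X]big1 ?addr0 => [|s ne]; last first.
  rewrite Vup_in_neq ?(lin0 (@scal_lin _ _ _ _ s)) //.
  by apply: contra ne => /eqP [->].
rewrite /tube_counit.
have ne a' b' x' z' (B : _ -> _ -> K^o) : (a', b', x', z') != (a, b, x, z) ->
    tlift B (tcomp a' b' x' z' z' x' (tgen f g)) = 0.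
  by move=> n; rewrite tcomp_gen_neq ?tlift0 //; apply: contra n => /eqP [-> -> -> ->].
rewrite (bigD1 a) //= [X in _ + X]big1 ?addr0; last first.
  move=> i n; do 3! (rewrite big1 // => ? _); apply: ne.
  by apply: contra n => /eqP [-> _ _ _].
rewrite (bigD1 b) //= [X in _ + X]big1 ?addr0; last first.
  move=> i n; do 2! (rewrite big1 // => ? _); apply: ne.
  by apply: contra n => /eqP [-> _ _].
rewrite (bigD1 x) //= [X in _ + X]big1 ?addr0; last first.
  move=> i n; rewrite big1 // => ? _; apply: ne.
  by apply: contra n => /eqP [-> _].
rewrite (bigD1 z) //= [X in _ + X]big1 ?addr0; last first.
  by move=> i n; apply: ne; apply: contra n => /eqP [->].
rewrite tcomp_gen tlift_tens // => [p|p].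
  by apply: (@lin_comp _ _ _ _ (fun f : mor M (simpM x) (simpM x) => scal f : K^o));
    [apply: scal_lin|apply: cmp_linl].
by apply: (@lin_comp _ _ _ _ (fun f : mor M (simpM x) (simpM x) => scal f : K^o));
    [apply: scal_lin|apply: cmp_linr].
Qed.

Lemma up_epsL (h : W) : epsL h = up_unit (wact h up_one).
Proof.
have r1 := Vup_rep sC sD bC bD bM d bf_id.
rewrite /epsL tube_comul_one (lin_sum (tlift_lin _)); apply: eq_bigr => k _.
rewrite tlift_tens; last 2 first.
- by move=> h1 c x y; rewrite linearP.
- move=> h2; apply: (@lin_scalel _ _ _ (fun h1 : W => tube_counit (tube_mul bC bD h1 h) : K^o)).
  apply: (@lin_comp _ _ _ _ (fun h : W => tube_counit h : K^o)); first exact: tube_counit_lin.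
  exact: tube_lift_lin.
congr (_ *: _); rewrite -[LHS]/(tube_counit (wmul (row_unit k) h)) tube_counitE.
under eq_bigr => s _ do rewrite (wactM r1) Vup_act_row
  (fun_if (fun f => scal f)) (lin0 (@scal_lin _ _ _ _ s)).
by rewrite -big_mkcond big_pred1_eq.
Qed.

Lemma Vup_act_up_unit F (v : Vup bf_id) (u : Vup F) x y :
  Vup_comp x y (wact (up_unit v) u : Vup F) = scal (Vup_comp y y v) *: Vup_comp x y u.
Proof.
have lx := @Vup_comp_lin _ _ _ _ sC sD bC bD bM d F x y.
rewrite (lin_sum (Vup_act_linl _)) (lin_sum lx).
under eq_bigr => s _ do rewrite (linZ (Vup_act_linl _)) (linZ lx) Vup_act_e.
rewrite (bigD1 y) //= eqxx big1 ?addr0 // => s /negbTE; rewrite eq_sym => ->.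
by rewrite scaler0.
Qed.

Lemma up_unitK (v : Vup bf_id) : wact (up_unit v) up_one = v.
Proof.
apply: Vup_comp_inj => x y; rewrite Vup_act_up_unit.
have [->|xy] := eqVneq x y; last by rewrite up_one_off // scaler0 [RHS](simple_hom0 (ub_ss M)).
by rewrite up_one_diag -(simpleE (ub_ss M)).
Qed.

Lemma up_unit_lin : linear up_unit.
Proof.
apply: lin_bigsum => s; apply: (@lin_scalel _ _ _
  (fun v : Vup bf_id => scal (Vup_comp s s v : mor M (simpM s) (simpM s)) : K^o)).
apply: (@lin_comp _ _ _ _ (fun f : mor M (simpM s) (simpM s) => scal f : K^o)).
  exact: scal_lin.
exact: Vup_comp_lin.
Qed.

Lemma up_unit_e s : up_unit (Vup_in bf_id s s (idm (simpM s))) = e_ s.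
Proof.
rewrite /up_unit (bigD1 s) //= Vup_inK big1 => [|k ks].
  by rewrite scal_idm ?addr0 ?scale1r //; apply: ub_ss.
by rewrite Vup_in_neq ?(lin0 (@scal_lin _ _ _ _ k)) ?scale0r // ; apply: contra ks => /eqP [->].
Qed.

Lemma up_lun F (v : Vup bf_id) (u : Vup F) :
  Vup_map (nt_lun F : mhom (bf_comp F bf_id : FunCat M) F) (up_mu (tens v u))
  = wact (up_unit v) u :> Vup F.
Proof.
apply: Vup_comp_inj => x w; rewrite Vup_map_comp up_mu_tens up_mul_comp cmp1m.
rewrite Vup_act_up_unit (bigD1 w) //= {1}(simpleE (ub_ss M) (Vup_comp w w v)).
rewrite (linZ (@bf_lin _ _ _ _ F _ _)) bf1 cmpZm cmp1m big1 ?addr0 // => y yw.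
rewrite (simple_hom0 (ub_ss M) (Vup_comp y w v)) //.
by rewrite (lin0 (@bf_lin _ _ _ _ F _ _)) cmp0m.
Qed.

Lemma up_run F (v : Vup F) :
  Vup_map (nt_run F : mhom (bf_comp bf_id F : FunCat M) F) (up_mu (tens v up_one)) = v :> Vup F.
Proof.
apply: Vup_comp_inj => x w; rewrite Vup_map_comp up_mu_tens up_mul_comp cmp1m (bigD1 x) //=.
rewrite up_one_diag cmpm1 big1 ?addr0 // => y; rewrite eq_sym => xy.
by rewrite up_one_off // cmpm0.
Qed.

End TubeUnit.

Section VUpFunctor.
Variables (K : numClosedFieldType) (C D : unitaryFusion K) (M : unitaryBimod C D).
Variables (sC : standardSolutions C) (sD : standardSolutions D)
  (bC : dualBases (@simpF K C)) (bD : dualBases (@simpF K D))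
  (bM : dualBases (@simpM K C D M)) (d : irrM M -> K).
Local Notation W := (Tube sC sD bC bD bM d).
Local Notation Vup F := (Vup sC sD bC bD bM d (F : FunCat M)).

Lemma Vup_map_hom (F G : bimodFun M) (t : bimodNat F G) :
  is_rep_hom (Vup_map (t : mhom (F : FunCat M) G) : Vup F -> Vup G).
Proof.
have lt : linear (Vup_map (t : mhom (F : FunCat M) G) : Vup F -> Vup G).
  move=> c v v'; apply: Vup_comp_inj => x y; rewrite Vup_map_comp.
  by rewrite !Vup_comp_lin !Vup_map_comp cmp_linr.
split=> // h v; move: h; apply: tube_ext => [||a b x z u w f g].
- exact: lin_comp lt (Vup_act_linl v).
- exact: Vup_act_linl.
rewrite !Vup_act_gen Vup_map_comp acth1_cmp; apply: Vup_comp_inj => x' w'.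
rewrite Vup_map_comp; have [[ex ew]|ne] := eqVneq (x, w) (x', w'); last first.
  by rewrite !Vup_in_neq // cmpm0.
subst x' w'; rewrite !Vup_inK.
have := nt_actV t (simpF a) (simpM u) (simpF b).
set V1 := bf_actV _ _ _ _; set V2 := bf_actV _ _ _ _; clearbody V1 V2 => e.
by rewrite !cmpA nt_nat -(cmpA _ _ V1) e !cmpA.
Qed.

Local Notation mu := (mu_of (V0 := Defs.Vup sC sD bC bD bM d) (@up_mu K C D M sC sD bC bD bM d)).
Local Notation eta := (eta_of (V0 := Defs.Vup sC sD bC bD bM d) (@up_eta K C D M sC sD bC bD bM d)).

Lemma up_monoidal : is_monoidal_functor
  (@Vup_map _ C D M sC sD bC bD bM d) mu eta (psi (up_one sC sD bC bD bM d)).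
Proof.
apply: (@monoidal_criterion K W (FunCat M) _ _ _ _ _ (@up_unit K C D M sC sD bC bD bM d)
  (irrM M) (row_unit sC sD bC bD bM d) (fun k => Vup_in bf_id k k (idm (simpM k)))).
- by move=> f; apply: Vup_rep.
- by move=> f g t; apply: Vup_map_hom.
- move=> f v; apply: (@Vup_comp_inj _ _ _ _ sC sD bC bD bM d f) => x y.
  by rewrite (@Vup_map_comp K C D M sC sD bC bD bM d f f) /= cmp1m.
- move=> f g h t s v; apply: (@Vup_comp_inj _ _ _ _ sC sD bC bD bM d h) => x y.
  have mapE F G := @Vup_map_comp K C D M sC sD bC bD bM d F G.
  by rewrite (mapE f h (nt_cmp t s) v) (mapE g h t (Vup_map s v)) (mapE f g s v) cmpA.
- by move=> f g; apply: up_mu_lin.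
- by move=> f g; apply: up_eta_lin.
- by move=> f g; apply: up_muK.
- by move=> f g h t; apply: up_wact2.
- by move=> f f' g g' s t v u; apply: up_mu_nat.
- by move=> f g h v; apply: up_eta_assoc.
- exact: up_unit_lin.
- exact: up_epsL.
- exact: up_unitK.
- by rewrite tube_comul_one; apply: eq_bigr => k _; rewrite up_unit_e.
- by move=> f v u; apply: up_lun.
- by move=> f v; apply: up_run.
Qed.
End VUpFunctor.

(** * The modules V_f *)

Section VDown.
Variables (K : numClosedFieldType) (C D : unitaryFusion K) (M : unitaryBimod C D).
Variables (sC : standardSolutions C) (sD : standardSolutions D)
  (bC : dualBases (@simpF K C)) (bD : dualBases (@simpF K D))
  (bM : dualBases (@simpM K C D M)) (d : irrM M -> K).
Local Notation actI a m b := (act (simpF a) (simpM m) (simpF b)).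
Local Notation W := (Tube sC sD bC bD bM d).
Local Notation Vdown F := (Vdown sC sD bC bD bM d (F : opRev (FunCat M))).
Local Notation unit_gen x u :=
  (@tgen K C D M None None x x u u (act_unit (simpM x))^† (act_unit (simpM u))).

Section OneFunctor.
Variable F : bimodFun M.
Local Notation VF := (Vdown F).
Local Notation VT := (fun p : irrM M * irrM M => mor M (F (simpM p.1)) (simpM p.2)).

Definition Vdown_comp (x y : irrM M) (v : Vdown_sort F) : mor M (F (simpM x)) (simpM y) :=
  dcomp (x, y) v.

Lemma Vdown_comp_lin x y : linear (fun v : VF => Vdown_comp x y v).
Proof. exact: (@dcomp_lin _ _ VT (x, y)). Qed.
Lemma Vdown_in_lin x y : linear (fun alpha => Vdown_in F x y alpha : VF).
Proof. exact: (@dinj_lin _ _ VT (x, y)). Qed.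

Lemma Vdown_inK x y al : Vdown_comp x y (Vdown_in F x y al) = al.
Proof. exact: (@dcomp_dinj _ _ VT (x, y) al). Qed.
Lemma Vdown_in_neq x y x' y' al :
  (x', y') != (x, y) -> Vdown_comp x y (Vdown_in F x' y' al) = 0.
Proof. exact: (@dcomp_dinj_neq _ _ VT (x', y') (x, y) al). Qed.

Lemma Vdown_comp_inj (v v' : VF) :
  (forall x y, Vdown_comp x y v = Vdown_comp x y v') -> v = v'.
Proof. by move=> e; apply: dsumP => -[x y]; apply: e. Qed.

Lemma Vdown_ext (T : lmodType K) (A B : VF -> T) : linear A -> linear B ->
  (forall x y al, A (Vdown_in F x y al) = B (Vdown_in F x y al)) -> A =1 B.
Proof. by move=> lA lB e; apply: dsum_ext => // -[x y] v; apply: e. Qed.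

Lemma Vdown_sum (v : VF) : v = \sum_x \sum_y Vdown_in F x y (Vdown_comp x y v).
Proof.
rewrite {1}[v]dsum_dinj (pair_bigA _ (fun x y => Vdown_in F x y (Vdown_comp x y v))).
by apply: eq_bigr => -[x y] _.
Qed.

Lemma Vdown_act_gen a b x z u w f g (v : VF) :
  wact (@tgen K C D M a b x z u w f g : W) v
  = Vdown_in F x w (g ∘ acth (idm (simpF a)) (Vdown_comp z u v) (idm (simpF b))
      ∘ bf_act F (simpF a) (simpM z) (simpF b) ∘ bf_hom F f) :> VF.
Proof.
rewrite /= /Vdown_act tube_lift_gen // => y.
  apply: (lin_comp (@Vdown_in_lin _ _)); do 2! apply: (lin_comp (cmp_linl _)).
  exact: cmp_linl.
apply: (lin_comp (@Vdown_in_lin _ _)); apply: (lin_comp (cmp_linr _)); exact: bf_lin.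
Qed.

Lemma Vdown_act_linl (v : VF) : linear (fun h : W => wact h v).
Proof. exact: tube_lift_lin. Qed.

Lemma Vdown_act_linr (h : W) : linear (fun v : VF => wact h v).
Proof.
apply: tube_lift_linB => *; apply: (lin_comp (@Vdown_in_lin _ _)).
do 2! apply: (lin_comp (cmp_linl _)); apply: (lin_comp (cmp_linr _)).
by apply: (lin_comp (acth_lin _ _)); apply: Vdown_comp_lin.
Qed.

Lemma Vdown_act_unit x u (v : VF) :
  wact (unit_gen x u : W) v = Vdown_in F x u (Vdown_comp x u v) :> VF.
Proof.
rewrite Vdown_act_gen act_unit_nat -(cmpA (Vdown_comp _ _ _)) bf_act_unit -cmpA -bf_cmp.
by rewrite (act_unit_unitary _).2 bf1 cmpm1.
Qed.

Lemma Vdown_rep : is_rep VF.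
Proof.
split; [exact: Vdown_act_linr|exact: Vdown_act_linl| |].
- move=> v; rewrite [RHS]Vdown_sum (lin_sum (Vdown_act_linl v)); apply: eq_bigr => x _.
  by rewrite (lin_sum (Vdown_act_linl v)); apply: eq_bigr => u _; apply: Vdown_act_unit.
move=> h h' v; move: h'; apply: tube_ext => [||a' b' x' z' u' w' f' g'].
- exact: (lin_comp (Vdown_act_linl v) (@tube_mul_lin _ _ _ _ bC bD h)).
- exact: (lin_comp (@Vdown_act_linr h) (Vdown_act_linl v)).
move: h; apply: tube_ext => [||a b x z u w f g].
- exact: (lin_comp (Vdown_act_linl v) (tube_lift_lin _)).
- exact: Vdown_act_linl.
have [|ne] := eqVneq (x', w') (z, u); last first.
  rewrite -[wmul _ _]/(tube_mul bC bD _ _) tube_mul_gen_neq //.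
  rewrite (lin0 (Vdown_act_linl v)) [in RHS]Vdown_act_gen.
  by rewrite Vdown_act_gen Vdown_in_neq // (lin0 (acth_lin _ _)) cmpm0 !cmp0m
    (lin0 (@Vdown_in_lin _ _)).
case=> ex ew; subst x' w'.
pose al := Vdown_comp z' u' v.
pose B (s : mor C (simpF a ⊗ simpF a') _) (t : mor D (simpF b' ⊗ simpF b) _) : VF :=
  Vdown_in F x w ((g ∘ acth (idm (simpF a)) g' (idm (simpF b))
     ∘ (act_asc (simpF a) (simpF a') (simpM u') (simpF b') (simpF b))^†)
   ∘ (acth s al t ∘ bf_act F _ _ _)
   ∘ bf_hom F (act_asc (simpF a) (simpF a') (simpM z') (simpF b') (simpF b)
     ∘ acth (idm (simpF a)) f' (idm (simpF b)) ∘ f)).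
transitivity (B (idm _) (idm _)).
  rewrite -[wmul _ _]/(tube_mul bC bD _ _) tube_mul_gen.
  rewrite -(@bas_sum2 _ _ _ bC bD _ _ _ B); last first.
  + move=> t; apply: (lin_comp (@Vdown_in_lin _ _)); apply: (lin_comp (cmp_linl _)).
    by apply: (lin_comp (cmp_linr _)); apply: (lin_comp (cmp_linl _)); apply: acth_linl.
  + move=> s; apply: (lin_comp (@Vdown_in_lin _ _)); apply: (lin_comp (cmp_linl _)).
    by apply: (lin_comp (cmp_linr _)); apply: (lin_comp (cmp_linl _)); apply: acth_linr.
  do 4! (rewrite (lin_sum (Vdown_act_linl v)); apply: eq_bigr => ? _).
  rewrite /tube_prod Vdown_act_gen /B; congr (Vdown_in F x w _).
  rewrite -[al in RHS]cmpm1 acth_cmp -/al.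
  rewrite -[X in bf_hom F (X ∘ f)]cmpA -[X in bf_hom F X]cmpA bf_cmp.
  set Y := bf_hom F (_ ∘ f); set A := _ ∘ _^†.
  have e1 (k : irrF C) (s : irrF D) (t : mor C _ (simpF k)) (r : mor D _ (simpF s)) :
    bf_act F _ _ _ ∘ bf_hom F (acth t (idm (simpM z')) r)
    = acth t (idm _) r ∘ bf_act F (simpF a ⊗ simpF a') (simpM z') (simpF b' ⊗ simpF b).
    by rewrite bf_act_nat bf1.
  rewrite !(cmpA _ _ Y) -(cmpA _ (bf_act _ _ _ _)) e1; congr (_ ∘ Y).
  set V := bf_act _ _ _ _; clearbody V A; rewrite !cmpA; congr (_ ∘ _ ∘ V).
  by rewrite -(cmpA A) -acth_cmp cmp1m !cmpm1.
rewrite !Vdown_act_gen Vdown_inK /B; congr (Vdown_in F x w _).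
have e1 : acth (idm (simpF a ⊗ simpF a')) al (idm (simpF b' ⊗ simpF b))
    ∘ act_asc _ _ _ _ _
  = act_asc (simpF a) (simpF a') (simpM u') (simpF b') (simpF b)
    ∘ acth (idm (simpF a)) (acth (idm (simpF a')) al (idm (simpF b')))
      (idm (simpF b)) by rewrite act_asc_nat !bhom1.
have e2 := bf_act_asc F (simpF a) (simpF a') (simpM z') (simpF b') (simpF b).
have e3 := bf_act_nat F (idm (simpF a)) f' (idm (simpF b)).
rewrite -/al.
have e4 := (act_asc_unitary (simpF a) (simpF a') (simpM u') (simpF b') (simpF b)).1.
move: e1 e2 e3 e4; set V1 := bf_act _ _ _ _; set V2 := bf_act _ _ _ _.
set V3 := bf_act _ _ _ _; set V4 := bf_act _ _ _ _.
set Q1 := act_asc _ _ _ _ _; set Q2 := act_asc _ _ _ _ _; set Q3 := act_asc _ _ _ _ _.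
clearbody V1 V2 V3 V4 Q1 Q2 Q3 => e1 e2 e3 e4.
rewrite !bf_cmp !cmpA; congr (_ ∘ _); rewrite !acth1_cmp !cmpA.
rewrite -(cmpA _ V3) -e2 !cmpA -(cmpA _ _ Q1) e1 !cmpA -(cmpA _ Q2^† Q2) e4 cmpm1.
by rewrite -(cmpA _ V2) e3 !cmpA.
Qed.
End OneFunctor.

Implicit Types F G H : bimodFun M.
Local Notation din_lin F x y := (@Vdown_in_lin F x y).

Definition down_mul F G (v : Vdown F) (u : Vdown G) : Vdown (bf_comp F G) :=
  dsum_of (fun p => \sum_y Vdown_comp y p.2 v ∘ bf_hom F (Vdown_comp p.1 y u)).

Lemma down_mul_comp F G (v : Vdown F) (u : Vdown G) x w :
  Vdown_comp x w (down_mul v u) = \sum_y Vdown_comp y w v ∘ bf_hom F (Vdown_comp x y u).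
Proof. by rewrite /Vdown_comp dsum_ofE. Qed.

Lemma down_mul_linr F G (v : Vdown F) : linear (fun u : Vdown G => down_mul v u).
Proof.
move=> c u u'; apply: Vdown_comp_inj => x w.
rewrite Vdown_comp_lin !down_mul_comp scaler_sumr -big_split; apply: eq_bigr => y _.
by rewrite Vdown_comp_lin bf_lin cmp_linr.
Qed.

Lemma down_mul_linl F G (u : Vdown G) : linear (fun v : Vdown F => down_mul v u).
Proof.
move=> c v v'; apply: Vdown_comp_inj => x w.
rewrite Vdown_comp_lin !down_mul_comp scaler_sumr -big_split; apply: eq_bigr => y _.
by rewrite Vdown_comp_lin cmp_linl.
Qed.

Definition down_mu F G : tprod (Vdown F) (Vdown G) -> Vdown (bf_comp F G) :=
  tlift (@down_mul F G).

Lemma down_mu_lin F G : linear (@down_mu F G).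
Proof. exact: tlift_lin. Qed.

Lemma down_mu_tens F G v u : @down_mu F G (tens v u) = down_mul v u.
Proof. by rewrite /down_mu tlift_tens //; [apply: down_mul_linr|apply: down_mul_linl]. Qed.

Lemma down_mul_in F G x y w al be :
  down_mul (Vdown_in F y w al : Vdown F) (Vdown_in G x y be : Vdown G)
  = Vdown_in (bf_comp F G) x w (al ∘ bf_hom F be).
Proof.
apply: Vdown_comp_inj => x' w'; rewrite down_mul_comp.
have [[<- <-]|ne] := eqVneq (x, w) (x', w').
  rewrite Vdown_inK (bigD1 y) //= !Vdown_inK big1 ?addr0 // => y' ne.
  by rewrite Vdown_in_neq ?cmp0m //; apply: contra ne => /eqP [->].
rewrite (@Vdown_in_neq (bf_comp F G)) // big1 // => y' _.
have [e1|ne1] := eqVneq x x'; last first.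
  rewrite (@Vdown_in_neq G) ?(lin0 (@bf_lin _ _ _ _ F _ _)) ?cmpm0 //.
  by apply: contra ne1 => /eqP [->].
rewrite (@Vdown_in_neq F) ?cmp0m //.
by apply: contra ne; rewrite e1 => /eqP [_ ->].
Qed.

Definition down_eta F G (v : Vdown (bf_comp F G)) : tprod (Vdown F) (Vdown G) :=
  \sum_x \sum_w \sum_k \sum_(r < \dim {: mor M (simpM k) (G (simpM x))})
    tens (Vdown_in F k w (Vdown_comp x w v ∘ bf_hom F (bas bM r)) : Vdown F)
      (Vdown_in G x k (dbas bM r) : Vdown G).

Lemma down_eta_lin F G : linear (@down_eta F G).
Proof.
do 4! apply: lin_bigsum => ?; apply: (lin_comp (tens_linl _)).
apply: (lin_comp (din_lin _ _ _)); apply: (lin_comp (cmp_linl _)).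
exact: Vdown_comp_lin.
Qed.

Lemma down_eta_in F G x w ga :
  down_eta (Vdown_in (bf_comp F G) x w ga : Vdown (bf_comp F G))
  = \sum_k \sum_(r < \dim {: mor M (simpM k) (G (simpM x))})
      tens (Vdown_in F k w (ga ∘ bf_hom F (bas bM r)) : Vdown F)
        (Vdown_in G x k (dbas bM r) : Vdown G).
Proof.
rewrite /down_eta (bigD1 x) //= [X in _ + X]big1 ?addr0 => [|x' ne].
  rewrite (bigD1 w) //= [X in _ + X]big1 ?addr0 => [|w' ne].
    by rewrite (@Vdown_inK (bf_comp F G)).
  do 2! rewrite big1 // => ? _.
  rewrite (@Vdown_in_neq (bf_comp F G)); last by apply: contra ne => /eqP [->].
  by rewrite cmp0m (lin0 (din_lin _ _ _)) (lin0 (tens_linl _)).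
do 3! rewrite big1 // => ? _.
rewrite (@Vdown_in_neq (bf_comp F G)); last by apply: contra ne => /eqP [->].
by rewrite cmp0m (lin0 (din_lin _ _ _)) (lin0 (tens_linl _)).
Qed.

Lemma down_muK F G : cancel (@down_eta F G) (@down_mu F G).
Proof.
apply: Vdown_ext => [||x w ga].
- exact: (lin_comp (@down_mu_lin _ _) (@down_eta_lin _ _)).
- exact: lin_id.
rewrite down_eta_in (lin_sum (@down_mu_lin _ _)) -[RHS]/(Vdown_in (bf_comp F G) x w ga).
have -> : ga = ga ∘ bf_hom F (idm (G (simpM x))) by rewrite bf1 cmpm1.
rewrite -[in RHS](bas_sum (ub_ss M) bM) bf1 cmpm1.
rewrite (lin_sum (@bf_lin _ _ _ _ F _ _)) cmp_sumr (lin_sum (din_lin _ _ _)).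
apply: eq_bigr => k _; rewrite (lin_sum (@down_mu_lin _ _)).
rewrite (lin_sum (@bf_lin _ _ _ _ F _ _)) cmp_sumr (lin_sum (din_lin _ _ _)).
by apply: eq_bigr => r _; rewrite down_mu_tens down_mul_in -cmpA bf_cmp.
Qed.

Lemma down_wact2 F G (h : W) t :
  wact2 (wcomul h) t = down_eta (wact h (down_mu t)) :> tprod (Vdown F) (Vdown G).
Proof.
have rF := Vdown_rep F; have rG := Vdown_rep G; have rGF := Vdown_rep (bf_comp F G).
move: t; apply: tens_ext => [||v v'].
- exact: wact2_lin.
- apply: (lin_comp (@down_eta_lin _ _)).
  exact: (lin_comp (wact_linr rGF h) (@down_mu_lin _ _)).
rewrite down_mu_tens; move: h; apply: tube_ext => [||a b x z u w f g].
- apply: (@lin_comp _ _ _ _ (fun D => wact2 D (tens v v')) (@tube_comul _ _ _ _ bM)).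
    exact: wact2_linD.
  exact: tube_lift_lin.
- apply: (lin_comp (@down_eta_lin _ _)); exact: (wact_linl rGF).
rewrite (wact2_tens _ _ _ rF rG) -[wcomul _]/(tube_comul bM _) tube_comul_gen.
rewrite Vdown_act_gen down_eta_in.
pose p i := g ∘ acth (idm (simpF a)) (Vdown_comp i u v) (idm (simpF b)) ∘ bf_act F _ _ _.
pose q i := acth (idm (simpF a)) (Vdown_comp z i v') (idm (simpF b)) ∘ bf_act G _ _ _ ∘ bf_hom G f.
have -> : g ∘ acth (idm (simpF a)) (Vdown_comp z u (down_mul v v')) (idm (simpF b))
    ∘ bf_act (bf_comp F G) (simpF a) (simpM z) (simpF b) ∘ bf_hom (bf_comp F G) f
  = \sum_i (p i ∘ bf_hom F (q i)).
  rewrite down_mul_comp (lin_sum (acth_lin _ _)) cmp_sumr !cmp_suml; apply: eq_bigr => i _.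
  have := bf_act_nat F (idm (simpF a)) (Vdown_comp z i v') (idm (simpF b)).
  rewrite bf_act_comp acth1_cmp /p /q.
  set V1 := bf_act F _ _ _; set V2 := bf_act G _ _ _; set V3 := bf_act F _ _ _.
  by clearbody V1 V2 V3 => e; rewrite !bf_cmp !cmpA -(cmpA _ V1) e /= !cmpA.
rewrite (lin_sum (tlift_lin _)).
under [RHS]eq_bigr => k _ do under eq_bigr => r _ do
  rewrite cmp_suml (lin_sum (din_lin _ _ _)) (lin_sum (tens_linl _)).
under [RHS]eq_bigr => k _ do rewrite exchange_big.
rewrite [RHS]exchange_big; apply: eq_bigr => i _.
pose B k (s : mor M (simpM k) (actI a i b)) (s' : mor M (G (simpM x)) (simpM k)) :=
  tens (Vdown_in F k w (p i ∘ bf_hom F s) : Vdown F) (Vdown_in G x k s' : Vdown G).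
under [RHS]eq_bigr => k _ do under eq_bigr => r _ do rewrite -cmpA -bf_cmp.
rewrite [RHS](bas_shift (ub_ss M) bM (B := B)); last 2 first.
- by move=> k s; apply: (lin_comp (tens_linr _)); apply: (din_lin _ _ _).
- move=> k s; apply: (lin_comp (tens_linl _)); apply: (lin_comp (din_lin _ _ _)).
  exact: (lin_comp (cmp_linr _) (@bf_lin _ _ _ _ F _ _)).
rewrite (lin_sum (tlift_lin _)); apply: eq_bigr => k _.
rewrite (lin_sum (tlift_lin _)); apply: eq_bigr => r _.
rewrite tlift_tens; last 2 first.
- by move=> s; apply: (lin_comp (tens_linr _)); apply: (wact_linl rG).
- by move=> s; apply: (lin_comp (tens_linl _)); apply: (wact_linl rF).
by rewrite !Vdown_act_gen /B /p /q !cmpA.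
Qed.

Lemma Vdown_map_comp F G (t : bimodNat G F) (v : Vdown F) x y :
  Vdown_comp x y (Vdown_map (t : mhom (F : opRev (FunCat M)) G) v : Vdown G)
  = Vdown_comp x y v ∘ t (simpM x).
Proof. by rewrite /Vdown_comp dsum_ofE. Qed.

Lemma Vdown_map_hom F G (t : bimodNat G F) :
  is_rep_hom (Vdown_map (t : mhom (F : opRev (FunCat M)) G) : Vdown F -> Vdown G).
Proof.
have lt : linear (Vdown_map (t : mhom (F : opRev (FunCat M)) G) : Vdown F -> Vdown G).
  move=> c v v'; apply: Vdown_comp_inj => x y; rewrite Vdown_map_comp.
  by rewrite !Vdown_comp_lin !Vdown_map_comp cmp_linl.
split=> // h v; move: h; apply: tube_ext => [||a b x z u w f g].
- exact: lin_comp lt (Vdown_act_linl v).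
- exact: Vdown_act_linl.
rewrite !Vdown_act_gen Vdown_map_comp acth1_cmp; apply: Vdown_comp_inj => x' w'.
rewrite Vdown_map_comp; have [[ex ew]|ne] := eqVneq (x, w) (x', w'); last first.
  by rewrite !Vdown_in_neq // cmp0m.
subst x' w'; rewrite !Vdown_inK.
have := nt_act t (simpF a) (simpM z) (simpF b).
set V1 := bf_act _ _ _ _; set V2 := bf_act _ _ _ _; clearbody V1 V2 => e.
by rewrite -(cmpA _ _ (t _)) -nt_nat !cmpA -(cmpA _ V1) e !cmpA.
Qed.

Lemma down_mu_nat F F' G G' (s : bimodNat F' F) (t : bimodNat G' G)
    (v : Vdown F) (u : Vdown G) :
  down_mu (tens (Vdown_map (s : mhom (F : opRev (FunCat M)) F') v : Vdown F')
    (Vdown_map (t : mhom (G : opRev (FunCat M)) G') u : Vdown G'))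
  = Vdown_map (nt_ten t s : mhom (bf_comp F G : opRev (FunCat M)) (bf_comp F' G'))
      (down_mu (tens v u)) :> Vdown (bf_comp F' G').
Proof.
apply: Vdown_comp_inj => x w; rewrite Vdown_map_comp !down_mu_tens !down_mul_comp cmp_suml.
apply: eq_bigr => y _; rewrite !Vdown_map_comp bf_cmp /=.
by rewrite !cmpA -(cmpA _ _ (s _)) -nt_nat !cmpA.
Qed.
End VDown.

Section VDownMonoidal.
Variables (K : numClosedFieldType) (C D : unitaryFusion K) (M : unitaryBimod C D).
Variables (sC : standardSolutions C) (sD : standardSolutions D)
  (bC : dualBases (@simpF K C)) (bD : dualBases (@simpF K D))
  (bM : dualBases (@simpM K C D M)) (d : irrM M -> K).
Local Notation W := (Tube sC sD bC bD bM d).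
Local Notation Vdown F := (Vdown sC sD bC bD bM d (F : opRev (FunCat M))).
Local Notation Vup F := (Vup sC sD bC bD bM d (F : FunCat M)).
Local Notation din_lin F x y := (@Vdown_in_lin K C D M sC sD bC bD bM d F x y).
Local Notation e_ := (tube_e sC sD bC bD bM d).
Local Notation down_eta := (@down_eta K C D M sC sD bC bD bM d).
Local Notation down_eta_lin := (@down_eta_lin K C D M sC sD bC bD bM d).

Lemma down_eta_assoc_comp (F G H : bimodFun M) x w
    (ga : mor M (F (G (H (simpM x)))) (simpM w)) :
  tassoc (tmap (@down_eta F G) id
    (\sum_k \sum_(r < \dim {: mor M (simpM k) (H (simpM x))})
      tens (Vdown_in (bf_comp F G) k w (ga ∘ bf_hom F (bf_hom G (bas bM r)))
          : Vdown (bf_comp F G))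
        (Vdown_in H x k (dbas bM r) : Vdown H)))
  = tmap id (@down_eta G H)
      (\sum_k \sum_(r < \dim {: mor M (simpM k) (G (H (simpM x)))})
        tens (Vdown_in F k w (ga ∘ bf_hom F (bas bM r)) : Vdown F)
          (Vdown_in (bf_comp G H) x k (dbas bM r) : Vdown (bf_comp G H))).
Proof.
have leta (F' G' : bimodFun M) := @down_eta_lin F' G'.
transitivity (\sum_l \sum_(s < \dim {: mor M (simpM l) (G (H (simpM x)))})
  \sum_k \sum_(r < \dim {: mor M (simpM k) (H (simpM x))})
    tens (Vdown_in F l w (ga ∘ bf_hom F (bas bM s)) : Vdown F) (tens
      (Vdown_in G k l (dbas bM s ∘ bf_hom G (bas bM r)) : Vdown G)
      (Vdown_in H x k (dbas bM r) : Vdown H))); last first.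
  rewrite (lin_sum (tmap_lin _ _)); apply: eq_bigr => l _.
  rewrite (lin_sum (tmap_lin _ _)); apply: eq_bigr => s _.
  rewrite tmap_tens // down_eta_in (lin_sum (tens_linr _)).
  by apply: eq_bigr => k _; rewrite (lin_sum (tens_linr _)).
rewrite exchange_big4 (lin_sum (tmap_lin _ _)) (lin_sum (@tassoc_lin _ _ _ _)).
apply: eq_bigr => k _.
rewrite (lin_sum (tmap_lin _ _)) (lin_sum (@tassoc_lin _ _ _ _)); apply: eq_bigr => r _.
rewrite tmap_tens // down_eta_in.
pose B l (p : mor M (simpM l) (G (H (simpM x)))) (p' : mor M (G (simpM k)) (simpM l)) :=
  tens (Vdown_in F l w (ga ∘ bf_hom F p) : Vdown F) (tens (Vdown_in G k l p' : Vdown G)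
    (Vdown_in H x k (dbas bM r) : Vdown H)).
rewrite -[RHS](bas_shift (ub_ss M) bM (B := B)).
- rewrite (lin_sum (tens_linl _)) (lin_sum (@tassoc_lin _ _ _ _)); apply: eq_bigr => l _.
  rewrite (lin_sum (tens_linl _)) (lin_sum (@tassoc_lin _ _ _ _)); apply: eq_bigr => s _.
  by rewrite tassoc_tens /B bf_cmp cmpA.
- move=> l p; apply: (lin_comp (tens_linr _)); apply: (lin_comp (tens_linl _)).
  exact: (din_lin _ _ _).
- move=> l p; apply: (lin_comp (tens_linl _)); apply: (lin_comp (din_lin _ _ _)).
  exact: (lin_comp (cmp_linr _) (@bf_lin _ _ _ _ F _ _)).
Qed.

Lemma down_eta_assoc (F G H : opRev (FunCat M)) (v : Vdown (mten (mten F G) H)) :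
  tassoc (tmap (@down_eta F G) id (@down_eta (mten F G) H v))
  = tmap id (@down_eta G H) (@down_eta F (mten G H) (Vdown_map (massoc F G H) v)).
Proof.
pose A (t : tprod (Vdown (mten F G)) (Vdown H)) := tassoc (tmap (@down_eta F G) id t).
pose B (t : tprod (Vdown F) (Vdown (mten G H))) := tmap id (@down_eta G H) t.
apply: (@eq_lin_sum2 _ _ _ _ _ _ A B) => [||x w].
- exact: (lin_comp (@tassoc_lin _ _ _ _) (tmap_lin _ _)).
- exact: tmap_lin.
apply: etrans (@down_eta_assoc_comp F G H x w (Vdown_comp x w v)) _.
rewrite /B; congr (tmap _ _ _); apply: eq_bigr => k _; apply: eq_bigr => r _.
congr (tens (Vdown_in _ _ _ (_ ∘ _)) _).
by rewrite /Vdown_comp dsum_ofE; symmetry; apply: cmpm1.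
Qed.

Lemma Vdown_act_e (F : bimodFun M) (v : Vdown F) s x y :
  Vdown_comp x y (wact (e_ s) v : Vdown F) = if y == s then Vdown_comp x y v else 0.
Proof.
have lx := @Vdown_comp_lin _ _ _ _ sC sD bC bD bM d F x y.
rewrite (lin_sum (Vdown_act_linl v)) (lin_sum lx).
under eq_bigr => u _ do rewrite Vdown_act_unit.
have [->|ne] := eqVneq y s; last first.
  by rewrite big1 // => u _; rewrite Vdown_in_neq //; apply: contra ne => /eqP [_ ->].
rewrite (bigD1 x) //= Vdown_inK big1 ?addr0 // => u ux.
by rewrite Vdown_in_neq //; apply: contra ux => /eqP [->].
Qed.

(* For the identity functor, V_id and V^id have the same underlying space. *)
Definition down_one : Vdown bf_id := up_one sC sD bC bD bM d.
Definition down_unit (v : Vdown bf_id) : W := up_unit (v : Vup bf_id).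

Lemma Vdown_act_down_unit (F : bimodFun M) (v : Vdown bf_id) (u : Vdown F) x y :
  Vdown_comp x y (wact (down_unit v) u : Vdown F)
  = scal (Vdown_comp y y v) *: Vdown_comp x y u.
Proof.
have lx := @Vdown_comp_lin _ _ _ _ sC sD bC bD bM d F x y.
rewrite (lin_sum (Vdown_act_linl _)) (lin_sum lx).
under eq_bigr => s _ do rewrite (linZ (Vdown_act_linl _)) (linZ lx) Vdown_act_e.
rewrite (bigD1 y) //= eqxx big1 ?addr0 // => s /negbTE; rewrite eq_sym => ->.
by rewrite scaler0.
Qed.

Lemma Vdown_act_bf_id (h : W) (v : Vdown bf_id) :
  wact h v = wact h (v : Vup bf_id) :> Vup bf_id.
Proof.
move: h; apply: tube_ext => [||a b x z u w f g].
- exact: (@Vdown_act_linl _ _ _ _ sC sD bC bD bM d bf_id v).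
- exact: (@Vup_act_linl _ _ _ _ sC sD bC bD bM d bf_id v).
rewrite Vdown_act_gen Vup_act_gen bf_act_id bf_actV_id.
congr (Vup_in bf_id _ _ _); rewrite /= !cmpm1.
by [].
Qed.

Lemma down_lun (F : bimodFun M) (v : Vdown bf_id) (u : Vdown F) :
  Vdown_map (nt_runV F : mhom (bf_comp bf_id F : opRev (FunCat M)) F) (down_mu (tens v u))
  = wact (down_unit v) u :> Vdown F.
Proof.
apply: Vdown_comp_inj => x w; rewrite Vdown_map_comp down_mu_tens down_mul_comp cmpm1.
rewrite Vdown_act_down_unit (bigD1 w) //= {1}(simpleE (ub_ss M) (Vdown_comp w w v)).
rewrite cmpZm cmp1m big1 ?addr0 // => y yw.
by rewrite (simple_hom0 (ub_ss M) (Vdown_comp y w v)) // cmp0m.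
Qed.

Lemma down_run (F : bimodFun M) (v : Vdown F) :
  Vdown_map (nt_lunV F : mhom (bf_comp F bf_id : opRev (FunCat M)) F)
    (down_mu (tens v down_one)) = v :> Vdown F.
Proof.
apply: Vdown_comp_inj => x w; rewrite Vdown_map_comp down_mu_tens down_mul_comp cmpm1.
rewrite (bigD1 x) //= [Vdown_comp x x _](up_one_diag sC sD bC bD bM d) bf1 cmpm1.
rewrite big1 ?addr0 // => y; rewrite eq_sym => xy.
rewrite [Vdown_comp x y _](up_one_off sC sD bC bD bM d) //.
by rewrite (lin0 (@bf_lin _ _ _ _ F _ _)) cmpm0.
Qed.

Local Notation mu := (mu_of (V0 := Defs.Vdown sC sD bC bD bM d)
  (@down_mu K C D M sC sD bC bD bM d)).
Local Notation eta := (eta_of (V0 := Defs.Vdown sC sD bC bD bM d) down_eta).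

Lemma down_monoidal : is_monoidal_functor
  (@Vdown_map _ C D M sC sD bC bD bM d) mu eta (psi down_one).
Proof.
apply: (@monoidal_criterion K W (opRev (FunCat M)) _ _ _ _ _ down_unit
  (irrM M) (row_unit sC sD bC bD bM d) (fun k => Vdown_in bf_id k k (idm (simpM k)))).
- by move=> f; apply: Vdown_rep.
- by move=> f g t; apply: Vdown_map_hom.
- move=> f v; apply: (@Vdown_comp_inj _ _ _ _ sC sD bC bD bM d f) => x y.
  by rewrite (@Vdown_map_comp K C D M sC sD bC bD bM d f f) /= cmpm1.
- move=> f g h t s v; apply: (@Vdown_comp_inj _ _ _ _ sC sD bC bD bM d h) => x y.
  have mapE F G := @Vdown_map_comp K C D M sC sD bC bD bM d F G.
  by rewrite (mapE f h (nt_cmp s t) v) (mapE g h t (Vdown_map s v)) (mapE f g s v) cmpA.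
- by move=> f g; apply: down_mu_lin.
- by move=> f g; apply: down_eta_lin.
- by move=> f g; apply: down_muK.
- by move=> f g h t; apply: down_wact2.
- by move=> f f' g g' s t v u; apply: down_mu_nat.
- by move=> f g h v; apply: down_eta_assoc.
- exact: up_unit_lin.
- by move=> h; rewrite Vdown_act_bf_id; apply: up_epsL.
- by move=> v; rewrite Vdown_act_bf_id; apply: up_unitK.
- by rewrite tube_comul_one; apply: eq_bigr => k _; rewrite -[in LHS]up_unit_e.
- by move=> f v u; apply: down_lun.
- by move=> f v; apply: down_run.
Qed.
End VDownMonoidal.

Section Generators.
Variables (K : numClosedFieldType) (C D : unitaryFusion K) (M : unitaryBimod C D).
Variables (sC : standardSolutions C) (sD : standardSolutions D)
  (bC : dualBases (@simpF K C)) (bD : dualBases (@simpF K D))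
  (bM : dualBases (@simpM K C D M)) (d : irrM M -> K).
Local Notation W := (Tube sC sD bC bD bM d).
Local Notation Vdown F := (Vdown sC sD bC bD bM d (F : opRev (FunCat M))).
Local Notation Vup F := (Vup sC sD bC bD bM d (F : FunCat M)).
Local Notation in_lin F x y := (@Vup_in_lin K C D M sC sD bC bD bM d F x y).
Local Notation din_lin F x y := (@Vdown_in_lin K C D M sC sD bC bD bM d F x y).
Local Notation e_ := (tube_e sC sD bC bD bM d).

Lemma epsL_basis : basis_of (epsL_space W) [seq e_ s | s <- enum (irrM M)].
Proof.
have r1 := Vup_rep sC sD bC bD bM d bf_id.
have memU h := @mem_epsL_space K W _ _ _ r1 (@up_unit_lin K C D M sC sD bC bD bM d)
  (@up_epsL K C D M sC sD bC bD bM d) (@up_unitK K C D M sC sD bC bD bM d) h.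
pose phi x (h : W) : K^o := scal (Vup_comp x x (wact h (up_one sC sD bC bD bM d) : Vup bf_id)).
have lphi x : linear (phi x).
  apply: (@lin_comp _ _ _ _ (fun f : mor M (simpM x) (simpM x) => scal f : K^o)).
    exact: scal_lin.
  apply: (@lin_comp _ _ _ _ (fun v : Vup bf_id => Vup_comp x x v)).
    exact: Vup_comp_lin.
  exact: Vup_act_linl.
have phi_e x s : phi x (e_ s) = (x == s)%:R.
  rewrite /phi Vup_act_e up_one_diag; case: eqP => _.
    exact: (scal_idm (ub_ss M)).
  exact: (lin0 (@scal_lin _ _ _ _ x)).
rewrite basisEfree; apply/and3P; split.
- have := enum_uniq (irrM M); elim: (enum _) => [|x s IHs] /=; first by rewrite nil_free.
  case/andP=> xs us; rewrite free_cons IHs // andbT; apply/negP => e_in.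
  have /subvP /(_ _ e_in) : (<<[seq e_ s | s <- s]>> <= lker (linfun (phi x)))%VS.
    apply/span_subvP => _ /mapP [y ys ->]; rewrite memv_ker linfunE // phi_e.
    have -> : (x == y) = false by apply: contraNF xs => /eqP ->.
    by rewrite eqxx.
  by rewrite memv_ker linfunE // phi_e eqxx oner_eq0.
- apply/span_subvP => _ /mapP [s _ ->]; apply/memU.
  by exists (Vup_in bf_id s s (idm (simpM s))); rewrite up_unit_e.
suff : (epsL_space W <= <<[seq e_ s | s <- enum (irrM M)]>>)%VS.
  by move/dimvS/leq_trans; apply; apply: dim_span.
apply/subvP => h /memU [v ->]; apply: memv_suml => s _; apply: memvZ.
by apply/memv_span/map_f; rewrite mem_enum.
Qed.

Lemma up_rtens (F G : bimodFun M) x y w (al : mor M (simpM y) (F (simpM w)))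
    (be : mor M (simpM x) (G (simpM y))) :
  vsval (rtens (Vup_in F y w al : Vup F) (Vup_in G x y be : Vup G))
  = tens (Vup_in F y w al : Vup F) (Vup_in G x y be : Vup G).
Proof.
rewrite (rtens_val (Vup_rep sC sD bC bD bM d (bf_comp G F)) (@up_muK _ _ _ _ _ _ _ _ _ _ F G)
  (@up_wact2 _ _ _ _ _ _ _ _ _ _ F G)).
rewrite up_mu_tens up_mul_in up_eta_in.
pose B k (p : mor M (simpM k) (F (simpM w))) (p' : mor M (simpM y) (simpM k)) :=
  tens (Vup_in F k w p : Vup F) (Vup_in G x k (bf_hom G p' ∘ be) : Vup G).
have Br k p : linear (B k p).
  apply: (lin_comp (tens_linr _)); apply: (lin_comp (in_lin _ _ _)).
  exact: (lin_comp (cmp_linl _) (@bf_lin _ _ _ _ G _ _)).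
have Bl k p : linear (B k ^~ p).
  by apply: (lin_comp (tens_linl _)); apply: (in_lin _ _ _).
under eq_bigr => k _ do under eq_bigr => r _ do rewrite cmpA -bf_cmp.
rewrite -[LHS](bas_shift (ub_ss M) bM Br Bl).
rewrite (bas_simple (ub_ss M) bM (B := fun k p p' => B k (al ∘ p) p')) //.
  by rewrite /B cmpm1 bf1 cmp1m.
by move=> k p; apply: (lin_comp (Bl k p)); apply: cmp_linr.
Qed.

Lemma down_rtens (F G : bimodFun M) x y w (al : mor M (F (simpM y)) (simpM w))
    (be : mor M (G (simpM x)) (simpM y)) :
  vsval (rtens (Vdown_in F y w al : Vdown F) (Vdown_in G x y be : Vdown G))
  = tens (Vdown_in F y w al : Vdown F) (Vdown_in G x y be : Vdown G).
Proof.
rewrite (rtens_val (Vdown_rep sC sD bC bD bM d (bf_comp F G)) (@down_muK _ _ _ _ _ _ _ _ _ _ F G)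
  (@down_wact2 _ _ _ _ _ _ _ _ _ _ F G)).
rewrite down_mu_tens down_mul_in down_eta_in.
pose B k (p : mor M (simpM k) (simpM y)) (p' : mor M (G (simpM x)) (simpM k)) :=
  tens (Vdown_in F k w (al ∘ bf_hom F p) : Vdown F) (Vdown_in G x k p' : Vdown G).
have Br k p : linear (B k p).
  by apply: (lin_comp (tens_linr _)); apply: (din_lin _ _ _).
have Bl k p : linear (B k ^~ p).
  apply: (lin_comp (tens_linl _)); apply: (lin_comp (din_lin _ _ _)).
  exact: (lin_comp (cmp_linr _) (@bf_lin _ _ _ _ F _ _)).
under eq_bigr => k _ do under eq_bigr => r _ do rewrite -cmpA -bf_cmp.
rewrite [LHS](bas_shift (ub_ss M) bM Br Bl).
rewrite (bas_simple (ub_ss M) bM (B := fun k p p' => B k p (p' ∘ be))) //.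
  by rewrite /B cmp1m bf1 cmpm1.
by move=> k p; apply: (lin_comp (Br k p)); apply: cmp_linl.
Qed.
End Generators.

Theorem theorem23 (R : realType) (C D : unitaryFusion R[i]) (M : unitaryBimod C D)
    (M_indecomposable : indecomposable M)
    (sC : standardSolutions C) (sD : standardSolutions D)
    (bC : dualBases (@simpF _ C)) (bD : dualBases (@simpF _ D))
    (bM : dualBases (@simpM _ C D M))
    (dL dR : irrM M -> R[i])
    (dL_gt0 : forall m, 0 < dL m) (dR_gt0 : forall m, 0 < dR m)
    (dL_eq : forall a m, qdim sC a * dL m =
       \sum_n (\dim {: mor M (simpF a ⊳ simpM m) (simpM n)})%:R * dL n)
    (dR_eq : forall m b, dR m * qdim sD b =
       \sum_n (\dim {: mor M (simpM m ⊲ simpF b) (simpM n)})%:R * dR n)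
    (dLR : forall m, dL m = dR m) :
  let W := Tube sC sD bC bD bM dL in
  let e (s : irrM M) : W := tube_e sC sD bC bD bM dL s in
  let V := Vup sC sD bC bD bM dL in
  let V' := Vdown sC sD bC bD bM dL in
  [/\ basis_of (epsL_space W) [seq e s | s <- enum (irrM M)],
      exists (mu : forall f g : FunCat M, rten (V f) (V g) -> V (mten f g))
             (eta : forall f g : FunCat M, V (mten f g) -> rten (V f) (V g))
             (psi : rone W -> V (mone (FunCat M))),
        [/\ is_monoidal_functor
              (@Vup_map _ C D M sC sD bC bD bM dL) mu eta psi,
            forall (f g : bimodFun M) (x y w : irrM M)
                (alpha : mor M (simpM y) (f (simpM w)))
                (beta : mor M (simpM x) (g (simpM y))),
              let al : V f := Vup_in f y w alpha in
              let be : V g := Vup_in g x y beta in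
              vsval (rtens al be) = tens al be /\
              mu f g (rtens al be) = Vup_in (bf_comp g f) x w (bf_hom g alpha ∘ beta),
            forall s, psi (vsproj (epsL_space W) (e s))
                      = Vup_in bf_id s s (idm (simpM s)) &
            forall (f : bimodFun M) (x y : irrM M)
                (beta : mor M (simpM x) (f (simpM y))),
              let te : V bf_id := Vup_in bf_id y y (idm (simpM y)) in
              let be : V f := Vup_in f x y beta in
              Vup_map (mlun (f : FunCat M)) (mu (mone (FunCat M)) f (rtens te be)) = be] &
      exists (mu : forall f g : opRev (FunCat M), rten (V' f) (V' g) -> V' (mten f g))
             (eta : forall f g : opRev (FunCat M), V' (mten f g) -> rten (V' f) (V' g))
             (psi : rone W -> V' (mone (opRev (FunCat M)))),
        [/\ is_monoidal_functor
              (@Vdown_map _ C D M sC sD bC bD bM dL) mu eta psi,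
            forall (f g : bimodFun M) (x y w : irrM M)
                (alpha : mor M (f (simpM y)) (simpM w))
                (beta : mor M (g (simpM x)) (simpM y)),
              let al : V' f := Vdown_in f y w alpha in
              let be : V' g := Vdown_in g x y beta in
              vsval (rtens al be) = tens al be /\
              mu f g (rtens al be)
              = Vdown_in (bf_comp f g) x w (alpha ∘ bf_hom f beta) &
            forall s, psi (vsproj (epsL_space W) (e s))
                      = Vdown_in bf_id s s (idm (simpM s))]].
Proof.
move=> W e V V'; split.
- exact: epsL_basis.
- exists (mu_of (V0 := V) (@up_mu _ C D M sC sD bC bD bM dL)).
  exists (eta_of (V0 := V) (@up_eta _ C D M sC sD bC bD bM dL)).
  exists (psi (up_one sC sD bC bD bM dL)); split.
  + exact: up_monoidal.
  + move=> f g x y w al be a b; rewrite /mu_of up_rtens; split=> //.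
    by rewrite up_mu_tens up_mul_in.
  + move=> s; rewrite /e -up_unit_e.
    exact: (psi_j (Vup_rep sC sD bC bD bM dL bf_id) (@up_unit_lin _ _ _ _ _ _ _ _ _ _)
      (@up_epsL _ _ _ _ _ _ _ _ _ _) (@up_unitK _ _ _ _ _ _ _ _ _ _)).
  + move=> f x y be t b; rewrite /mu_of up_rtens [LHS]up_lun up_unit_e.
    apply: (@Vup_comp_inj _ _ _ _ sC sD bC bD bM dL f) => x' y'; rewrite Vup_act_e.
    case: eqP => // ne; rewrite Vup_in_neq //.
    by apply/eqP => -[_ ey]; case: ne.
- exists (mu_of (V0 := V') (@down_mu _ C D M sC sD bC bD bM dL)).
  exists (eta_of (V0 := V') (@down_eta _ C D M sC sD bC bD bM dL)).
  exists (psi (down_one sC sD bC bD bM dL)); split.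
  + exact: down_monoidal.
  + move=> f g x y w al be a b; rewrite /mu_of down_rtens; split=> //.
    by rewrite down_mu_tens down_mul_in.
  + move=> s; rewrite /e -up_unit_e.
    apply: (psi_j (Vdown_rep sC sD bC bD bM dL bf_id) (j := @down_unit _ _ _ _ sC sD bC bD bM dL)).
    * exact: up_unit_lin.
    * by move=> h; rewrite Vdown_act_bf_id; apply: up_epsL.
    * by move=> v; rewrite Vdown_act_bf_id; apply: up_unitK.
Qed.
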